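(* For any finitely generated free group $\mathbf{F}$ there exists a sequence of hyperoctahedral representations $\phi_i\in\mathrm{Hom}(\mathbf{F},B_{n_i})$, $i\in\mathbb{N}$, that strongly converges to the regular representation of $\mathbf{F}$.
   Context: For $n\in\mathbb{N}$, $B_n$ is the hyperoctahedral group of signed permutation matrices, i.e. the $n\times n$ matrices obtained from permutation matrices by replacing each entry $1$ by $+1$ or $-1$. A hyperoctahedral representation of a group $\Gamma$ is a homomorphism $\phi:\Gamma\to B_n$ for some $n$, extended linearly to $\phi:\mathbb{C}[\Gamma]\to M_n(\mathbb{C})$. The regular representation $\lambda$ of $\Gamma$ acts on $\ell^2(\Gamma)$ by $(\lambda(g)f)(h)=f(g^{-1}h)$, extended linearly to $\mathbb{C}[\Gamma]$. A sequence $\phi_i\in\mathrm{Hom}(\Gamma,B_{n_i})$ strongly converges to $\lambda$ if for every $z\in\mathbb{C}[\Gamma]$, $\lim_{i\to\infty}\|\phi_i(z)\|=\|\lambda(z)\|$, with operator norms on both sides. *)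

(* Defs.v *)
From HB Require Import structures.
From mathcomp Require Import all_boot all_order all_algebra all_fingroup.
From mathcomp Require Import finmap complex.
From mathcomp Require Import all_classical all_reals all_analysis.
Import numFieldNormedType.Exports.

Set Implicit Arguments.
Unset Strict Implicit.
Unset Printing Implicit Defensive.

Import Order.TTheory GRing.Theory Num.Theory.

Local Open Scope classical_set_scope.
Local Open Scope ring_scope.

Definition free_basis (F : groupType) (X : Type) (x : X -> F) : Prop :=
  forall (H : groupType) (h : X -> H),
    exists f : {multiplicative F -> H},
      (forall a, f (x a) = h a) /\
      (forall f' : {multiplicative F -> H},
         (forall a, f' (x a) = h a) -> forall g, f' g = f g).

Definition free_group (F : groupType) : Prop :=
  exists (X : Type) (x : X -> F), free_basis x.

Definition finitely_generated (F : groupType) : Prop :=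
  exists s : seq F, forall g : F,
    exists2 w : seq F,
      {subset w <= s ++ [seq y^-1%g | y <- s]} & g = (\prod_(y <- w) y)%g.

Definition group_algebra (R : realType) (G : groupType) : Type :=
  {fsfun G -> R[i] with 0}.

Definition linear_extension (R : realType) (G : groupType)
    (V : lmodType R[i]) (pi : G -> V) (z : group_algebra R G) : V :=
  \sum_(g <- finsupp z) z g *: pi g.

(* [normc] is the [R]-valued modulus on [R[i]]; [l2norm f] is +oo exactly when
   [f] is not in l^2(X). *)
Definition l2norm (R : realType) (X : choiceType) (f : X -> R[i]) : \bar R :=
  sqrte (\esum_(x in [set: X]) (Normc.normc (f x) ^+ 2)%:E).

Definition opnorm (R : realType) (X : choiceType)
    (T : (X -> R[i]) -> (X -> R[i])) : \bar R :=
  ereal_sup [set l2norm (T f) | f in [set f | (l2norm f <= 1)%E]].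

(* M_n(C) acting on C^n, seen as l^2('I_n). *)
Definition mxop (R : realType) (n : nat) (A : 'M[R[i]]_n)
    (v : 'I_n -> R[i]) : 'I_n -> R[i] :=
  fun k => \sum_(j < n) A k j * v j.

(* The formula makes sense on all functions [G -> R[i]]; [opnorm] only sees its
   restriction to l^2(G). *)
Definition regular_rep (R : realType) (G : groupType) (g : G) :
    (G -> R[i]) -> (G -> R[i]) :=
  fun f h => f (g^-1 * h)%g.

Definition signed_perm_mx (R : realType) (n : nat) (A : 'M[R[i]]_n) : Prop :=
  exists2 P : 'M[R[i]]_n, is_perm_mx P &
    forall k j, A k j = P k j \/ A k j = - P k j.

Definition hyperoctahedral_rep (R : realType) (G : groupType) (n : nat)
    (phi : G -> 'M[R[i]]_n) : Prop :=
  [/\ forall g, signed_perm_mx (phi g),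
      phi 1%g = 1%:M &
      forall g h, phi (g * h)%g = phi g *m phi h].

(* Both operator norms are finite, being at most the sum of the moduli of the
   coefficients of [z], so convergence in [\bar R] is convergence of reals. *)
Definition strongly_converges_to_regular (R : realType) (G : groupType)
    (n : nat -> nat) (phi : forall i, G -> 'M[R[i]]_(n i)) : Prop :=
  forall z : group_algebra R G,
    opnorm (mxop (linear_extension (phi i) z)) @[i --> \oo] -->
    opnorm (linear_extension (@regular_rep R G) z).

(* Main.v *)
(* The upper bound is the heart of the matter. A ping-pong argument maps F to
   Q = GL_2(Z/m) in such a way that no nontrivial reduced word of length at most g dies,
   while |Q| is at most exponential in g. Put independent uniform signs on the edges of the
   Cayley graph of Q: F then acts on C^Q by signed permutations. Let y = z^* z with
   ||lambda(z)|| <= 1. The trace of phi(y)^k averages to a sum of the coefficients of y^k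
   over the words w which, read from some vertex, cross every edge an even number of times.
   Take k = K g. Cut the walk of w into blocks of length g/2: two blocks meet in a single
   path since there are no short cycles, so w splits into boundedly many segments (in terms
   of K), each of which occurs at least twice up to inversion. Decomposing the walks on the
   tree at their last entrance into the successive cones of w bounds the coefficient of y^k
   at w by a product over the segments v of G(v), where the l^2 norm of G is polynomial in k
   because lambda(y) is a contraction. As each segment occurs twice, the sum over these words
   is polynomial in k, with degree depending on K only. Hence ||phi(z)||^(2k) is at most
   |Q|^2 times a polynomial in k, and taking 2k-th roots with K and then g large gives
   ||phi(z)|| <= 1 + epsilon for any finite family of z.
   The lower bound transports a finitely supported almost maximizing vector to an orbit in Q,
   on which a large ball of F is injective. *)
Require Import Defs.
From HB Require Import structures.
From mathcomp Require Import all_boot all_order all_algebra all_fingroup.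
From mathcomp Require Import finmap complex.
From mathcomp Require Import all_classical all_reals all_analysis.
From mathcomp Require Import zify ring lra.
Import numFieldNormedType.Exports.

Set Implicit Arguments.
Unset Strict Implicit.
Unset Printing Implicit Defensive.

Import Order.TTheory GRing.Theory Num.Theory.
Import Normc.

(** * Reduced words and ping-pong in SL_2(Z) *)

(** The obstacle is that [y] has complex coefficients: replacing them by their moduli would in
    general increase the norm of lambda(y), so no comparison with a positive random walk is
    available. The only control is the l^2 contraction. Truncation to a cone preserves it, which is
    why moduli are taken only after the walks have been cut at cones. The signs play the role that
    removing the constant vectors plays for permutation representations: no invariant vector has to
    be split off. Only the upper bound selects signs, by averaging a sum of moments over the whole
    finite family; the lower bound holds for every choice. Operator norms are recovered from traces
    without a spectral theorem, by taking square roots one at a time, so all moments have exponents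
    that are powers of two. One sequence must serve all of C[F]. The norms are 1-Lipschitz for the
    l^1 norm of the coefficients and the sums with rational complex coefficients are countable and
    l^1-dense, so the i-th representation only has to handle the first i + 1 of them up to 1/(i +
    1). *)

Section Words.
Variable X : eqType.

Definition letter : Type := (X * bool)%type.
Definition linv (a : letter) : letter := (a.1, ~~ a.2).
Definition winv (w : seq letter) : seq letter := rev (map linv w).
Definition nobt (a b : letter) := b != linv a.
Definition reduced (w : seq letter) := sorted nobt w.

Lemma linvK : involutive linv.
Proof. by case=> i b; rewrite /linv /= negbK. Qed.

Lemma nobt_linv a b : nobt (linv b) (linv a) = nobt a b.
Proof.
rewrite /nobt linvK; apply/idP/idP; apply: contra => /eqP.
  by move=> ->.
by move=> ->.
Qed.

Lemma winv_cat u v : winv (u ++ v) = winv v ++ winv u.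
Proof. by rewrite /winv map_cat rev_cat. Qed.

Lemma size_winv w : size (winv w) = size w.
Proof. by rewrite size_rev size_map. Qed.

Lemma reduced_winv w : reduced (winv w) = reduced w.
Proof.
rewrite /reduced /winv rev_sorted sorted_map.
by apply: eq_sorted => a b /=; rewrite /relpre /= nobt_linv.
Qed.

Lemma reduced_catl u v : reduced (u ++ v) -> reduced u.
Proof. by rewrite /reduced; case: u => //= a u; rewrite cat_path => /andP[]. Qed.

Lemma reduced_catr u v : reduced (u ++ v) -> reduced v.
Proof.
rewrite /reduced; case: u => //= a u; rewrite cat_path => /andP[_].
by case: v => //= b v /andP[].
Qed.

Definition push (a : letter) (w : seq letter) :=
  if w is b :: w' then if b == linv a then w' else a :: w else [:: a].

Definition red (w : seq letter) := foldr push [::] w.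

Lemma reduced_push a w : reduced w -> reduced (push a w).
Proof.
case: w => //= b w; case: ifP => [_|/negbT ba] /=; last by move=> ->; rewrite andbT.
by case: w => //= c w /andP[].
Qed.

Lemma reduced_red w : reduced (red w).
Proof. by elim: w => //= a w IH; exact: reduced_push. Qed.

Lemma size_red w : size (red w) <= size w.
Proof.
elim: w => //= a w; rewrite /push; case: (red w) => //= b v le.
by case: ifP => _ /=; rewrite ?ltnS // ltnW // ltnW.
Qed.

Section Ev.
Variables (F : groupType) (x : X -> F).
Local Open Scope group_scope.

Definition gl (a : letter) : F := if a.2 then x a.1 else (x a.1)^-1.
Fixpoint ev (w : seq letter) : F := if w is a :: w' then gl a * ev w' else 1.

Lemma gl_linv a : gl (linv a) = (gl a)^-1.
Proof. by case: a => i []; rewrite /gl /= ?invgK. Qed.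

Lemma ev_cat u v : ev (u ++ v) = ev u * ev v.
Proof. by elim: u => [|a u IH] /=; rewrite ?mul1g // IH mulgA. Qed.

Lemma ev_winv w : ev (winv w) = (ev w)^-1.
Proof.
elim: w => [|a w IH]; first by rewrite /= invg1.
by rewrite -cat1s winv_cat !ev_cat IH /= gl_linv !mulg1 invgM.
Qed.

Lemma ev_push a w : ev (push a w) = gl a * ev w.
Proof.
case: w => //= b w; case: ifP => //= /eqP ->.
by rewrite gl_linv mulgA mulgV mul1g.
Qed.

Lemma ev_red w : ev (red w) = ev w.
Proof. by elim: w => //= a w IH; rewrite ev_push IH. Qed.

Hypothesis faith : forall w, reduced w -> ev w = 1 -> w = [::].

(** If the first letters differ, [winv u ++ v] is already reduced, so [faith] would make it empty;
    equal first letters are cancelled. *)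
Lemma ev_inj u v : reduced u -> reduced v -> ev u = ev v -> u = v.
Proof.
elim: u v => [|a u IH] [|b v] // ru rv e.
- by rewrite (@faith (b :: v)).
- by rewrite (@faith (a :: u)).
have [eab|neq] := eqVneq a b.
  move: e; rewrite /= eab => /mulgI e; congr (_ :: _); apply: IH => //.
    by case: (u) ru => //= c s /andP[].
  by case: (v) rv => //= c s /andP[].
have : reduced (winv (a :: u) ++ b :: v).
  have := ru; rewrite -reduced_winv /reduced /winv /= rev_cons.
  case E : (rev (map linv u)) => [|c s] /=.
    by move: rv; rewrite /reduced /= => ->; rewrite andbT /nobt linvK eq_sym.
  rewrite cat_path !rcons_path last_rcons => /andP[-> ->] /=.
  by move: rv; rewrite /reduced /= => ->; rewrite andbT /nobt linvK eq_sym.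
move=> /faith; rewrite ev_cat ev_winv e mulVg => /(_ erefl) /(congr1 size).
by rewrite size_cat /= addnS.
Qed.

End Ev.

Section Morph.
Variables (F H : groupType) (f : {multiplicative F -> H}).
Local Open Scope group_scope.

Lemma mult1 : f 1 = 1.
Proof. by apply: (@mulgI _ (f 1)); rewrite -gmulfM !mulg1. Qed.

Lemma multV g : f g^-1 = (f g)^-1.
Proof. by apply: (@mulgI _ (f g)); rewrite -gmulfM !mulgV mult1. Qed.

Lemma ev_morph (x : X -> F) w : f (ev x w) = ev (f \o x) w.
Proof.
elim: w => [|a w IH] /=; first exact: mult1.
by rewrite gmulfM IH; case: a => i []; rewrite /gl /= ?multV.
Qed.
End Morph.

End Words.

Section Sanov.
Variable n : nat.
Local Open Scope ring_scope.

Definition sg (b : bool) : int := if b then 1 else -1.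

(** The pair (x, y) stands for the projective point x/y. The quantity p = x - i y is preserved and y
    becomes y ± 6 p, so this is a parabolic map fixing i. The intervals of radius 1/2 around
    distinct integers are disjoint, and 6 is large enough: |y| <= 2 |p| forces |y ± 6 p| >= 4
    |p|. *)
Definition mob (a : letter 'I_n) (v : int * int) : int * int :=
  let p := v.1 - (a.1 : nat)%:Z * v.2 in
  let q := v.2 + sg a.2 * 6 * p in (p + (a.1 : nat)%:Z * q, q).

(* The two half-neighbourhoods of the fixed point [i] of the parabolic [mob (i, _)]. *)
Definition halfnb (a : letter 'I_n) (v : int * int) : bool :=
  let p := v.1 - (a.1 : nat)%:Z * v.2 in
  (2 * `|p| < `|v.2|) && (0 < sg a.2 * p * v.2).

Lemma halfnb_aux (p q s : int) : (s = 1 \/ s = -1) -> p != 0 ->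
  (`|q| <= 2 * `|p|) || (0 < s * p * q) ->
  (2 * `|p| < `|q + s * 6 * p|) && (0 < s * p * (q + s * 6 * p)).
Proof.
move=> hs p0 h; wlog sE : p q s hs p0 h / s = 1.
  move=> H; case: hs => hs; first by apply: H => //; left.
  have := H (- p) q 1 (or_introl erefl); rewrite oppr_eq0 normrN => /(_ p0).
  by rewrite hs !mulN1r !mul1r !mulNr mulrN in h *; move=> /(_ h erefl).
move: h; rewrite sE !mul1r => h; wlog p1 : p q hs p0 h / 0 < p.
  move=> H; case: (ltgtP p 0) p0 => // hp _; last by apply: H => //; lia.
  have := H (- p) (- q) hs; rewrite oppr_eq0 !normrN mulrNN => H'.
  have {H'}: (2 * `|p| < `|q + 6 * p|) && (0 < p * (q + 6 * p)).
    have := H' _ _ _; rewrite mulrN -opprD normrN mulrNN; apply => //; lia.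
  by [].
case/orP: h => h; last first.
  have q0 : 0 < q by rewrite pmulr_rgt0 in h.
  by rewrite pmulr_rgt0 //; lia.
by rewrite pmulr_rgt0 //; lia.
Qed.

Lemma mob_dom_init c : halfnb c (mob c (1, 2)).
Proof.
case: c => j s; rewrite /halfnb /mob /= addrK; apply: halfnb_aux.
- by case: s; [left|right].
- by apply/eqP; lia.
by apply/orP; left; lia.
Qed.

Lemma mob_dom a c v : nobt a c -> halfnb a v -> halfnb c (mob c v).
Proof.
case: a c v => i t [j s] [x y]; rewrite /nobt /linv /= xpair_eqE negb_and.
rewrite /halfnb /mob /= addrK => h /andP[h1 h2].
have key : i != j -> `|y| <= `|(i : nat)%:Z * y - (j : nat)%:Z * y|.
  move=> ij; rewrite -mulrBl normrM ler_peMl // -gtz0_ge1 normr_gt0 subr_eq0.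
  by apply: contra ij => /eqP[/val_inj ->].
apply: halfnb_aux.
- by case: s {h}; [left|right].
- have [e|ne] := eqVneq i j.
    by apply/eqP => p0; move: h2; rewrite e p0 mulr0 mul0r.
  by apply/eqP; have := key ne; lia.
have [e|ne] := eqVneq i j.
  by move: h; rewrite e eqxx /= => /negbTE st; apply/orP; right; move: h2; rewrite e; case: s st; case: t.
by apply/orP; left; have := key ne; lia.
Qed.

Definition orbit_pt (w : seq (letter 'I_n)) : int * int := foldl (fun v a => mob a v) (1, 2) w.

(** The image of (1, 2) lies in the half-neighbourhood of the last letter, whereas (1, 2) itself,
    that is the point 1/2, is at distance at least 1/2 from every integer and lies in none of
    them. *)
Lemma orbit_pt_neq w : reduced w -> w != [::] -> orbit_pt w != (1, 2).
Proof.
move=> rw wN; suff : exists2 c, halfnb c (orbit_pt w) & true.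
  by case=> -[j s] + _; apply: contraTneq => ->; rewrite /halfnb /=; lia.
elim/last_ind: w rw wN => // w c IH rw _.
rewrite /orbit_pt -cats1 foldl_cat /= -/(orbit_pt w).
suff [] : halfnb c (mob c (orbit_pt w)) /\ true by exists c.
split=> //; clear IH.
elim/last_ind: w c rw => [|w b IH] c rw; first exact: mob_dom_init.
rewrite /orbit_pt -cats1 foldl_cat /= -/(orbit_pt w).
apply: (@mob_dom b); last first.
  by apply: IH; move: rw; rewrite -!cats1 => /reduced_catl.
by move: rw; rewrite /reduced -!cats1 -catA; case: w {IH} => [|d w] /=; rewrite ?cat_path /= ?andbT // => /and3P[].
Qed.

(** Bounds the expansion of the maximum norm by one letter: the first coordinate grows by at most
    [6n(n+1) + 1], the second by at most [6n + 7]. *)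
Definition growth : nat := 6 * n ^ 2 + 6 * n + 7.

Lemma mob_growth c v (B : nat) : `|v.1| <= B%:Z -> `|v.2| <= B%:Z ->
  `|(mob c v).1| <= (growth * B)%:Z /\ `|(mob c v).2| <= (growth * B)%:Z.
Proof.
case: c v => j s [x y] /= hx hy; rewrite /mob /=.
have jn : (j : nat)%:Z <= n%:Z by rewrite lez_nat ltnW.
have h1 : `|(j : nat)%:Z * y| <= n%:Z * B%:Z by rewrite normrM ler_pM.
have h2 : `|x - (j : nat)%:Z * y| <= (1 + n%:Z) * B%:Z.
  by rewrite mulrDl mul1r (le_trans (ler_normB _ _)) // lerD.
have h3 : `|sg s * 6 * (x - (j : nat)%:Z * y)| <= 6 * (1 + n%:Z) * B%:Z.
  by rewrite -mulrA normrM normrM; case: s => /=; lia.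
have h4 : `|y + sg s * 6 * (x - (j : nat)%:Z * y)| <= (7 + 6 * n%:Z) * B%:Z by lia.
have gE : (growth * B)%:Z = (6 * n%:Z * n%:Z + 6 * n%:Z + 7) * B%:Z.
  by rewrite /growth !PoszM !PoszD !PoszM; lia.
rewrite gE; split; last by apply: (le_trans h4); nia.
have h5 : `|(j : nat)%:Z * (sg s * 6 * (x - (j : nat)%:Z * y))| <= n%:Z * (6 * (1 + n%:Z) * B%:Z).
  by rewrite normrM ler_pM.
by rewrite mulrDr; nia.
Qed.

Lemma orbit_pt_le w : `|(orbit_pt w).1| <= (2 * growth ^ size w)%:Z /\
  `|(orbit_pt w).2| <= (2 * growth ^ size w)%:Z.
Proof.
elim/last_ind: w => [|w c [IH1 IH2]] //=.
rewrite /orbit_pt -cats1 foldl_cat /= -/(orbit_pt w) cats1 size_rcons expnS mulnCA.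
exact: mob_growth.
Qed.

End Sanov.

(** * Reduction modulo m: quotients of large girth and controlled size *)

Section SanovMod.
Variables (n m : nat).
Local Open Scope ring_scope.
Let A := 'Z_m.

Definition lmx (a : letter 'I_n) : 'M[A]_2 :=
  let i : A := (a.1 : nat)%:R in let s : A := (sg a.2 * 6)%:~R in
  \matrix_(r, c) (if (r == 0) then (if c == 0 then 1 + s * i else s)
                  else (if c == 0 then - (s * i * i) else 1 - s * i)).

Lemma lmxV a : lmx a *m lmx (linv a) = 1%:M.
Proof.
apply/matrixP => r c; rewrite !mxE !big_ord_recl big_ord0 addr0 !mxE /=.
have -> : (sg (~~ a.2) * 6)%:~R = - ((sg a.2 * 6)%:~R) :> A.
  by rewrite -rmorphN /=; case: a.2.
move: ((sg a.2 * 6)%:~R) => s; move: ((a.1 : nat)%:R : A) => i.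
case: r c => [[|[|//]] hr] [[|[|//]] hc]; rewrite -!val_eqE /=; ring.
Qed.

Definition ptmx (v : int * int) : 'rV[A]_2 := \row_c (if c == 0 then v.1%:~R else v.2%:~R).

Lemma ptmx_mob a v : ptmx v *m lmx a = ptmx (mob a v).
Proof.
apply/rowP => c; rewrite !mxE !big_ord_recl big_ord0 addr0 !mxE /=.
case: v => x y; rewrite /mob /= !(rmorphM, rmorphD, rmorphB) /=.
set i : A := (_%:Z)%:~R; have -> : (a.1 : nat)%:R = i by [].
move: ((sg a.2)%:~R : A) => s.
by case: c => [[|[|//]] hc]; rewrite -!val_eqE /=; ring.
Qed.

Lemma lmx_unit a : lmx a \is a GRing.unit.
Proof. by case: (mulmx1_unit (lmxV a)). Qed.

Definition lgl (i : 'I_n) : {'GL_2[A]} := FinRing.unit ('M[A]_2 : finUnitRingType) (lmx_unit (i, true)).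

Lemma gl_lgl a : GLval (gl (lgl : 'I_n -> {'GL_2[A]}) a) = lmx a.
Proof.
case: a => i [] //=; rewrite /gl /=; change (invmx (lmx (i, true)) = lmx (i, false)).
apply: (@can_inj _ _ (mulmx (lmx (i, true))) (mulmx (invmx (lmx (i, true))))) => [B|].
  by rewrite mulKmx //; exact: lmx_unit.
by rewrite mulmxV ?lmxV //; exact: lmx_unit.
Qed.

Lemma ptmx_ev v w : ptmx v *m GLval (ev (lgl : 'I_n -> {'GL_2[A]}) w) = ptmx (foldl (fun v a => mob a v) v w).
Proof.
elim: w v => [|a w IH] v; first by rewrite mulmx1.
have -> : ev (lgl : 'I_n -> {'GL_2[A]}) (a :: w) = (gl (lgl : 'I_n -> {'GL_2[A]}) a * ev (lgl : 'I_n -> {'GL_2[A]}) w)%g by [].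
by rewrite GL_MxE mulmxA gl_lgl ptmx_mob IH.
Qed.
End SanovMod.

Section Girth.
Variables (n g : nat).
(** A word of length at most [g] moves (1, 2) to a point whose coordinates differ from 1 and 2 by at
    most [2 * growth n ^ g + 2], which is below this modulus; a congruence with (1, 2) is then an
    equality. *)
Definition modulus : nat := 4 * growth n ^ g + 3.
Notation A := 'Z_modulus.

Lemma modulus_gt1 : 1 < modulus. Proof. by rewrite /modulus; lia. Qed.

Lemma intr_Zp_eq0 (c : int) : (c%:~R = 0 :> A)%R -> (`|c| < modulus%:Z)%R -> c = 0%R.
Proof.
have H k : (k%:R = 0 :> A)%R -> k < modulus -> k = 0.
  move=> e km; have := val_Zp_nat modulus_gt1 k; rewrite e modn_small //=.
case: c => k.
  by rewrite -pmulrn => e km; congr Posz; apply: H => //.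
rewrite NegzE mulrNz -pmulrn => /eqP; rewrite oppr_eq0 => /eqP e km.
by have := H _ e; rewrite normrN in km => /(_ km).
Qed.

Lemma sanov_girth w : reduced w -> w != [::] -> size w <= g ->
  ev (lgl modulus : 'I_n -> {'GL_2[A]}) w <> 1%g.
Proof.
move=> rw wN sw e; have := ptmx_ev modulus (1, 2)%R w; rewrite e GL_1E mulmx1 -/(orbit_pt w).
have := orbit_pt_neq rw wN; have [] := orbit_pt_le w; case: (orbit_pt w) => x y /= hx hy.
have hg : 2 * growth n ^ size w <= 2 * growth n ^ g.
  by rewrite leq_mul2l leq_pexp2l // /growth; lia.
move=> /negP h /rowP h'; apply: h.
have h0 := h' (0%R : 'I_2); have h1 := h' (1%R : 'I_2); move: h0 h1; rewrite !mxE /=.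
have fin (b c : int) : (`|b| <= 2)%R -> (`|c| <= (2 * growth n ^ size w)%:Z)%R -> (b%:~R = c%:~R :> A)%R -> c = b.
  move=> b2 cs bc; apply/eqP; rewrite -subr_eq0; apply/eqP; apply: intr_Zp_eq0.
    by rewrite rmorphB /= bc subrr.
  by rewrite /modulus; have := ler_normB c b; lia.
by move=> /fin -> // /fin -> //.
Qed.

Lemma card_sanov : #|{: {'GL_2[A]}}| <= (7 * growth n ^ g) ^ 4.
Proof.
apply: (@leq_trans #|{: 'M[A]_2}|); first by rewrite card_sub max_card.
rewrite card_mx card_ord Zp_cast ?modulus_gt1 // -[(2 * 2)%N]/4 leq_exp2r // /modulus.
have : 0 < growth n ^ g by rewrite expn_gt0 /growth; lia.
lia.
Qed.
End Girth.

(** * Consequences of the universal property: generation, finite bases, faithfulness *)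

Section Generation.
Variables (X : eqType) (F : groupType) (x : X -> F).
Local Open Scope group_scope.

Definition gens : {pred F} := [pred g | `[< exists w, g = ev x w >]].

Lemma gens_closed : group_closed gens.
Proof.
split; first by apply/asboolP; exists [::].
move=> u v /asboolP[w ->] /asboolP[w' ->]; apply/asboolP; exists (w ++ winv w').
by rewrite ev_cat ev_winv.
Qed.

Definition gen_sub := {g : F | g \in gens}.
HB.instance Definition _ := [Choice of gen_sub by <:].
HB.instance Definition _ := SubType.on gen_sub.
HB.instance Definition _ := SubChoice_isSubGroup.Build F (mem gens) gen_sub gens_closed.

(** The universal property yields a map from [F] to the subgroup of values of words; composed with
    the inclusion it fixes the basis, so by uniqueness it is the identity of [F]. *)
Lemma free_basis_gen : free_basis x -> forall g, exists w, g = ev x w.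
Proof.
move=> fb g; have hx a : x a \in gens by apply/asboolP; exists [:: (a, true)]; rewrite /= mulg1.
have [f [fx _]] := fb gen_sub (fun a => Sub (x a) (hx a)).
have [f0 [_ uniq]] := fb F x.
have e1 : f0 g = g by rewrite -(uniq idfun).
have := uniq ((val : gen_sub -> F) \o f : {multiplicative F -> F}).
rewrite /= => /(_ _ g); rewrite e1 => <-; first by have /asboolP := valP (f g).
by move=> a /=; rewrite fx.
Qed.
End Generation.

Lemma ev_eq1 (X : eqType) (F : groupType) (y : X -> F) (w : seq (letter X)) :
  (forall a, a \in map fst w -> y a = 1%g) -> ev y w = 1%g.
Proof.
elim: w => //= -[a b] w IH h; rewrite IH ?mulg1; last first.
  by move=> c cw; apply: h; rewrite inE cw orbT.
by rewrite /gl /=; case: b h => h; rewrite h ?inE ?eqxx ?invg1.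
Qed.

Lemma finite_free_basis (F : groupType) : free_group F -> finitely_generated F ->
  exists (n : nat) (x : 'I_n -> F), free_basis x.
Proof.
move=> [X0 [x0 fb0]] [s hs]; pose X : choiceType := {classic X0}.
pose x : X -> F := x0; have fb : free_basis x by exact: fb0.
have [W hW] := choice (free_basis_gen fb).
pose l := undup (flatten [seq map fst (W y) | y <- s]).
have hl a : a \in l.
  (* The given generators use only the letters in [l]. For a letter [a] outside [l], the morphism
     sending [a] to a transposition and the other letters to 1 would kill all generators, hence [a]
     itself. *)
  apply: contrapT => /negP al.
  pose h (b : X) : {perm bool} := if b == a then tperm true false else 1%g.
  have [f [fx _]] := fb {perm bool} h.
  have fs y : y \in s -> f y = 1%g.
    move=> ys; rewrite (hW y) (ev_morph f); apply: ev_eq1 => b bW /=.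
    rewrite fx /h; case: eqP => // ba; move: al; rewrite -ba mem_undup.
    by move=> /negP[]; apply/flattenP; exists (map fst (W y)) => //; apply: map_f.
  have f1 g : f g = 1%g.
    have [w ws ->] := hs g; elim: w ws => [|y w IH] ws.
      by rewrite big_nil mult1.
    rewrite big_cons gmulfM IH ?mulg1; last by move=> z zw; apply: ws; rewrite inE zw orbT.
    have := ws y (mem_head _ _); rewrite mem_cat => /orP[/fs//|/mapP[z zs ->]].
    by rewrite multV fs // invg1.
  have := fx a; rewrite f1 /h eqxx => /permP/(_ true).
  by rewrite perm1 tpermL.
have idx_lt a : index a l < size l by rewrite index_mem.
exists (size l), (fun i => x (tnth (in_tuple l) i)) => H h.
pose idx a := Ordinal (idx_lt a).
have tn a : tnth (in_tuple l) (idx a) = a by rewrite (tnth_nth a) /= nth_index.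
have [f [fx uniq]] := fb H (h \o idx); exists f; split.
  move=> i; rewrite fx /=; congr h; apply: val_inj => /=.
  have a0 := tnth (in_tuple l) i.
  by rewrite (tnth_nth a0) /= index_uniq // undup_uniq.
by move=> f' hf' g; apply: uniq => a /=; rewrite -hf' tn.
Qed.

(** The universal property maps [F] to the ping-pong quotient whose girth parameter is the length of
    [w], and [w] survives there unless it is empty. *)
Lemma free_basis_faithful n (F : groupType) (x : 'I_n -> F) : free_basis x ->
  forall w, reduced w -> ev x w = 1%g -> w = [::].
Proof.
move=> fb w rw e1; apply/eqP; apply: contraT => wN.
have [f [fx _]] := fb _ (@lgl n (modulus n (size w))).
case: (@sanov_girth n (size w) w rw wN (leqnn _)).
have := congr1 f e1; rewrite mult1 ev_morph => <-.
by congr (ev _ w); apply: funext => i; rewrite -fx.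
Qed.

(** * Cutting a long walk into few repeated segments *)

(* [c] maps the index of a segment to the representative of its class: no class is a singleton. *)
Definition goodpat m (c : {ffun 'I_m -> 'I_m}) := [forall i, exists j, (j != i) && (c j == c i)].

Section Intervals.
Variable cut : pred nat.

Fixpoint segs (a n : nat) : seq (nat * nat) :=
  if n is n'.+1 then
    if segs a.+1 n' is (c, d) :: r then
      if cut a.+1 then (a, a.+1) :: (c, d) :: r else (a, d) :: r
    else [:: (a, a.+1)]
  else [::].

Lemma segs_flatten a n : flatten [seq iota iv.1 (iv.2 - iv.1) | iv <- segs a n] = iota a n /\
  (forall iv, iv \in segs a n -> iv.1 < iv.2) /\ (if segs a n is iv :: _ then iv.1 = a else n = 0).
Proof.
elim: n a => [|n IH] a //=; have [IH1 [IH2 IH3]] := IH a.+1.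
case E : (segs a.+1 n) IH1 IH2 IH3 => [|[c d] r] /= IH1 IH2 IH3.
  by rewrite IH3 subSnn; split=> //; split=> // iv; rewrite inE => /eqP ->.
have cd := IH2 (c, d) (mem_head _ _); rewrite /= in cd.
case: ifP => _ /=; rewrite ?subSnn -IH1 /=.
  by split=> //; split=> // iv; rewrite inE => /orP[/eqP ->//|/IH2].
rewrite IH3 in cd *; split; last first.
  split=> // iv; rewrite inE => /orP[/eqP ->/=|Ir]; first by lia.
  by apply: IH2; rewrite inE Ir orbT.
by rewrite (_ : d - a = (d - a.+1).+1) //; lia.
Qed.

Lemma segs_prop a n iv : iv \in segs a n ->
  [/\ iv.1 < iv.2 <= a + n, (iv.2 == a + n) || cut iv.2 & forall i, iv.1 < i < iv.2 -> ~~ cut i].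
Proof.
elim: n a iv => [|n IH] a iv //=; have [_ [_]] := segs_flatten a.+1 n.
case E : (segs a.+1 n) (IH a.+1) => [|[c d] r] {}IH /=.
  by move=> ->; rewrite inE => /eqP -> /=; split; rewrite ?addn1 ?ltnSn ?eqxx // => i; lia.
move=> ca; have {}IH jv : jv \in (c, d) :: r ->
   [/\ jv.1 < jv.2 <= a + n.+1, (jv.2 == a + n.+1) || cut jv.2 & forall i, jv.1 < i < jv.2 -> ~~ cut i].
  by move=> /IH; rewrite addSnnS.
have [/= h1 h2 h3] := IH (c, d) (mem_head _ _).
case: ifP => cuta; rewrite inE => /orP[/eqP ->|Ir] /=; try exact: IH.
- by rewrite cuta orbT; split=> // [|i]; lia.
- split=> // [|i]; first by lia.
  move=> /andP[ai id]; have [->|ne] := eqVneq i a.+1; first by rewrite cuta.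
  by apply: h3; lia.
by apply: IH; rewrite inE Ir orbT.
Qed.

Lemma size_segs a n : size (segs a n) <= (count cut (iota a.+1 n)).+1.
Proof.
(* A cut at the right end [a + n] opens no new segment, and the induction needs the count without
   it. *)
suff: size (segs a n) <= (count cut (iota a.+1 n.-1)).+1.
  move=> /leq_trans; apply; rewrite ltnS; case: n => // n.
  by rewrite -{2}[n.+1]addn1 iotaD count_cat leq_addr.
elim: n a => [|n IH] a //=; have := IH a.+1; have [_ [_]] := segs_flatten a.+1 n.
case E : (segs a.+1 n) => [|[c d] r] //=.
by case: n {IH} E => // n E _ /=; case: ifP.
Qed.
End Intervals.

Section Segmentation.
Variables (X Q : finType) (act : letter X -> Q -> Q).
Hypothesis actK : forall a q, act (linv a) (act a q) = q.
Variables (h g : nat).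
Hypothesis h0 : 0 < h.
Hypothesis hg : 2 * h <= g.

Definition walk (q : Q) (u : seq (letter X)) : Q := foldl (fun q a => act a q) q u.

Hypothesis walk_uniq : forall q u v, reduced u -> reduced v -> size u + size v <= g ->
  walk q u = walk q v -> u = v.

Lemma walk_cat q u v : walk q (u ++ v) = walk (walk q u) v.
Proof. by rewrite /walk foldl_cat. Qed.

Lemma walk_winv q u : walk (walk q u) (winv u) = q.
Proof.
elim: u q => //= a u IH q; rewrite /winv /= rev_cons -cats1 walk_cat IH /=.
exact: actK.
Qed.

(* The undirected edge between [q] and [act (i, true) q] is encoded as [(q, i)]. *)
Definition ledge (q : Q) (a : letter X) : Q * X := (if a.2 then q else act a q, a.1).

Fixpoint epath (q : Q) (u : seq (letter X)) : seq (Q * X) :=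
  if u is a :: u' then ledge q a :: epath (act a q) u' else [::].

Lemma epath_cat q u v : epath q (u ++ v) = epath q u ++ epath (walk q u) v.
Proof. by elim: u q => //= a u IH q; rewrite IH. Qed.

Lemma ledge_linv q a : ledge (act a q) (linv a) = ledge q a.
Proof. by case: a => i []; rewrite /ledge /= ?(actK (i, true)). Qed.

Lemma epath_winv q u : epath (walk q u) (winv u) = rev (epath q u).
Proof.
elim: u q => //= a u IH q; rewrite rev_cons -cats1 /winv /= rev_cons -cats1 epath_cat.
by rewrite -/(winv u) IH walk_winv /= ledge_linv.
Qed.

Variables (q0 : Q) (a0 : letter X) (w : seq (letter X)).
Hypothesis rw : reduced w.
Notation l := (size w).
Definition la i := nth a0 w i.
Definition pos i := walk q0 (take i w).
Definition ed i := ledge (pos i) (la i).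
Definition sub i j := take (j - i) (drop i w).

Lemma posS i : i < l -> pos i.+1 = act (la i) (pos i).
Proof. by move=> il; rewrite /pos (take_nth a0 il) -cats1 walk_cat. Qed.

Lemma size_sub i j : i <= j -> j <= l -> size (sub i j) = j - i.
Proof. by move=> ij jl; rewrite size_takel // size_drop; lia. Qed.

Lemma reduced_sub i j : reduced (sub i j).
Proof.
apply: (@reduced_catl _ _ (drop (j - i) (drop i w))); rewrite cat_take_drop.
by apply: (@reduced_catr _ (take i w)); rewrite cat_take_drop.
Qed.

Lemma walk_sub i j : i <= j -> walk (pos i) (sub i j) = pos j.
Proof.
move=> ij; rewrite /pos -walk_cat /sub; congr walk.
by rewrite -{2}(subnKC ij) takeD.
Qed.

Lemma epath_take i n : i + n <= l -> epath (pos i) (take n (drop i w)) = [seq ed t | t <- iota i n].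
Proof.
elim: n i => [|n IH] i il; first by rewrite take0.
by rewrite (drop_nth a0) /=; last lia; rewrite -IH ?posS //; lia.
Qed.

Lemma epath_sub i j : i <= j -> j <= l -> epath (pos i) (sub i j) = [seq ed t | t <- iota i (j - i)].
Proof. by move=> ij jl; rewrite epath_take //; lia. Qed.

Lemma pos_inj s t : s <= l -> t <= l -> s <= t + h -> t <= s + h -> pos s = pos t -> s = t.
Proof.
wlog st : s t / s <= t.
  by move=> H sl tl s1 t1 e; have [/H|/ltnW/H] := leqP s t; [apply|move=> ->].
move=> sl tl _ ts e; have : [::] = sub s t.
  apply: (@walk_uniq (pos s)) => //; rewrite ?size_sub //=; first exact: reduced_sub.
    by lia.
  by rewrite walk_sub.
by move=> /(congr1 size); rewrite size_sub //=; lia.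
Qed.

Definition dirS i j := pos i = pos j /\ la i = la j.
Definition dirO i j := [/\ pos i.+1 = pos j, pos i = pos j.+1 & la i = linv (la j)].

Lemma edP i j : i < l -> j < l -> ed i = ed j -> dirS i j \/ dirO i j.
Proof.
move=> il jl; rewrite /ed /ledge /dirS /dirO !posS //.
have := actK (la i) (pos i); have := actK (la j) (pos j).
case: (la i) (la j) => x [] [x' []] /= hj hi [e ex]; move: e hi hj; rewrite ex.
- by left.
- by move=> e hi hj; right; split=> //; rewrite e hj.
- by move=> e hi hj; right; split=> //; rewrite -e hi.
by move=> e hi hj; left; split=> //; rewrite -hi e hj.
Qed.

Lemma edS i j : i < l -> j < l -> dirS i j -> ed i = ed j.
Proof. by move=> il jl [e1 e2]; rewrite /ed e1 e2. Qed.

Lemma edO i j : i < l -> j < l -> dirO i j -> ed i = ed j.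
Proof.
by move=> il jl [e1 e2 e3]; rewrite /ed e2 e3 posS // ledge_linv.
Qed.

Notation blk i := (i %/ h).

Lemma blk_close i j : blk i = blk j -> i < j + h /\ j < i + h.
Proof.
move=> e; have := divn_eq i h; have := divn_eq j h; rewrite e.
have := ltn_pmod i h0; have := ltn_pmod j h0; lia.
Qed.

Lemma blk_mid i j t : blk i = blk j -> i <= t -> t <= j -> blk t = blk i.
Proof.
move=> e it tj; apply/eqP; rewrite eqn_leq; apply/andP; split.
  by rewrite e leq_div2r.
exact: leq_div2r.
Qed.

Lemma ed_inj i j : i < l -> j < l -> blk i = blk j -> ed i = ed j -> i = j.
Proof.
move=> il jl /blk_close[b1 b2] /(edP il jl)[[e _]|[e1 e2 _]]; first by apply: pos_inj e; lia.
have := pos_inj _ _ _ _ e1; have := pos_inj _ _ _ _ e2; lia.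
Qed.

(* [Ty i b]: the [i]-th edge of the walk also occurs in the [b]-th block of length [h]. *)
Definition Ty i b := has (fun j => (blk j == b) && (ed j == ed i)) (iota 0 l).

Lemma TyP i b : reflect (exists j, [/\ j < l, blk j = b & ed j = ed i]) (Ty i b).
Proof.
apply: (iffP hasP) => [[j]|[j [jl bj ej]]].
  by rewrite mem_iota add0n /= => jl /andP[/eqP bj /eqP ej]; exists j.
by exists j; rewrite ?mem_iota //= bj ej !eqxx.
Qed.

Variable nb : nat.
Hypothesis lnb : l <= nb * h.

Definition toggle i := [exists b : 'I_nb, Ty i.-1 b != Ty i b].
(** Between two cuts the set of blocks that contain the current edge does not change. This is what
    lets the repetition of a single edge spread to its whole segment. *)
Definition cut i := (blk i.-1 != blk i) || toggle i.

Lemma blk_lt j : j < l -> blk j < nb.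
Proof. by move=> jl; rewrite ltn_divLR // (leq_trans jl). Qed.

Lemma ncutP i : ~~ cut i.+1 -> blk i = blk i.+1 /\ (forall j, j < l -> Ty i (blk j) = Ty i.+1 (blk j)).
Proof.
rewrite negb_or negbK => /andP[/eqP e /existsPn nt]; split=> // j jl.
by have /negPn/eqP := nt (Ordinal (blk_lt jl)).
Qed.

(** Inside a block, being a cut depends only on the unordered pair of edges on both sides, so it is
    insensitive to the direction in which the pair is crossed. *)
Lemma cut_ext i j : i.+1 < l -> j.+1 < l -> blk j = blk j.+1 ->
  (ed i = ed j /\ ed i.+1 = ed j.+1) \/ (ed i = ed j.+1 /\ ed i.+1 = ed j) -> ~~ cut i.+1 -> ~~ cut j.+1.
Proof.
move=> il jl bj e nc; have [_ T] := ncutP nc; rewrite negb_or bj negbK eqxx /=.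
have Te s t b : ed s = ed t -> Ty s b = Ty t b by move=> st; rewrite /Ty st.
apply/existsPn => b; rewrite negbK /=; apply/eqP.
have [Ti|Ti] := boolP (Ty i b).
  have /TyP[t [tl bt _]] := Ti; have := T t tl; rewrite bt => Tb.
  by case: e => -[/(Te _ _ b) e1 /(Te _ _ b) e2]; rewrite -e1 -e2 Tb.
have Ti1 : Ty i.+1 b = false.
  by apply: contraNF Ti => Ti1; have /TyP[t [tl bt _]] := Ti1; move: Ti1; rewrite -bt -T.
by case: e => -[/(Te _ _ b) e1 /(Te _ _ b) e2]; rewrite -e1 -e2 Ti1 (negbTE Ti).
Qed.

(** Edges [i] and [i.+1] have the same type, so the block of [j] also contains the edge [i.+1], at
    some [j']. Absence of short cycles forces [j'] to be adjacent to [j]: after it when both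
    passages have the same direction, before it otherwise. *)
Lemma step i j : i.+1 < l -> ~~ cut i.+1 -> j < l ->
  (dirS i j -> [/\ j.+1 < l, ~~ cut j.+1, dirS i.+1 j.+1 & blk j = blk j.+1]) /\
  (dirO i j -> [/\ 0 < j, ~~ cut j, dirO i.+1 j.-1 & blk j.-1 = blk j]).
Proof.
move=> il nc jl; have [bi T] := ncutP nc.
have il' : i < l by lia.
have nee : ed i = ed i.+1 -> False by move=> /ed_inj -/(_ il' il bi); lia.
have TT : ed i = ed j -> exists j', [/\ j' < l, blk j' = blk j & ed i.+1 = ed j'].
  move=> e; have : Ty i (blk j) by apply/TyP; exists j.
  by rewrite T // => /TyP[j' [? ? e2]]; exists j'; rewrite e2.
split=> d.
  have e : ed i = ed j by exact: edS.
  have [j' [jl' bj ej]] := TT e; have [c1 c2] := blk_close bj; case: d => d1 d2.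
  have d3 : pos i.+1 = pos j.+1 by rewrite !posS // d1 d2.
  case: (edP il jl' ej) => [[f1 f2]|[f1 f2 f3]].
    have jj : j.+1 = j' by apply: pos_inj; rewrite -?d3 //; lia.
    rewrite -jj in f1 f2 jl' bj ej *; split=> //; apply: (cut_ext il jl') nc => //.
    by left.
  have jj : j.+1 = j'.+1 by apply: pos_inj; rewrite -?d3 //; lia.
  by case: jj => jj; case: nee; rewrite ej -jj.
have e : ed i = ed j by exact: edO.
have [j' [jl' bj ej]] := TT e; have [c1 c2] := blk_close bj; case: d => d1 d2 d3.
case: (edP il jl' ej) => [[f1 f2]|[f1 f2 f3]].
  have jj : j = j' by apply: pos_inj; rewrite -?d1 //; lia.
  by case: nee; rewrite ej -jj.
have jj : j = j'.+1 by apply: pos_inj; rewrite -?d1 //; lia.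
rewrite jj /= in d1 d2 d3 jl bj e *; split=> //; apply: (cut_ext il jl) nc => //.
by right.
Qed.

(* Two geodesics of length at most [h] meet in a connected set, since there are no short cycles. *)
Lemma Ty_mid i1 i i2 b : i1 <= i -> i <= i2 -> i2 < l -> blk i1 = blk i2 ->
  Ty i1 b -> Ty i2 b -> Ty i b.
Proof.
move=> l1 l2 il2 bi T1 T2; have [<-//|n1] := eqVneq i1 i; have [->//|n2] := eqVneq i i2.
have [b1 b2] := blk_close bi; have il1 : i1 < l by lia.
have /TyP[j1 [jl1 bj1 e1]] := T1; have /TyP[j2 [jl2 bj2 e2]] := T2.
have [d1 d2] : j1 < j2 + h /\ j2 < j1 + h by apply: blk_close; rewrite bj1 bj2.
(* [s] and [t] are times at which the other block visits the vertices [pos i1.+1] and [pos i2]. By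
   [walk_uniq] both blocks follow the same path between these vertices, possibly in opposite
   directions, and the edge [i] lies on it. *)
have [s [s1 s2 s3]] : exists s, [/\ j1 <= s, s <= j1.+1 & pos i1.+1 = pos s].
  case: (edP il1 jl1 (esym e1)) => [[f1 f2]|[f1 f2 _]].
    by exists j1.+1; rewrite leqnn leqnSn; split=> //; rewrite !posS // f1 f2.
  by exists j1; rewrite leqnn leqnSn.
have [t [t1 t2 t3]] : exists s, [/\ j2 <= s, s <= j2.+1 & pos i2 = pos s].
  case: (edP il2 jl2 (esym e2)) => [[f1 f2]|[f1 f2 _]].
    by exists j2; rewrite leqnn leqnSn.
  by exists j2.+1; rewrite leqnn leqnSn.
have iin : ed i \in epath (pos i1.+1) (sub i1.+1 i2).
  by rewrite epath_sub ?map_f ?mem_iota //; lia.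
have [st|ts] := leqP s t.
  have e : sub i1.+1 i2 = sub s t.
    apply: (@walk_uniq (pos i1.+1)); rewrite ?size_sub ?reduced_sub //; try lia.
    by rewrite walk_sub ?s3 ?walk_sub //; lia.
  move: iin; rewrite e s3 epath_sub; try lia.
  move=> /mapP[u]; rewrite mem_iota => uu eu; apply/TyP; exists u; split=> //; first lia.
  by rewrite -bj1; apply: (@blk_mid j1 j2); rewrite ?bj1 ?bj2 //; lia.
have e : sub i1.+1 i2 = winv (sub t s).
  apply: (@walk_uniq (pos i1.+1)); rewrite ?size_winv ?size_sub ?reduced_winv ?reduced_sub //; try lia.
  rewrite walk_sub; last lia.
  by rewrite s3 -(@walk_sub t s) ?walk_winv //; lia.
move: iin; rewrite e s3 -(@walk_sub t s); last lia.
rewrite epath_winv mem_rev epath_sub; try lia.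
move=> /mapP[u]; rewrite mem_iota => uu eu; apply/TyP; exists u; split=> //; first lia.
by rewrite -bj2; apply: (@blk_mid j2 j1); rewrite ?bj1 ?bj2 //; lia.
Qed.

(* By [Ty_mid], within a block each [b] enters and leaves the type at most once, so this code
   is injective on the cuts. *)
Definition cutcode i : 'I_nb.+1 * option ('I_nb * bool) :=
  (inord (blk i), if blk i.-1 != blk i then None else
     if [pick b : 'I_nb | Ty i.-1 b != Ty i b] is Some b then Some (b, Ty i b) else None).

Lemma cutcode_inj i i' : 0 < i -> 0 < i' -> i < l -> i' < l -> cut i -> cut i' ->
  cutcode i = cutcode i' -> i = i'.
Proof.
wlog : i i' / i < i'.
  move=> H i0 i0' il il' ci ci' e; have [ii|ii|//] := ltngtP i i'; first exact: H.
  by apply/esym; exact: H.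
move=> ii i0 i0' il il' ci ci'; rewrite /cutcode => -[e1].
have bb : blk i = blk i'.
  rewrite -(@inordK nb (blk i)) ?e1 ?inordK //; apply: ltnW; rewrite ltnS; exact: blk_lt.
have bm : blk i'.-1 = blk i' by rewrite -bb; apply: (@blk_mid i i') => //; lia.
move: ci'; rewrite /cut bm eqxx /= => tg.
case: (pickP (fun b : 'I_nb => Ty i'.-1 b != Ty i' b)) => [b' nb'|np]; last first.
  by move: tg; rewrite /toggle => /existsP[b]; have /= -> := np b.
case: ifP => // /negbFE /eqP bi; case: pickP => // b nbb [bE e]; rewrite -bE in nb' e.
rewrite e in nbb; case E : (Ty i' b) e nb' nbb => e nb' nbb.
  have Tm : Ty i'.-1 b by apply: (@Ty_mid i _ i') => //; lia.
  by rewrite Tm in nb'.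
have Tm : Ty i b.
  apply: (@Ty_mid i.-1 _ i'.-1); [exact: leq_pred|lia|exact: leq_ltn_trans (leq_pred _) il'|by rewrite bi bm -bb|..].
    by move: nbb; case: (Ty i.-1 b).
  by move: nb'; case: (Ty i'.-1 b).
by rewrite Tm in e.
Qed.

Lemma count_cut : count cut (iota 1 l) <= (nb.+1 * (nb * 2).+1).+1.
Proof.
case E : l => [|l']; first by [].
(* The position [l] is outside the range of [cutcode_inj]; it is counted separately and accounts for
   the last successor in the bound. *)
rewrite -[l'.+1]addn1 iotaD count_cat [X in _ + X]/= addn0.
apply: (@leq_trans (count cut (iota 1 l') + 1)); first by rewrite leq_add2l; case: cut.
rewrite addn1 ltnS -size_filter; set s := [seq i <- iota 1 l' | cut i].
have sP i : i \in s -> [/\ 0 < i, i < l & cut i].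
  by rewrite mem_filter mem_iota E => /andP[-> /andP[-> ]]; rewrite add1n.
have us : uniq (map cutcode s).
  rewrite map_inj_in_uniq ?filter_uniq ?iota_uniq // => i j /sP[i0 il ci] /sP[j0 jl cj].
  exact: cutcode_inj.
rewrite -(size_map cutcode) -(card_uniqP us) (leq_trans (max_card _)) //.
by rewrite card_prod card_option card_prod !card_ord card_bool.
Qed.

Definition ivs := segs cut 0 l.
(** Segments are compared through their sets of undirected edges, which ignore the direction of
    travel; by [labels_eq] two of these sets are equal or disjoint. *)
Definition labels (v : nat * nat) : {set Q * X} := [set e in [seq ed t | t <- iota v.1 (v.2 - v.1)]].
Definition word_of (v : nat * nat) := sub v.1 v.2.

Lemma labelsP v e : v.1 <= v.2 -> reflect (exists2 j, v.1 <= j < v.2 & ed j = e) (e \in labels v).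
Proof.
move=> vv; rewrite inE; apply: (iffP mapP) => -[j].
  by rewrite mem_iota => jj ->; exists j => //; lia.
by move=> jj <-; exists j => //; rewrite mem_iota; lia.
Qed.

Lemma ivsP (v : nat * nat) : v \in ivs -> [/\ v.1 < v.2, v.2 <= l, (v.2 == l) || cut v.2 & forall i, v.1 < i < v.2 -> ~~ cut i].
Proof. by move=> /segs_prop[/andP[]]. Qed.

Lemma ivs_cover i : i < l -> exists2 v : nat * nat, v \in ivs & v.1 <= i < v.2.
Proof.
have [fl _] := segs_flatten cut 0 l; move=> il; have : i \in iota 0 l by rewrite mem_iota.
by rewrite -fl => /flattenP[s /mapP[[c d] vi ->]]; rewrite mem_iota /= => ii; exists (c, d) => //=; lia.
Qed.

Lemma iv_blk (v : nat * nat) i : v \in ivs -> v.1 <= i < v.2 -> blk i = blk v.1.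
Proof.
move=> /ivsP[vv vl _ nc]; elim: i => [|i IH]; first by rewrite leqn0 => /andP[/eqP ->].
move=> ii; have [->//|ne] := eqVneq v.1 i.+1.
by have [|<- _] := @ncutP i; [apply: nc; lia | rewrite IH //; lia].
Qed.

Lemma iv_next (v : nat * nat) j : v \in ivs -> v.1 <= j < v.2 -> j.+1 < l -> ~~ cut j.+1 -> j.+1 < v.2.
Proof.
move=> /ivsP[vv vl vc _] jj jl nc; have [//|e] : j.+1 < v.2 \/ v.2 = j.+1 by lia.
by move: vc; rewrite e (negbTE nc) orbF => /eqP; lia.
Qed.

(** If [j] were the left end of [v], then, [j] being no cut, the segment containing [j.-1] would
    also contain [j], and two segments would overlap. *)
Lemma iv_prev (v : nat * nat) j : v \in ivs -> v.1 <= j < v.2 -> 0 < j -> ~~ cut j -> v.1 <= j.-1.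
Proof.
move=> vi jj j0 nc; have [//|e] : v.1 <= j.-1 \/ v.1 = j by lia.
have jl : j.-1 < l by have [] := ivsP vi; lia.
have [v' v'i jj'] := ivs_cover jl.
have : j < v'.2 by rewrite -(prednK j0); apply: iv_next => //; rewrite prednK //; have [] := ivsP vi; lia.
move=> jv; exfalso.
have [fl _] := segs_flatten cut 0 l; have := iota_uniq 0 l; rewrite -fl -/ivs.
have ne : v != v' by apply/eqP => vv; move: jj'; rewrite -vv e; lia.
have [j1 j2] : j \in iota v.1 (v.2 - v.1) /\ j \in iota v'.1 (v'.2 - v'.1).
  by rewrite !mem_iota; lia.
elim: (ivs) vi v'i => //= u r IH; rewrite !inE cat_uniq => /orP[/eqP uv|vr] /orP[/eqP uv'|v'r] /and3P[_ /hasPn/= nh ur].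
- by rewrite uv uv' eqxx in ne.
- have : j \in flatten [seq iota v0.1 (v0.2 - v0.1) | v0 <- r].
    by apply/flattenP; exists (iota v'.1 (v'.2 - v'.1)) => //; exact: map_f.
  by move=> /nh; rewrite -uv j1.
- have : j \in flatten [seq iota v0.1 (v0.2 - v0.1) | v0 <- r].
    by apply/flattenP; exists (iota v.1 (v.2 - v.1)) => //; exact: map_f.
  by move=> /nh; rewrite -uv' j2.
exact: IH.
Qed.

(** Left to right is [step]. Conversely, equality of types gives an occurrence of edge [i] in the
    block of [j]; stepping from it reaches edge [i.+1] in that block, which must be [j] by [ed_inj],
    and no cut separates the two. *)
Lemma stepN (v v' : nat * nat) i : v \in ivs -> v' \in ivs -> v.1 <= i -> i.+1 < v.2 ->
  (ed i \in labels v') = (ed i.+1 \in labels v').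
Proof.
move=> vi vi' vli liv; have [vv vl _ nc] := ivsP vi; have [vv' vl' _ _] := ivsP vi'.
have nci : ~~ cut i.+1 by apply: nc; lia.
have il : i.+1 < l by lia.
apply/idP/idP => /(labelsP _ (ltnW vv'))[j jj ej].
  have jl : j < l by lia.
  have [S O] := step il nci jl; apply/labelsP; first exact: ltnW.
  have [/S[h1 h2 h3 h4]|/O[h1 h2 h3 h4]] := edP (ltnW il) jl (esym ej).
    exists j.+1; first by have := iv_next vi' jj h1 h2; lia.
    by apply/esym/edS.
  exists j.-1; first by have := iv_prev vi' jj h1 h2; lia.
  by apply/esym/edO => //; lia.
have jl : j < l by lia.
have [bi Tn] := ncutP nci.
have : Ty i.+1 (blk j) by apply/TyP; exists j.
rewrite -Tn // => /TyP[j' [jl' bj ej']].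
have [S O] := step il nci jl'; apply/labelsP; first exact: ltnW.
exists j' => //.
have [/S[h1 h2 h3 h4]|/O[h1 h2 h3 h4]] := edP (ltnW il) jl' (esym ej').
  have jj' : j = j'.+1.
    by apply: ed_inj => //; rewrite ?ej -?bj -?h4 //; apply: edS.
  by rewrite jj' in jj h2; have := iv_prev vi' jj isT h2; lia.
have jj' : j = j'.-1.
  by apply: ed_inj => //; rewrite ?ej -?bj ?h4 //; try lia; apply: edO => //; lia.
rewrite jj' in jj; have := iv_next vi' jj; rewrite prednK // => /(_ jl' h2); lia.
Qed.

Lemma labels_sub (v v' : nat * nat) i : v \in ivs -> v' \in ivs -> v.1 <= i < v.2 -> ed i \in labels v' ->
  labels v \subset labels v'.
Proof.
move=> vi vi' ii ei; have [vv vl _ _] := ivsP vi.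
have H n : v.1 + n < v.2 -> (ed (v.1 + n) \in labels v') = (ed v.1 \in labels v').
  elim: n => [|n IH] hn; first by rewrite addn0.
  by rewrite addnS -(@stepN v) ?IH //; lia.
have e0 : ed v.1 \in labels v' by rewrite -(H (i - v.1)) ?subnKC //; lia.
apply/fintype.subsetP => e /(labelsP _ (ltnW vv))[j jj <-].
by rewrite -(@subnKC v.1 j) ?H ?subnKC //; lia.
Qed.

Lemma labels_eq (v v' : nat * nat) i j : v \in ivs -> v' \in ivs -> v.1 <= i < v.2 -> v'.1 <= j < v'.2 ->
  ed i = ed j -> labels v = labels v'.
Proof.
move=> vi vi' ii jj e; have [vv _ _ _] := ivsP vi; have [vv' _ _ _] := ivsP vi'.
apply/eqP; rewrite finset.eqEsubset; apply/andP; split.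
  by apply: (labels_sub vi vi' ii); apply/labelsP; [exact: ltnW | exists j].
by apply: (labels_sub vi' vi jj); apply/labelsP; [exact: ltnW | exists i].
Qed.

Lemma card_labels (v : nat * nat) : v \in ivs -> #|labels v| = v.2 - v.1.
Proof.
move=> vi; have [vv vl _ _] := ivsP vi; rewrite cardsE (card_uniqP _) ?size_map ?size_iota //.
rewrite map_inj_in_uniq ?iota_uniq // => i j; rewrite !mem_iota => ii jj.
by apply: ed_inj; try lia; rewrite !(iv_blk vi) //; lia.
Qed.

Lemma nth_sub i j t : t < j - i -> nth a0 (sub i j) t = la (i + t).
Proof. by move=> tt; rewrite nth_take // nth_drop. Qed.

(** The occurrence in [v'] of the first edge of [v] fixes a direction; [step] then follows [v']
    forwards or backwards, and equality of lengths forces the start to be an end of [v']. *)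
Lemma word_eq (v v' : nat * nat) : v \in ivs -> v' \in ivs -> labels v = labels v' ->
  word_of v = word_of v' \/ word_of v = winv (word_of v').
Proof.
move=> vi vi' le; have := card_labels vi; rewrite le card_labels // => sz.
have [vv vl _ nc] := ivsP vi; have [vv' vl' _ _] := ivsP vi'.
have : ed v.1 \in labels v' by rewrite -le; apply/labelsP; [exact: ltnW | exists v.1; rewrite ?leqnn].
move=> /(labelsP _ (ltnW vv'))[j jj ej].
have jl : j < l by lia.
have [S|O] := edP (leq_trans vv vl) jl (esym ej).
  have H n : v.1 + n < v.2 -> j + n < v'.2 /\ dirS (v.1 + n) (j + n).
    elim: n => [|n IH] hn; first by rewrite !addn0; split=> //; lia.
    have [|h1 h2] := IH; first by lia.
    have nci : ~~ cut (v.1 + n).+1 by apply: nc; lia.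
    have il : (v.1 + n).+1 < l by lia.
    have jnl : j + n < l by lia.
    have [+ _] := step il nci jnl; move=> /(_ h2)[g1 g2 g3 g4].
    by rewrite !addnS; split=> //; apply: iv_next => //; lia.
  have jE : j = v'.1 by have [|hj _] := H (v.2 - v.1).-1; lia.
  left; apply: (@eq_from_nth _ a0); rewrite ?size_sub; try lia.
  by move=> n nn; rewrite !nth_sub; try lia; rewrite -jE; have [|_ []] := H n; [lia|].
have H n : v.1 + n < v.2 -> v'.1 + n <= j /\ dirO (v.1 + n) (j - n).
  elim: n => [|n IH] hn; first by rewrite !addn0 subn0; split=> //; lia.
  have [|h1 h2] := IH; first by lia.
  have nci : ~~ cut (v.1 + n).+1 by apply: nc; lia.
  have il : (v.1 + n).+1 < l by lia.
  have jnl : j - n < l by lia.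
  have [_ +] := step il nci jnl; move=> /(_ h2)[g1 g2 g3 g4].
  have p := @iv_prev v' (j - n) vi' _ g1 g2.
  rewrite !addnS subnS; split=> //; have := p _; lia.
have jE : j.+1 = v'.2 by have [|hj _] := H (v.2 - v.1).-1; lia.
right; apply: (@eq_from_nth _ a0); rewrite ?size_winv ?size_sub; try lia.
move=> n nn; rewrite /winv nth_rev ?size_map ?size_sub; try lia.
rewrite (nth_map a0) ?size_sub; try lia.
rewrite !nth_sub; try lia.
have [|_ [_ _ ->]] := H n; first lia.
by congr (linv (la _)); lia.
Qed.

Hypothesis twice : forall i, i < l -> exists j, [/\ j < l, j != i & ed j = ed i].

(** [c] picks the first segment with the same edge set. No class is a singleton: the second
    occurrence of an edge lies in another segment, since edges within one block are distinct. *)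
Lemma segmentation : exists2 vs : seq (seq (letter X)),
  [/\ flatten vs = w, all (fun v => v != [::]) vs & size vs <= (nb.+1 * (nb * 2).+1).+2] &
  exists2 c : {ffun 'I_(size vs) -> 'I_(size vs)}, goodpat c &
    forall i : 'I_(size vs), nth [::] vs i = nth [::] vs (c i) \/ nth [::] vs i = winv (nth [::] vs (c i)).
Proof.
exists (map word_of ivs).
  split; last by rewrite size_map (leq_trans (size_segs _ _ _)) // ltnS count_cut.
    have [fl _] := segs_flatten cut 0 l.
    have -> : map word_of ivs = [seq [seq la t | t <- iota v.1 (v.2 - v.1)] | v <- ivs].
      apply/eq_in_map => v /ivsP[vv vl _ _]; apply: (@eq_from_nth _ a0).
        by rewrite size_map size_iota size_sub //; lia.
      move=> t; rewrite size_sub; try lia; move=> tt.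
      by rewrite nth_sub // (nth_map 0) ?size_iota // nth_iota.
    rewrite (map_comp (map la) (fun v => iota v.1 (v.2 - v.1))) -map_flatten fl.
    exact: mkseq_nth.
  rewrite all_map; apply/allP => v /ivsP[vv vl _ _] /=.
  by rewrite -size_eq0 size_sub //; lia.
rewrite size_map.
pose idx (i : 'I_(size ivs)) := index (labels (nth (0, 0) ivs i)) (map labels ivs).
have idx_lt i : idx i < size ivs.
  by rewrite -(size_map labels) index_mem; apply: map_f; apply: mem_nth.
have idxP i : labels (nth (0, 0) ivs (idx i)) = labels (nth (0, 0) ivs i).
  by rewrite -(nth_map (0, 0) finset.set0 labels) // nth_index //; apply: map_f; apply: mem_nth.
exists [ffun i => Ordinal (idx_lt i)].
  apply/forallP => i; set v := nth (0, 0) ivs i.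
  have vi : v \in ivs by exact: mem_nth.
  have [vv vl _ _] := ivsP vi.
  have [j [jl ji ej]] := twice (leq_trans vv vl).
  have [v' vi' jj] := ivs_cover jl.
  have le : labels v = labels v' by apply: (@labels_eq v v' v.1 j); rewrite ?leqnn // ej.
  have jlt : index v' ivs < size ivs by rewrite index_mem.
  apply/existsP; exists (Ordinal jlt); apply/andP; split.
    apply/eqP => /(congr1 val) /= e; have : v' = v by rewrite /v -e nth_index.
    move=> vv'; rewrite vv' in jj; move: ji; rewrite (@ed_inj j v.1) ?eqxx //; try lia.
    by rewrite (iv_blk vi jj).
  by rewrite !ffunE -val_eqE /= /idx /= nth_index // -le.
move=> i; rewrite ffunE /= !(nth_map (0, 0)) //.
by apply: word_eq; rewrite ?mem_nth ?idxP.
Qed.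
End Segmentation.

(** * Random signed permutation representations *)

Section Rep.
Variables (X : finType) (F : groupType) (x : X -> F) (fb : free_basis x).
Variables (Q : finGroupType) (y : X -> Q).

Definition stepQ (a : letter X) (q : Q) : Q := (q * gl y a)%g.

Lemma stepQK a q : stepQ (linv a) (stepQ a q) = q.
Proof. by rewrite /stepQ gl_linv mulgK. Qed.

Lemma walkE q w : walk stepQ q w = (q * ev y w)%g.
Proof.
elim: w q => [|a w IH] q /=; first by rewrite mulg1.
by rewrite IH /stepQ mulgA.
Qed.

Variable s : {ffun Q * X -> bool}.

(** Signed permutations of [Q] are encoded as permutations of its double cover [Q * bool], a finite
    group to which the universal property of [F] applies. *)
Definition step_fun (i : X) (v : Q * bool) : Q * bool := ((v.1 * y i)%g, v.2 (+) s (v.1, i)).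

Lemma step_fun_inj i : injective (step_fun i).
Proof.
move=> [q b] [q' b'] [/= /mulIg ->] /(congr1 (addb (s (q', i)))).
by rewrite ![s _ (+) _]addbC -!addbA addbb !addbF => ->.
Qed.

Definition srep : {multiplicative F -> {perm Q * bool}} :=
  sval (cid (fb (fun i => perm (@step_fun_inj i)))).

Lemma srepE i : srep (x i) = perm (@step_fun_inj i).
Proof. by rewrite /srep; case: cid => f [/= h _]; exact: h. Qed.

Definition par (es : seq (Q * X)) : bool := foldr (fun e b => s e (+) b) false es.

Lemma srep_ev w q b : srep (ev x w) (q, b) = (walk stepQ q w, b (+) par (epath stepQ q w)).
Proof.
elim: w q b => [|a w IH] q b /=; first by rewrite mult1 perm1 addbF.
rewrite gmulfM permM.
have -> : srep (gl x a) (q, b) = (stepQ a q, b (+) s (ledge stepQ q a)).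
  case: a => i []; rewrite /gl /ledge /stepQ /gl /= ?multV srepE; first by rewrite permE.
  apply: (@perm_inj _ (perm (@step_fun_inj i))); rewrite permKV permE /step_fun /=.
  by rewrite mulgKV -addbA addbb addbF.
by rewrite IH addbA.
Qed.

Definition vproj (g : F) : Q := (srep g (1%g, false)).1.
Definition sgn (g : F) (q : Q) : bool := (srep g (q, false)).2.

Lemma srepP g q b : srep g (q, b) = ((q * vproj g)%g, b (+) sgn g q).
Proof.
have [w ->] := free_basis_gen fb g.
by rewrite /vproj /sgn !srep_ev !walkE mul1g.
Qed.

Lemma vproj_ev w : vproj (ev x w) = ev y w.
Proof. by rewrite /vproj srep_ev walkE mul1g. Qed.

Lemma sgn_ev w q : sgn (ev x w) q = par (epath stepQ q w).
Proof. by rewrite /sgn srep_ev. Qed.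

Lemma vprojM g h : vproj (g * h)%g = (vproj g * vproj h)%g.
Proof. by rewrite {1}/vproj gmulfM permM srepP srepP mul1g. Qed.

Lemma sgnM g h q : sgn (g * h)%g q = sgn g q (+) sgn h (q * vproj g)%g.
Proof. by rewrite {1}/sgn gmulfM permM srepP srepP. Qed.

Lemma vproj1 : vproj 1%g = 1%g. Proof. by rewrite /vproj mult1 perm1. Qed.
Lemma sgn1 q : sgn 1%g q = false. Proof. by rewrite /sgn mult1 perm1. Qed.

Lemma vprojV g : vproj g^-1%g = (vproj g)^-1%g.
Proof. by apply: (@mulgI _ (vproj g)); rewrite -vprojM !mulgV vproj1. Qed.

Variable R : realType.
Notation C := R[i].
Local Open Scope ring_scope.

Definition phi (g : F) : 'M[C]_#|Q| :=
  \matrix_(i, j) ((enum_val i * vproj g == enum_val j)%g%:R * (-1) ^+ sgn g (enum_val i)).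

Lemma phi1 : phi 1%g = 1%:M.
Proof.
apply/matrixP => i j; rewrite !mxE vproj1 sgn1 expr0 mulr1 mulg1.
by rewrite (inj_eq enum_val_inj).
Qed.

Lemma phiM g h : phi (g * h)%g = phi g *m phi h.
Proof.
apply/matrixP => i j; rewrite !mxE (bigD1 (enum_rank (enum_val i * vproj g)%g)) //= big1 => [|k].
  by rewrite !mxE enum_rankK eqxx mul1r addr0 vprojM sgnM mulgA signr_addb mulrCA.
rewrite !mxE => hk; case: (eqVneq (enum_val i * vproj g)%g (enum_val k)) => [e|_].
  by rewrite e enum_valK eqxx in hk.
by rewrite !mul0r.
Qed.

Lemma phi_signed g : signed_perm_mx (phi g).
Proof.
have inj : injective (fun i : 'I_#|Q| => enum_rank (enum_val i * vproj g)%g).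
  by move=> i j /enum_rank_inj /mulIg /enum_val_inj.
exists (perm_mx (perm inj)); first exact: perm_mx_is_perm.
move=> i j; rewrite !mxE permE -(can_eq enum_valK) enum_rankK.
by case: sgn; [right; rewrite expr1 mulrN mulr1 | left; rewrite mulr1].
Qed.

Lemma hyperoctahedral_phi : hyperoctahedral_rep phi.
Proof. by split; [exact: phi_signed | exact: phi1 | exact: phiM]. Qed.

Lemma tr_phi g : \tr (phi g) = \sum_(q : Q) ((q * vproj g == q)%g%:R * (-1) ^+ sgn g q).
Proof.
rewrite /mxtrace (reindex enum_rank) /=; last by exists enum_val => i _; rewrite ?enum_rankK ?enum_valK.
by apply: eq_bigr => q _; rewrite mxE enum_rankK.
Qed.

(** Needed because [lin_pow] writes a power as a combination of the matrices at inverses [h^-1]. *)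
Lemma tr_phiV g : \tr (phi g^-1%g) = \tr (phi g).
Proof.
rewrite !tr_phi; apply: eq_bigr => q _; rewrite vprojV.
have -> : ((q * (vproj g)^-1)%g == q) = ((q * vproj g)%g == q).
  by apply/eqP/eqP => {1}<-; rewrite ?mulgK ?mulgKV.
case: eqP => [e|]; last by rewrite !mul0r.
have := sgnM g g^-1%g q; rewrite mulgV sgn1 e.
by case: (sgn g q); case: sgn.
Qed.
End Rep.

Section SignAverage.
Local Open Scope ring_scope.
Variables (X : finType) (Q : finGroupType) (R : realType).
Notation C := R[i].

(* Flipping the sign of [e] is a sign-reversing involution. *)
Lemma sum_par_eq0 (es : seq (Q * X)) e : odd (count_mem e es) ->
  \sum_(s : {ffun Q * X -> bool}) (-1) ^+ par s es = 0 :> C.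
Proof.
move=> oe; pose fl (s : {ffun Q * X -> bool}) := [ffun e' => s e' (+) (e' == e)].
have flK : involutive fl by move=> s; apply/ffunP => e'; rewrite !ffunE -addbA addbb addbF.
have parE s : par (fl s) es = par s es (+) odd (count_mem e es).
  elim: es {oe} => //= e' es IH; rewrite IH ffunE oddD oddb.
  by rewrite -!addbA; congr (_ (+) _); rewrite addbCA.
set S := \sum_s _; have : S = - S.
  rewrite {1}/S (reindex_inj (inv_inj flK)) /= -sumrN; apply: eq_bigr => s _.
  by rewrite parE oe addbT signrN.
by move=> /eqP; rewrite -addr_eq0 -mulr2n mulrn_eq0 /= => /eqP.
Qed.
End SignAverage.

Local Open Scope ring_scope.

(** * Cones and walks in the free group *)

Section Tree.
Variables (X : finType) (F : groupType) (x : X -> F).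
Local Open Scope group_scope.

Definition nf (g : F) : seq (letter X) := xget [::] [set w | reduced w /\ ev x w = g].
Definition len g := size (nf g).
(* [cone (Some a)] is the cone of the elements [h] for which [v * h] extends [v] without
   cancellation, for every reduced word [v] ending with [a]. *)
Definition okh (o : option (letter X)) (w : seq (letter X)) : bool :=
  match o, w with Some a, b :: _ => nobt a b | _, _ => true end.
Definition cone o g := okh o (nf g).
Definition lasto o (v : seq (letter X)) := foldl (fun _ a => Some a) o v.

Hypothesis gen : forall g, exists w, g = ev x w.
Hypothesis faith : forall w, reduced w -> ev x w = 1 -> w = [::].

Lemma nfP g : reduced (nf g) /\ ev x (nf g) = g.
Proof.
have [w gE] := gen g; have : [set w | reduced w /\ ev x w = g]%classic (red w).
  by split; [exact: reduced_red | rewrite ev_red].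
by move=> /(@xgetI _ [::]).
Qed.

Lemma nf_reduced g : reduced (nf g). Proof. by have [] := nfP g. Qed.
Lemma nfK g : ev x (nf g) = g. Proof. by have [] := nfP g. Qed.
Lemma nf_ev w : reduced w -> nf (ev x w) = w.
Proof. by move=> rw; apply: (ev_inj faith); rewrite ?nfK //; exact: nf_reduced. Qed.
Lemma nf1 : nf 1 = [::]. Proof. exact: (nf_ev (w := [::])). Qed.

Lemma nfV g : nf g^-1 = winv (nf g).
Proof. by rewrite -{1}(nfK g) -ev_winv nf_ev // reduced_winv nf_reduced. Qed.

Lemma nfM g h : reduced (nf g ++ nf h) -> nf (g * h) = nf g ++ nf h.
Proof. by move=> r; rewrite -{1}(nfK g) -{1}(nfK h) -ev_cat nf_ev. Qed.

Lemma len_ev w : (len (ev x w) <= size w)%N.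
Proof. by rewrite /len -ev_red nf_ev ?size_red // reduced_red. Qed.

Lemma lenM g h : (len (g * h) <= len g + len h)%N.
Proof. by rewrite -{1}(nfK g) -{1}(nfK h) -ev_cat (leq_trans (len_ev _)) // size_cat. Qed.

Lemma lenV g : len g^-1 = len g.
Proof. by rewrite /len nfV size_winv. Qed.

Lemma lasto_cat o u v : lasto o (u ++ v) = lasto (lasto o u) v.
Proof. by rewrite /lasto foldl_cat. Qed.

Lemma reduced_cat o v w : okh o v -> reduced v -> reduced w -> okh (lasto o v) w ->
  okh o (v ++ w) && reduced (v ++ w).
Proof.
elim/last_ind: v => [|v a _] /=; first by move=> _ _ -> ->.
rewrite -cats1 lasto_cat /= => ov rv rw ow; apply/andP; split.
  by case: o ov => //= b; case: v rv.
move: rv; rewrite -catA /reduced /=; case: v ov => [|c v] _ /=.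
  by move=> _; case: w rw ow => //= b w -> ->.
rewrite !cat_path /= andbT => /andP[-> ->] /=.
by case: w rw ow => //= b w -> ->.
Qed.

Lemma cone_ext o v h : okh o v -> reduced v -> cone (lasto o v) h ->
  cone o (ev x v * h) && (nf (ev x v * h) == v ++ nf h).
Proof.
move=> ov rv Th; have /andP[h1 h2] := reduced_cat ov rv (nf_reduced h) Th.
have e : nf (ev x v * h) = v ++ nf h by rewrite nfM nf_ev.
by rewrite /cone e h1 eqxx.
Qed.

(** The geodesic from [h] to [h'] passes through the root of the cone. Hence a step of length at
    most [D] that crosses the boundary of a cone has both ends within [D] of its root, and boundary
    terms are finite sums over [B]. *)
Lemma len_cross o h h' : cone o h -> ~~ cone o h' -> len (h^-1 * h') = (len h + len h')%N.
Proof.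
case: o => [a|//]; rewrite /cone => th; case E : (nf h') => [|b s] //= /negPn /eqP bE.
rewrite -(lenV h) /len; rewrite nfM ?size_cat // nfV.
have := nf_reduced h'; rewrite E; have := nf_reduced h; rewrite -reduced_winv.
move: th; case: (nf h) => [|c u] //= ac.
rewrite /reduced /winv /= rev_cons; case E2 : (rev _) => [|d r] /=.
  by move=> _ ->; rewrite andbT /nobt bE; apply: contra ac => /eqP ->; rewrite linvK.
rewrite cat_path !rcons_path last_rcons => -> /= ->; rewrite andbT.
by rewrite /nobt bE; apply: contra ac => /eqP ->; rewrite linvK.
Qed.
End Tree.

Section BigAux.
Variable R : realType.

Lemma normc_ge0 (c : R[i]) : 0 <= normc c.
Proof. by case: c => a b; exact: sqrtr_ge0. Qed.

Lemma normc_sum_le (I : Type) (s : seq I) (P : pred I) (a : I -> R[i]) :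
  normc (\sum_(i <- s | P i) a i) <= \sum_(i <- s | P i) normc (a i).
Proof.
elim/big_rec2: _ => [|i u v _ h]; first by rewrite normc0.
by apply: (le_trans (le_normcD _ _)); rewrite lerD2l.
Qed.

Lemma ler_sum_mem (I : eqType) (s : seq I) (a : I -> R) i :
  (forall j, 0 <= a j) -> i \in s -> a i <= \sum_(j <- s) a j.
Proof.
move=> a0 si; rewrite (big_rem i) //= lerDl; exact: sumr_ge0.
Qed.

Lemma ler_sum_cond (I : Type) (s : seq I) (P : pred I) (a : I -> R) :
  (forall j, 0 <= a j) -> \sum_(j <- s | P j) a j <= \sum_(j <- s) a j.
Proof.
by move=> a0; rewrite [leRHS](bigID P) /= lerDl; apply: sumr_ge0.
Qed.
End BigAux.

Section Walk.
Variables (R : realType) (X : finType) (F : groupType) (x : X -> F).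
Hypothesis gen : forall g, exists w, g = ev x w.
Hypothesis faith : forall w, reduced w -> ev x w = 1%g -> w = [::].
Notation C := R[i].

(** Convolution from the right, so that it commutes with left translations, which carry the cones at
    1 to the cones below [v]. Lists with repeated terms represent C[F], so that products need no
    collection of coefficients. *)
Definition Rop (y : seq (C * F)) (f : F -> C) (h : F) : C :=
  \sum_(p <- y) p.1 * f (h * p.2)%g.

Variables (y : seq (C * F)) (D : nat) (B : seq F).
Hypothesis yD : forall p, p \in y -> (len x p.2 <= D)%N.
Hypothesis uB : uniq B.
Hypothesis BD : forall g, (len x g <= D)%N -> g \in B.
Hypothesis BD' : forall g, g \in B -> (len x g <= D)%N.

(* [cone_walk o u t] is [(1_cone Rop)^t] applied to the Dirac mass at [u]. *)
Fixpoint cone_walk (o : option (letter X)) (u : F) (t : nat) : F -> C :=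
  if t is t'.+1 then fun h => if cone x o h then Rop y (cone_walk o u t') h else 0
  else fun h => (h == u)%:R.

Lemma cone_walk_supp o u t h : cone x o u -> ~~ cone x o h -> cone_walk o u t h = 0.
Proof.
case: t => [|t] /= Tu Th; last by rewrite (negbTE Th).
by case: eqP => // e; rewrite e Tu in Th.
Qed.

(** The contribution at [ev x v * u'] of one step that starts outside the cone below [v], after [t]
    steps. *)
Definition jump o u v t o' u' : C :=
  \sum_(p <- y | ~~ cone x o' (u' * p.2)%g) p.1 * cone_walk o u t (ev x v * (u' * p.2))%g.

Lemma delta_sum o' (c : F -> C) h : cone x o' h -> (h \notin B -> c h = 0) ->
  c h = \sum_(u' <- B | cone x o' u') c u' * (h == u')%:R.
Proof.
move=> Th hB; have [hin|hout] := boolP (h \in B).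
  rewrite big_mkcond (bigD1_seq h) //= Th eqxx mulr1 big1 ?addr0 // => i /negbTE.
  by rewrite eq_sym => ->; rewrite mulr0 if_same.
rewrite hB // big_seq_cond big1 // => i /andP[iB _].
by case: eqP iB hout => [->|]; rewrite ?mulr0 // => ->.
Qed.

(* Decomposition of the walks at their last entrance into the cone below [v]. *)
Lemma Duhamel o u v k h : (len x u <= D)%N -> okh o v -> reduced v ->
  cone x (lasto o v) h ->
  cone_walk o u k (ev x v * h)%g =
    \sum_(u' <- B | cone x (lasto o v) u') cone_walk o u 0 (ev x v * u')%g * cone_walk (lasto o v) u' k h +
    \sum_(t < k) \sum_(u' <- B | cone x (lasto o v) u')
       jump o u v t (lasto o v) u' * cone_walk (lasto o v) u' (k.-1 - t) h.
Proof.
move=> uD ov rv; set o' := lasto o v; elim: k h => [|k IH] h Th.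
  rewrite big_ord0 addr0; apply: (delta_sum (c := fun u' => cone_walk o u 0 (ev x v * u')%g)) => // hB.
  rewrite /=; case: eqP => // e; move: hB; rewrite BD //.
  have /andP[_ /eqP] := cone_ext gen faith ov rv Th; rewrite e => e2.
  by move: uD; rewrite {1}/len e2 size_cat; apply: leq_trans; rewrite leq_addl.
pose rhs k h := \sum_(u' <- B | cone x o' u') cone_walk o u 0 (ev x v * u')%g * cone_walk o' u' k h +
    \sum_(t < k) \sum_(u' <- B | cone x o' u') jump o u v t o' u' * cone_walk o' u' (k.-1 - t) h.
have rhs0 h' : ~~ cone x o' h' -> rhs k h' = 0.
  move=> Th'; rewrite /rhs big1 => [|u' Tu']; last by rewrite (cone_walk_supp _ Tu' Th') mulr0.
  rewrite add0r big1 // => t _.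
  by rewrite big1 // => u' Tu'; rewrite (cone_walk_supp _ Tu' Th') mulr0.
have -> : cone_walk o u k.+1 (ev x v * h)%g = \sum_(p <- y) p.1 * rhs k (h * p.2)%g + jump o u v k o' h.
  have /andP[Tvh _] := cone_ext gen faith ov rv Th.
  rewrite /= Tvh /Rop (bigID (fun p => cone x o' (h * p.2)%g)) /=; congr (_ + _).
    rewrite [RHS](bigID (fun p => cone x o' (h * p.2)%g)) /= [X in _ + X]big1 ?addr0.
      by apply: eq_bigr => p Tp; rewrite -mulgA IH.
    by move=> p Tp; rewrite rhs0 ?mulr0.
  by apply: eq_bigr => p _; rewrite mulgA.
rewrite -/(rhs k.+1 h) {2}/rhs big_ord_recr /= subnn addrA; congr (_ + _); last first.
  apply: (delta_sum (c := jump o u v k o')) => // hB.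
  rewrite /jump big_seq_cond big1 // => p /andP[py Tp].
  move: hB; rewrite BD //; have := yD py.
  by have := len_cross gen faith Th Tp; rewrite mulKg => ->; apply: leq_trans; rewrite leq_addr.
rewrite /rhs; under eq_bigr do rewrite mulrDr; rewrite big_split /=; congr (_ + _).
  under eq_bigr do rewrite mulr_sumr; rewrite exchange_big /=; apply: eq_bigr => u' Tu'.
  rewrite Th /Rop mulr_sumr; apply: eq_bigr => p _; rewrite mulrCA; congr (_ * _).
under eq_bigr do rewrite mulr_sumr; rewrite exchange_big /=; apply: eq_bigr => t _.
under eq_bigr do rewrite mulr_sumr; rewrite exchange_big /=; apply: eq_bigr => u' Tu'.
have -> : (k - t)%N = (k.-1 - t).+1 by have := ltn_ord t; lia.
by rewrite /= Th /Rop mulr_sumr; apply: eq_bigr => p _; rewrite mulrCA.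
Qed.

Notation os := (enum {: option (letter X)}).
Variable k : nat.

(** One majorant for every factor produced by [Duhamel]: summing over all cones, starting points in
    [B] and times up to [k] makes the cutting inequality reproduce itself, so it can be iterated
    over the segments. *)
Definition walk_mass (h : F) : R :=
  \sum_(o <- os) \sum_(u <- B | cone x o u) \sum_(t < k.+1) normc (cone_walk o u t h).
Definition ball_mass (v : F) : R := \sum_(r <- B) walk_mass (v * r)%g.
Definition coef_sum : R := \sum_(p <- y) normc p.1.

Lemma Fsum_ge0 o u h : 0 <= \sum_(t < k.+1) normc (cone_walk o u t h).
Proof. by apply: sumr_ge0 => t _; exact: normc_ge0. Qed.

Lemma Fsum2_ge0 o h : 0 <= \sum_(u <- B | cone x o u) \sum_(t < k.+1) normc (cone_walk o u t h).
Proof. by apply: sumr_ge0 => u _; exact: Fsum_ge0. Qed.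

Lemma walk_mass_ge0 h : 0 <= walk_mass h.
Proof. by apply: sumr_ge0 => o _; exact: Fsum2_ge0. Qed.

Lemma ball_mass_ge0 h : 0 <= ball_mass h.
Proof. by apply: sumr_ge0 => r _; exact: walk_mass_ge0. Qed.

Lemma coef_sum_ge0 : 0 <= coef_sum.
Proof. by apply: sumr_ge0 => p _; exact: normc_ge0. Qed.

Lemma le_Fsum o u t h : (t <= k)%N -> normc (cone_walk o u t h) <= \sum_(t < k.+1) normc (cone_walk o u t h).
Proof.
move=> tk; rewrite (bigD1 (Ordinal (tk : (t < k.+1)%N))) //= lerDl.
by apply: sumr_ge0 => *; exact: normc_ge0.
Qed.

Lemma le_walk_mass_sum o t h : (t <= k)%N ->
  \sum_(u <- B | cone x o u) normc (cone_walk o u t h) <= walk_mass h.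
Proof.
move=> tk; apply: (@le_trans _ _ (\sum_(u <- B | cone x o u) \sum_(t < k.+1) normc (cone_walk o u t h))).
  by apply: ler_sum => u _; exact: le_Fsum.
apply: (ler_sum_mem (a := fun o => \sum_(u <- B | cone x o u) \sum_(t < k.+1) normc (cone_walk o u t h))) ; last by rewrite mem_enum.
by move=> o'; exact: Fsum2_ge0.
Qed.

Lemma le_walk_mass o u t h : (t <= k)%N -> u \in B -> cone x o u -> normc (cone_walk o u t h) <= walk_mass h.
Proof.
move=> tk uB' Tu; apply: le_trans (le_walk_mass_sum o h tk).
rewrite big_mkcond; apply: (le_trans _ (ler_sum_mem (a := fun u => if cone x o u then normc (cone_walk o u t h) else 0) (i := u) _ _)) => //=; first by rewrite Tu.
by move=> j; case: ifP => _ //; exact: normc_ge0.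
Qed.

Lemma le_ball_mass h r : r \in B -> walk_mass (h * r)%g <= ball_mass h.
Proof.
by move=> rB; apply: (ler_sum_mem (a := fun r => walk_mass (h * r)%g)) => // j; exact: walk_mass_ge0.
Qed.

(** In [Duhamel] the summand 1 pays for the walks that start inside the cone below [v], and
    [k * coef_sum] for the at most [k] times of last entrance, each costing one step of weight at
    most [coef_sum]. *)
Lemma cut_bound o u v t h : (t <= k)%N -> u \in B -> cone x o u -> okh o v -> reduced v ->
  cone x (lasto o v) h ->
  normc (cone_walk o u t (ev x v * h)%g) <= (1 + k%:R * coef_sum) * ball_mass (ev x v) * walk_mass h.
Proof.
move=> tk uB' Tu ov rv Th; rewrite Duhamel //; last exact: BD'.
apply: (le_trans (le_normcD _ _)); rewrite -mulrA mulrDl mul1r; apply: lerD.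
  apply: (le_trans (normc_sum_le _ _ _)); rewrite /ball_mass mulr_suml.
  apply: (@le_trans _ _ (\sum_(u' <- B | cone x (lasto o v) u') walk_mass (ev x v * u')%g * walk_mass h)); last first.
    by apply: ler_sum_cond => j; rewrite mulr_ge0 ?walk_mass_ge0.
  rewrite big_seq_cond [leRHS]big_seq_cond; apply: ler_sum => u' /andP[u'B Tu']; rewrite normcM ler_pM ?normc_ge0 //.
    by apply: le_walk_mass.
  exact: le_walk_mass.
apply: (le_trans (normc_sum_le _ _ _)).
apply: (@le_trans _ _ (\sum_(i < t) coef_sum * (ball_mass (ev x v) * walk_mass h))); last first.
  rewrite sumr_const card_ord -mulrA -[leLHS]mulr_natl ler_wpM2r //.
    by rewrite !mulr_ge0 ?coef_sum_ge0 ?ball_mass_ge0 ?walk_mass_ge0.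
  by rewrite ler_nat.
apply: ler_sum => i _; have it := ltn_ord i; apply: (le_trans (normc_sum_le _ _ _)).
apply: (@le_trans _ _ (\sum_(u' <- B | cone x (lasto o v) u') coef_sum * ball_mass (ev x v) * normc (cone_walk (lasto o v) u' (t.-1 - i) h))); last first.
  rewrite -mulr_sumr mulrA ler_wpM2l ?mulr_ge0 ?coef_sum_ge0 ?ball_mass_ge0 //.
  by apply: le_walk_mass_sum; lia.
rewrite big_seq_cond [leRHS]big_seq_cond; apply: ler_sum => u' /andP[u'B Tu']; rewrite normcM ler_wpM2r ?normc_ge0 //.
apply: (le_trans (normc_sum_le _ _ _)); rewrite /coef_sum mulr_suml.
apply: le_trans (ler_sum_cond y (fun p => ~~ cone x (lasto o v) (u' * p.2)%g) _); last first.
  by move=> p; rewrite mulr_ge0 ?normc_ge0 ?ball_mass_ge0.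
rewrite big_seq_cond [leRHS]big_seq_cond; apply: ler_sum => p /andP[py Tp].
rewrite normcM ler_wpM2l ?normc_ge0 //.
have pB : (u' * p.2)%g \in B.
  apply: BD; have := yD py; have := len_cross gen faith Tu' Tp; rewrite mulKg => ->.
  by apply: leq_trans; rewrite leq_addl.
by apply: le_trans (le_ball_mass _ pB); apply: le_walk_mass => //; exact: ltnW (leq_trans it tk).
Qed.

(** The constant of [cut_bound] times the number of terms summed in [walk_mass]; it is polynomial in
    [k]. *)
Definition cutK : R := #|{: option (letter X)}|%:R * ((size B)%:R * (k.+1%:R * (1 + k%:R * coef_sum))).

Lemma cutK_ge0 : 0 <= cutK.
Proof. by rewrite !mulr_ge0 ?addr_ge0 ?mulr_ge0 ?coef_sum_ge0. Qed.

Lemma walk_mass_cut v h : v != [::] -> reduced (v ++ nf x h) ->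
  walk_mass (ev x v * h)%g <= cutK * ball_mass (ev x v) * walk_mass h.
Proof.
move=> vN r; have rv := reduced_catl r.
have To : forall o, cone x (lasto o v) h.
  move=> o; rewrite /cone; case: v vN r {rv} => // a v _; elim/last_ind: v => [|v b _] r.
    by move: r; rewrite /reduced /=; case: (nf x h) => //= b s /andP[].
  rewrite -cat1s -cats1 !lasto_cat /=; move: r; rewrite /reduced /= cat_path rcons_path last_rcons.
  by case: (nf x h) => //= d s /and3P[].
have nfE : nf x (ev x v * h)%g = v ++ nf x h.
  by have /andP[_ /eqP] := cone_ext gen faith (o := None) isT rv (To None).
rewrite /cutK {1}/walk_mass -!mulrA mulr_natl -sumr_const -big_enum; apply: ler_sum => o _ /=.
have [ov|nov] := boolP (okh o v); last first.
  rewrite big1 => [|u Tu].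
    by rewrite !mulr_ge0 ?addr_ge0 ?mulr_ge0 ?coef_sum_ge0 ?ball_mass_ge0 ?walk_mass_ge0.
  rewrite big1 // => t _; rewrite cone_walk_supp ?normc0 // /cone nfE.
  by case: o nov {Tu} => // a; case: (v) vN.
apply: (@le_trans _ _ (\sum_(u <- B | cone x o u) (k.+1%:R * ((1 + k%:R * coef_sum) * (ball_mass (ev x v) * walk_mass h))))); last first.
  apply: (@le_trans _ _ (\sum_(u <- B) (k.+1%:R * ((1 + k%:R * coef_sum) * (ball_mass (ev x v) * walk_mass h))))).
    apply: ler_sum_cond => _.
    by rewrite !mulr_ge0 ?addr_ge0 ?mulr_ge0 ?coef_sum_ge0 ?ball_mass_ge0 ?walk_mass_ge0.
  by rewrite big_const_seq count_predT iter_addr_0 -[leLHS]mulr_natl.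
rewrite big_seq_cond [leRHS]big_seq_cond; apply: ler_sum => u /andP[u'B Tu].
rewrite mulr_natl -[in leRHS](card_ord k.+1) -sumr_const; apply: ler_sum => t _.
by rewrite mulrA; apply: cut_bound => //; have := ltn_ord t; lia.
Qed.

Lemma walk_mass_cuts (vs : seq (seq (letter X))) : all (fun v => v != [::]) vs -> reduced (flatten vs) ->
  walk_mass (ev x (flatten vs)) <= cutK ^+ size vs * \prod_(v <- vs) ball_mass (ev x v) * walk_mass 1%g.
Proof.
elim: vs => [|v vs IH] /=; first by rewrite big_nil expr0 !mul1r.
move=> /andP[vN vsN] r; rewrite ev_cat big_cons exprS.
have rr := reduced_catr r.
apply: (le_trans (walk_mass_cut vN _)); first by rewrite (nf_ev gen faith).
rewrite [X in _ <= X * _]mulrACA -[leRHS]mulrA; apply: ler_wpM2l; last exact: IH.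
by rewrite mulr_ge0 ?cutK_ge0 ?ball_mass_ge0.
Qed.

End Walk.

(** * Square-summable bounds through finite partial sums *)

Section L2.
Variables (R : realType).

(** The squared l^2 norm is at most [c], phrased with finite sums so that no summability has to be
    discussed. *)
Definition l2b (S : eqType) (f : S -> R) (c : R) :=
  forall s : seq S, uniq s -> \sum_(h <- s) f h ^+ 2 <= c.

Lemma sqr_sum_le (I : Type) (s : seq I) (a : I -> R) :
  (\sum_(i <- s) a i) ^+ 2 <= (size s)%:R * \sum_(i <- s) a i ^+ 2.
Proof.
elim: s => [|i s IH]; first by rewrite !big_nil expr0n mulr0.
rewrite !big_cons /= -natr1; move: IH.
set u := \sum_(j <- s) a j; set w := \sum_(j <- s) a j ^+ 2; set m := (size s)%:R => IH.
have h : 2 * a i * u <= m * a i ^+ 2 + w.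
  rewrite /u /w /m; elim: (s) => [|j r IH2]; first by rewrite !big_nil mulr0 mul0r addr0.
  rewrite !big_cons /= -(natr1 (size r)); have := sqr_ge0 (a i - a j); nra.
by nra.
Qed.

Lemma l2b_sum (S : eqType) (I : eqType) (s : seq I) (P : pred I) (a : I -> S -> R) (c : R) :
  0 <= c -> (forall i, i \in s -> P i -> l2b (a i) c) ->
  l2b (fun h => \sum_(i <- s | P i) a i h) ((size s)%:R ^+ 2 * c).
Proof.
move=> c0 h r ur; pose b i h := if P i then a i h else 0.
apply: (@le_trans _ _ (\sum_(h <- r) ((size s)%:R * \sum_(i <- s) b i h ^+ 2))).
  by apply: ler_sum => g _; rewrite big_mkcond; exact: sqr_sum_le.
rewrite -mulr_sumr exchange_big /= expr2 -mulrA ler_wpM2l ?ler0n //.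
apply: (@le_trans _ _ (\sum_(i <- s) c)).
  rewrite big_seq [leRHS]big_seq; apply: ler_sum => i si; rewrite /b; case Pi: (P i).
    exact: h.
  by rewrite big1 // => *; rewrite expr0n.
by rewrite big_const_seq count_predT iter_addr_0 mulr_natl.
Qed.

Lemma l2b_inj (S S' : eqType) (g : S' -> S) (f : S -> R) c : injective g -> l2b f c -> l2b (f \o g) c.
Proof.
move=> ig h s us; have := h (map g s); rewrite map_inj_uniq // => /(_ us).
by rewrite big_map.
Qed.

Lemma l2b_le (S : eqType) (f : S -> R) c h : l2b f c -> f h ^+ 2 <= c.
Proof. by move=> /(_ [:: h] isT); rewrite big_seq1. Qed.

Lemma l2b_ge0 (S : eqType) (f : S -> R) c : l2b f c -> 0 <= c.
Proof. by move=> /(_ [::] isT); rewrite big_nil. Qed.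

Lemma l2b_mon (S : eqType) (f g : S -> R) c :
  (forall h, 0 <= g h) -> (forall h, g h <= f h) -> l2b f c -> l2b g c.
Proof.
move=> g0 gf fc s us; apply: le_trans (fc s us); apply: ler_sum => h _.
by rewrite lerXn2r ?nnegrE // (le_trans (g0 h)).
Qed.

Lemma l2b_weak (S : eqType) (f : S -> R) c c' : c <= c' -> l2b f c -> l2b f c'.
Proof. by move=> cc fc s us; apply: le_trans (fc s us) cc. Qed.
End L2.

Section WalkL2.
Variables (R : realType) (X : finType) (F : groupType) (x : X -> F).
Notation C := R[i].

Definition contr (y : seq (C * F)) := forall (f : F -> C) (c : R),
  l2b (fun h => normc (f h)) c -> l2b (fun h => normc (Rop y f h)) c.

Variables (y : seq (C * F)) (B : seq F) (k : nat).
Hypothesis y_contr : contr y.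

(** Both the contraction and the restriction to a cone do not increase the norm of the Dirac
    mass. *)
Lemma cone_walk_l2 o u t : l2b (fun h => normc (cone_walk x y o u t h)) 1.
Proof.
elim: t => [|t IH] /=.
  move=> s us; have [hin|hout] := boolP (u \in s).
    rewrite (bigD1_seq u) //= eqxx normc1 expr1n big1 ?addr0 // => h /negbTE ->.
    by rewrite normc0 expr0n.
  rewrite big_seq big1 // => h hs; case: eqP hs hout => [->|_ _ _]; first by move=> ->.
  by rewrite normc0 expr0n.
apply: l2b_mon (y_contr IH) => h; first exact: normc_ge0.
by case: ifP => // _; rewrite normc0 normc_ge0.
Qed.

Definition cntH : R := #|{: option (letter X)}|%:R * ((size B)%:R * k.+1%:R).
Definition cntG : R := (size B)%:R * cntH.

Lemma cntH_ge0 : 0 <= cntH. Proof. by rewrite !mulr_ge0. Qed.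
Lemma cntG_ge0 : 0 <= cntG. Proof. by rewrite mulr_ge0 ?cntH_ge0. Qed.

Lemma walk_mass_l2 : l2b (walk_mass x y B k) (cntH ^+ 2).
Proof.
have -> : cntH ^+ 2 = (size (enum {: option (letter X)}))%:R ^+ 2 * ((size B)%:R ^+ 2 * (k.+1%:R ^+ 2 * 1)).
  by rewrite mulr1 /cntH -cardE !exprMn.
apply: (@l2b_sum _ _ _ (enum {: option (letter X)}) predT) => [|o _ _].
  by rewrite !mulr_ge0 // sqr_ge0.
apply: l2b_sum => [|u _ _]; first by rewrite !mulr_ge0 // sqr_ge0.
have -> : k.+1%:R = (size (index_enum 'I_k.+1))%:R :> R.
  by rewrite [index_enum _]unlock -enumT size_enum_ord.
apply: (@l2b_sum _ _ _ (index_enum 'I_k.+1) predT) => // t _ _; exact: cone_walk_l2.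
Qed.

Lemma ball_mass_l2 : l2b (ball_mass x y B k) (cntG ^+ 2).
Proof.
rewrite /cntG exprMn; apply: (@l2b_sum _ _ _ B predT) => [|r _ _]; first exact: sqr_ge0.
by apply: (@l2b_inj _ _ _ (fun v => (v * r)%g)) walk_mass_l2; exact: mulIg.
Qed.

Lemma walk_mass_le h : walk_mass x y B k h <= cntH.
Proof.
have := l2b_le h walk_mass_l2; by rewrite ler_pXn2r ?nnegrE // ?cntH_ge0 // walk_mass_ge0.
Qed.
End WalkL2.

(** * Summation over words made of repeated segments *)

Section Pattern.
Variables (R : realType) (V : finType) (v0 : V) (gv : V -> R) (c2 : R).
Hypothesis gv0 : forall v, 0 <= gv v.
Hypothesis gv2 : \sum_v gv v ^+ 2 <= c2.
Hypothesis c21 : 1 <= c2.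

Lemma gv_le v : gv v <= c2.
Proof.
have h : gv v ^+ 2 <= c2.
  by apply: le_trans gv2; rewrite (bigD1 v) //= lerDl sumr_ge0 // => *; exact: sqr_ge0.
rewrite leNgt; apply/negP => lt; suff: c2 < gv v ^+ 2 by rewrite ltNge h.
by rewrite expr2 -[ltLHS]mulr1 ltr_pM // ?(lt_le_trans ltr01) // ?(le_lt_trans c21) // (le_trans ler01).
Qed.

Lemma sum_pow_le n : (1 < n)%N -> \sum_v gv v ^+ n <= c2 ^+ n.
Proof.
case: n => [|[|n]] // _; have c20 : 0 <= c2 := le_trans ler01 c21.
apply: (@le_trans _ _ (c2 ^+ n * \sum_v gv v ^+ 2)).
  rewrite mulr_sumr; apply: ler_sum => v _; rewrite -[n.+2]addn2 exprD ler_wpM2r ?sqr_ge0 //.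
  by rewrite lerXn2r ?nnegrE // gv_le.
rewrite -[n.+2]addn2 exprD ler_wpM2l ?exprn_ge0 // (le_trans gv2) // expr2.
by rewrite ler_peMl.
Qed.

(** The sum factors over the classes of [c], and a class of size [na] contributes the sum of
    [gv ^+ na], which the l^2 bound controls because [na >= 2]. Only coordinates in the image of [c]
    vary; the others are frozen at [v0], so each assignment is counted once. *)
Lemma pat_sum m (c : {ffun 'I_m -> 'I_m}) : goodpat c ->
  \sum_(v in pffun_on v0 (mem (codom c)) predT) \prod_i gv (v (c i)) <= c2 ^+ m.
Proof.
move=> gc; pose na a := #|[pred i | c i == a]|.
have prodE (g : 'I_m -> R) : \prod_i g (c i) = \prod_(a in codom c) g a ^+ na a.
  rewrite (partition_big c (mem (codom c))) /=; last by move=> i _; exact: codom_f.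
  apply: eq_bigr => a _; rewrite -prodr_const; apply: eq_big => i; first by rewrite inE.
  by move=> /eqP ->.
rewrite (eq_bigr (fun v : {ffun 'I_m -> V} => \prod_(a in codom c) gv (v a) ^+ na a)); last first.
  by move=> v _; exact: (prodE (fun a => gv (v a))).
rewrite -(big_distr_big v0 (mem (codom c)) predT (fun a x => gv x ^+ na a)).
have -> : c2 ^+ m = \prod_(a in codom c) c2 ^+ na a.
  by rewrite -(prodE (fun=> c2)) prodr_const card_ord.
apply: ler_prod => a /codomP[i ai]; rewrite sumr_ge0 => [|v _]; last by rewrite exprn_ge0.
apply: sum_pow_le; rewrite /na (cardD1 i) (_ : i \in _) ?inE ?ai //= add1n ltnS.
have /forallP/(_ i)/existsP[j /andP[ji cj]] := gc.
by apply/card_gt0P; exists j; rewrite !inE ji.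
Qed.
End Pattern.

Section KeySum.
Variables (R : realType) (S : eqType) (I : finType).
Lemma key_sum_le (s : seq S) (P : pred S) (a : S -> R) (Q : pred I) (key : I -> S) (b : I -> R) :
  uniq s -> (forall i, Q i -> 0 <= b i) ->
  (forall h, h \in s -> P h -> exists i, [/\ Q i, key i = h & a h <= b i]) ->
  \sum_(h <- s | P h) a h <= \sum_(i | Q i) b i.
Proof.
elim: s Q => [|h s IH] Q /=; first by move=> _ b0 _; rewrite big_nil sumr_ge0.
move=> /andP[hs us] b0 H; rewrite big_cons; case: ifP => Ph; last first.
  by apply: IH => // g gs; apply: H; rewrite inE gs orbT.
have [i [Qi ki ai]] := H h (mem_head _ _) Ph; rewrite (bigD1 i) //=.
apply: lerD => //; apply: IH => // [j /andP[/b0 //]|g gs Pg].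
have [|j [Qj kj aj]] := H g _ Pg; first by rewrite inE gs orbT.
exists j; split=> //; rewrite Qj; apply: contraNneq hs => ji.
by rewrite -ki -ji kj.
Qed.
End KeySum.

Definition patterned (X : finType) (m : nat) (c : {ffun 'I_m -> 'I_m}) (eps : {ffun 'I_m -> bool})
    (w : seq (letter X)) : Prop :=
  exists vs : seq (seq (letter X)),
    [/\ flatten vs = w, all (fun v => v != [::]) vs, size vs = m &
      forall i : 'I_m, nth [::] vs i = if eps i then winv (nth [::] vs (c i)) else nth [::] vs (c i)].

Definition few_segments (X : finType) (M : nat) (w : seq (letter X)) : Prop :=
  exists m : 'I_M.+1, exists c : {ffun 'I_m -> 'I_m}, exists eps : {ffun 'I_m -> bool},
    goodpat c /\ patterned c eps w.

Section UnionBound.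
Variables (R : realType) (S : eqType) (I : finType).
Lemma union_sum_le (s : seq S) (P : I -> S -> Prop) (a : S -> R) (A : R) :
  (forall h, 0 <= a h) ->
  (forall i, \sum_(h <- s | `[< P i h >]) a h <= A) ->
  \sum_(h <- s | `[< exists i, P i h >]) a h <= #|I|%:R * A.
Proof.
move=> a0 hA; apply: (@le_trans _ _ (\sum_(i : I) \sum_(h <- s | `[< P i h >]) a h)); last first.
  by rewrite mulr_natl -sumr_const; apply: ler_sum.
under [leRHS]eq_bigr do rewrite big_mkcond.
rewrite exchange_big /= big_mkcond; apply: ler_sum => h _; case: ifP => [/asboolP[i Pi]|_].
  rewrite (bigD1 i) //=; case: ifP => [_|/negbT/asboolP//].
  by rewrite lerDl sumr_ge0 // => *; case: ifP.
by rewrite sumr_ge0 // => *; case: ifP.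
Qed.
End UnionBound.

Section PatternedSum.
Variables (R : realType) (X : finType) (F : groupType) (x : X -> F).
Hypothesis gen : forall g, exists w, g = ev x w.
Hypothesis faith : forall w, reduced w -> ev x w = 1%g -> w = [::].
Notation C := R[i].
Variables (y : seq (C * F)) (D : nat) (B : seq F) (k : nat).
Hypothesis yD : forall p, p \in y -> (len x p.2 <= D)%N.
Hypothesis uB : uniq B.
Hypothesis BD : forall g, (len x g <= D)%N -> g \in B.
Hypothesis BD' : forall g, g \in B -> (len x g <= D)%N.
Hypothesis y_contr : contr y.

(** Symmetric under inversion, so one value per class bounds the factor of a segment and that of its
    inverse. The 4 in [c2] comes from (a + b)^2 <= 2 a^2 + 2 b^2. *)
Let G' v := ball_mass x y B k v + ball_mass x y B k v^-1%g.
Let c2 : R := 4 * cntG R X B k ^+ 2.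

Lemma len1 : len x 1%g = 0%N. Proof. by rewrite /len nf1. Qed.

Lemma B1 : 1%g \in B. Proof. by apply: BD; rewrite len1. Qed.

Lemma cntG_ge1 : 1 <= cntG R X B k.
Proof.
have sB : (1 <= size B)%N by have := B1; case: B.
rewrite /cntG /cntH -!natrM ler1n !muln_gt0 sB /= andbT.
by rewrite card_option.
Qed.

Lemma c2_ge1 : 1 <= c2.
Proof. by rewrite /c2; have := cntG_ge1; set c := cntG _ _ _ _ => c1; nra. Qed.

Lemma G'_l2 : l2b G' c2.
Proof.
move=> s us; have h1 := @ball_mass_l2 R X F x y B k y_contr s us.
have h2 := l2b_inj (@invg_inj F) (@ball_mass_l2 R X F x y B k y_contr) us.
apply: (@le_trans _ _ (2 * \sum_(h <- s) ball_mass x y B k h ^+ 2 + 2 * \sum_(h <- s) ball_mass x y B k h^-1%g ^+ 2)).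
  rewrite !mulr_sumr -big_split /=; apply: ler_sum => h _; rewrite /G'.
  by set a := ball_mass _ _ _ _ _; set b := ball_mass _ _ _ _ _; have := sqr_ge0 (a - b); nra.
by rewrite /= in h2; rewrite /c2; lra.
Qed.

Variables (W : seq F) (W0 : nat).
Hypothesis uW : uniq W.
Hypothesis WD : forall g, (len x g <= W0)%N -> g \in W.
Hypothesis WD' : forall g, g \in W -> (len x g <= W0)%N.

Lemma reduced_flatten (vs : seq (seq (letter X))) v : reduced (flatten vs) -> v \in vs -> reduced v.
Proof.
elim: vs => //= u vs IH r; rewrite inE => /orP[/eqP ->|vv]; first exact: reduced_catl r.
by apply: IH => //; exact: reduced_catr r.
Qed.

Lemma size_flatten_mem (vs : seq (seq (letter X))) v : v \in vs -> (size v <= size (flatten vs))%N.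
Proof.
elim: vs => //= u vs IH; rewrite inE size_cat => /orP[/eqP ->|/IH vv]; first exact: leq_addr.
by apply: (leq_trans vv); rewrite leq_addl.
Qed.

Lemma patterned_sum m (c : {ffun 'I_m -> 'I_m}) eps : goodpat c ->
  \sum_(h <- W | `[< patterned c eps (nf x h) >]) normc (cone_walk x y None 1%g k h) <=
  cutK X y B k ^+ m * c2 ^+ m * cntH R X B k.
Proof.
move=> gc; have W1 : 1%g \in W by apply: WD; rewrite len1.
pose V : finType := seq_sub W; pose v0 : V := SeqSub W1.
pose gv (v : V) := G' (ssval v).
have gv0 v : 0 <= gv v by rewrite addr_ge0 ?ball_mass_ge0.
have gv2 : \sum_v gv v ^+ 2 <= c2.
  have := @G'_l2 (map (@ssval _ W) (index_enum V)); rewrite big_map; apply.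
  by rewrite map_inj_uniq ?index_enum_uniq //; exact: val_inj.
have ps := pat_sum v0 gv0 gv2 c2_ge1 gc.
have K0 := cutK_ge0 X y B k; have H0 := cntH_ge0 R X B k.
(* An element with pattern [(c, eps)] is recovered from one group element per class. *)
pose key (v : {ffun 'I_m -> V}) := ev x (flatten [seq if eps i then winv (nf x (ssval (v (c i))))
   else nf x (ssval (v (c i))) | i <- enum 'I_m]).
apply: (@le_trans _ _ (\sum_(v in pffun_on v0 (mem (codom c)) predT)
    (cutK X y B k ^+ m * cntH R X B k * \prod_i gv (v (c i))))); last first.
  by rewrite -mulr_sumr [leRHS]mulrAC; apply: ler_wpM2l => //; rewrite mulr_ge0 ?exprn_ge0.
apply: (key_sum_le (key := key)) => //.
  by move=> v _; rewrite !mulr_ge0 ?exprn_ge0 // prodr_ge0.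
move=> h hW /asboolP[vs [fl ne sz vsE]].
have rvs i : (i < m)%N -> reduced (nth [::] vs i).
  by move=> im; apply: (@reduced_flatten vs); rewrite ?fl ?mem_nth ?sz // nf_reduced.
have inW i : (i < m)%N -> ev x (nth [::] vs i) \in W.
  move=> im; apply: WD; rewrite /len (nf_ev gen faith) ?rvs //.
  apply: leq_trans (WD' hW); rewrite /len -fl; apply: size_flatten_mem.
  by rewrite mem_nth ?sz.
pose v : {ffun 'I_m -> V} := [ffun a => if a \in codom c then insubd v0 (ev x (nth [::] vs a)) else v0].
have vc i : ssval (v (c i)) = ev x (nth [::] vs (c i)).
  by rewrite ffunE codom_f -[ssval _]/(val _) insubdK //; apply: inW.
have vsE2 : vs = [seq nth [::] vs (i : 'I_m) | i <- enum 'I_m].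
  apply: (@eq_from_nth _ [::]); first by rewrite size_map size_enum_ord.
  rewrite sz => i im; rewrite (nth_map (Ordinal im)) ?size_enum_ord //.
  by rewrite (nth_enum_ord (Ordinal im)).
exists v; split.
- apply/pffun_onP; split => //; apply/fintype.subsetP => a; rewrite !inE ffunE.
  by case: ifP => //; rewrite eqxx.
- rewrite /key -[RHS](nfK gen) -fl; congr (ev x (flatten _)); rewrite [RHS]vsE2.
  by apply: eq_map => i; rewrite vc (nf_ev gen faith) ?rvs // vsE.
rewrite -(nfK gen h) -fl.
apply: (@le_trans _ _ (walk_mass x y B k (ev x (flatten vs)))); first by apply: le_walk_mass => //; exact: B1.
apply: (le_trans (walk_mass_cuts gen faith yD uB BD BD' _ ne _)); first by rewrite fl nf_reduced.
rewrite sz mulrAC; apply: ler_pM => //.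
- by rewrite mulr_ge0 ?exprn_ge0 // walk_mass_ge0.
- by apply: prodr_ge0 => *; exact: ball_mass_ge0.
- by apply: ler_wpM2l; rewrite ?exprn_ge0 //; exact: (walk_mass_le x B k y_contr).
rewrite vsE2 big_map big_enum /=; apply: ler_prod => i _; rewrite ball_mass_ge0 /= /gv /G' vc.
rewrite [nth [::] vs i]vsE; case: ifP => _; last by rewrite lerDl ball_mass_ge0.
by rewrite ev_winv lerDr ball_mass_ge0.
Qed.

(** A union bound over the number of segments, [c] and [eps]. The base [1 + cutK] is at least 1, so
    the exponent can be raised from [m] to [M]. *)
Lemma few_segments_sum M :
  \sum_(h <- W | `[< few_segments M (nf x h) >]) normc (cone_walk x y None 1%g k h) <=
  M.+1%:R * ((M ^ M)%:R * ((2 ^ M)%:R * ((1 + cutK X y B k) ^+ M * c2 ^+ M * cntH R X B k))).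
Proof.
have K0 := cutK_ge0 X y B k; have H0 := cntH_ge0 R X B k; have c20 : 0 <= c2 := le_trans ler01 c2_ge1.
have T0 : 0 <= (1 + cutK X y B k) ^+ M * c2 ^+ M * cntH R X B k.
  by rewrite !mulr_ge0 ?exprn_ge0 // addr_ge0.
have n0 h : 0 <= normc (cone_walk x y None 1%g k h) by exact: normc_ge0.
rewrite -[in X in X%:R * _](card_ord M.+1); apply: union_sum_le => // m.
have mM : (m <= M)%N by rewrite -ltnS.
apply: (@le_trans _ _ (#|{ffun 'I_m -> 'I_m}|%:R * ((2 ^ M)%:R * ((1 + cutK X y B k) ^+ M * c2 ^+ M * cntH R X B k)))); last first.
  apply: ler_wpM2r; first by rewrite mulr_ge0.
  rewrite card_ffun !card_ord ler_nat; case: (posnP m) => [->|m0].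
    by rewrite expn0; case: (M) => // M'; rewrite expn_gt0.
  by apply: (leq_trans (leq_pexp2l m0 mM)); rewrite leq_exp2r // (leq_trans m0 mM).
apply: union_sum_le => // c.
apply: (@le_trans _ _ (#|{ffun 'I_m -> bool}|%:R * ((1 + cutK X y B k) ^+ M * c2 ^+ M * cntH R X B k))); last first.
  by apply: ler_wpM2r => //; rewrite card_ffun card_ord card_bool ler_nat leq_pexp2l.
apply: union_sum_le => // eps.
have [gc|ngc] := boolP (goodpat c); last first.
  by rewrite big1 // => h /asboolP[gc _]; case/negP: ngc.
apply: (@le_trans _ _ (\sum_(h <- W | `[< patterned c eps (nf x h) >]) normc (cone_walk x y None 1%g k h))).
  rewrite big_mkcond [leRHS]big_mkcond; apply: ler_sum => h _; case: ifP => [/asboolP[_ p]|_].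
    by rewrite asboolT.
  by case: ifP.
apply: (le_trans (patterned_sum eps gc)); apply: ler_wpM2r => //.
apply: ler_pM; rewrite ?exprn_ge0 //; last by rewrite ler_weXn2l // c2_ge1.
apply: (@le_trans _ _ ((1 + cutK X y B k) ^+ m)); last by rewrite ler_weXn2l // lerDl.
by rewrite lerXn2r ?nnegrE ?addr_ge0 // lerDr.
Qed.
End PatternedSum.

(** * Moments of random representations *)

Lemma sum_supp (V : nmodType) (S : eqType) (s1 s2 : seq S) (f : S -> V) :
  uniq s1 -> uniq s2 -> (forall h, f h != 0 -> (h \in s1) && (h \in s2)) ->
  \sum_(h <- s1) f h = \sum_(h <- s2) f h.
Proof.
move=> u1 u2 H.
have E s : \sum_(h <- s) f h = \sum_(h <- [seq h <- s | f h != 0]) f h.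
  by rewrite big_filter [RHS]big_mkcond; apply: eq_bigr => h _; case: eqP.
rewrite E [RHS]E; apply: perm_big; apply: uniq_perm; rewrite ?filter_uniq // => h.
by rewrite !mem_filter; have [|/H/andP[-> ->]] := eqVneq.
Qed.

Section Moment.
Variables (R : realType) (X : finType) (F : groupType) (x : X -> F) (fb : free_basis x).
Hypothesis faith : forall w, reduced w -> ev x w = 1%g -> w = [::].
Notation C := R[i].
Let gen := free_basis_gen fb.
Variables (ys : seq (C * F)) (D : nat).
Hypothesis yD : forall p, p \in ys -> (len x p.2 <= D)%N.
Variables (Q : finGroupType) (y : X -> Q).

Notation u k := (cone_walk x ys None 1%g k).

Lemma cone_walk_len k h : u k h != 0 -> (len x h <= k * D)%N.
Proof.
elim: k h => [|k IH] h /=; first by have [->|_] := eqVneq h 1%g; rewrite ?eqxx // /len nf1.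
apply: contraR; rewrite -ltnNge => lh; rewrite /Rop big_seq big1 // => p py.
have [->|/IH lk] := eqVneq (u k (h * p.2)%g) 0; first by rewrite mulr0.
have := lenM gen faith (h * p.2) p.2^-1; rewrite mulgK lenV // => l1.
by have := yD py; move: lh; rewrite mulSn; lia.
Qed.

Definition lin (n : nat) (psi : F -> 'M[C]_n) (z : seq (C * F)) : 'M[C]_n :=
  \sum_(p <- z) p.1 *: psi p.2.

Variables (W : seq F).
Hypothesis uW : uniq W.

(** Since [Rop] reads [f] at [h * p.2], the value [u k h] is the coefficient of the [k]-th power at
    [h^-1]. [W] only has to contain the ball that supports it. *)
Lemma lin_pow n (psi : F -> 'M[C]_n) k :
  psi 1%g = 1%:M -> (forall g h, psi (g * h)%g = psi g *m psi h) ->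
  (forall g, (len x g <= k * D)%N -> g \in W) ->
  lin psi ys ^+ k = \sum_(h <- W) u k h *: psi h^-1%g.
Proof.
move=> p1 pM; elim: k => [|k IH] WD.
  rewrite expr0 (bigD1_seq 1%g) //=; last by apply: WD; rewrite /len nf1.
  rewrite eqxx scale1r invg1 p1 big1 ?addr0 // => h /negbTE hn.
  by rewrite /= hn scale0r.
rewrite exprS IH; last by move=> g lg; apply: WD; rewrite mulSn (leq_trans lg) // leq_addl.
rewrite /lin mulr_suml /= /Rop; under [RHS]eq_bigr do rewrite scaler_suml.
rewrite [RHS]exchange_big /=; apply: eq_big_seq => p py.
rewrite -[_ * _]/(_ *m _) -scalemxAl mulmx_sumr scaler_sumr.
transitivity (\sum_(h <- [seq (h * p.2)%g | h <- W]) (p.1 * u k h) *: psi (p.2 * h^-1)%g); last first.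
  by rewrite big_map; apply: eq_bigr => h _; rewrite invgM mulVKg.
rewrite [RHS](@sum_supp _ _ _ W) //.
- by apply: eq_bigr => h _; rewrite -scalerA pM -scalemxAr.
- by rewrite map_inj_uniq //; exact: mulIg.
move=> h; have [->|/cone_walk_len lk _] := eqVneq (u k h) 0; first by rewrite mulr0 scale0r eqxx.
have yl := yD py; rewrite andbC WD /=; last by rewrite mulSn (leq_trans lk) // leq_addl.
apply/mapP; exists (h * p.2^-1)%g; last by rewrite mulgKV.
apply: WD; apply: leq_trans (lenM gen faith h p.2^-1) _.
by rewrite lenV // mulSn addnC leq_add.
Qed.

Variables (hh nb : nat).
Hypothesis hh0 : (0 < hh)%N.
Hypothesis girth : forall w, reduced w -> w != [::] -> (size w <= 2 * hh)%N -> ev y w <> 1%g.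

(** The free reduction of [winv u ++ v] is a word of length at most [2 * hh] that dies in [Q]; by
    the girth it is empty, so [u] and [v] agree already in [F]. *)
Lemma walk_uniqP q u v : reduced u -> reduced v -> (size u + size v <= 2 * hh)%N ->
  walk (stepQ y) q u = walk (stepQ y) q v -> u = v.
Proof.
move=> ru rv sz; rewrite !walkE => /mulgI e; apply: (ev_inj faith) => //.
have e1 : ev y (red (winv u ++ v)) = 1%g by rewrite ev_red ev_cat ev_winv e mulVg.
have [r0|rN] := eqVneq (red (winv u ++ v)) [::].
  have := ev_red x (winv u ++ v); rewrite r0 ev_cat ev_winv /= => e2.
  by apply: (@mulgI _ (ev x u)^-1%g); rewrite mulVg.
case: (girth _ rN _ e1); first exact: reduced_red.
by rewrite (leq_trans (size_red _)) // size_cat size_winv.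
Qed.

Definition nsegs := (nb.+1 * (nb * 2).+1).+2.

Notation signs := {ffun Q * X -> bool}.
Notation ph := (fun s : signs => phi fb y s R).

Lemma sum_tr_few h : (len x h <= nb * hh)%N -> \sum_(s : signs) \tr (ph s h) != 0 ->
  few_segments nsegs (nf x h).
Proof.
set w := nf x h => lw; have rw : reduced w by exact: nf_reduced gen h.
have hE : h = ev x w by rewrite /w nfK.
under eq_bigr do rewrite tr_phi; rewrite exchange_big /=.
move=> /eqP nz; have [q hq] : exists q : Q, \sum_(s : signs) ((q * vproj fb y s h == q)%g%:R * (-1) ^+ sgn fb y s h q : C) != 0.
  apply: contrapT => /forallNP no; apply: nz; apply: big1 => q _.
  by have /negP/negPn/eqP := no q.
have ev1 e : ~~ odd (count_mem e (epath (stepQ y) q w)).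
  apply: contraNN hq => oe; have := sum_par_eq0 R oe => s0.
  apply/eqP; transitivity ((q * ev y w == q)%g%:R * \sum_(s : signs) (-1) ^+ par s (epath (stepQ y) q w) : C).
    by rewrite mulr_sumr; apply: eq_bigr => s _; rewrite hE vproj_ev sgn_ev.
  by rewrite s0 mulr0.
(* The empty word has the pattern with no segment; it is set apart because [segmentation] needs a
   default letter [a0]. *)
case E : w => [|a0 w'].
  exists ord0; exists [ffun i => i]; exists [ffun=> false]; split.
    by apply/forallP => -[].
  by exists [::]; split=> // -[].
have twice i : (i < size w)%N -> exists j, [/\ (j < size w)%N, j != i & ed (stepQ y) q a0 w j = ed (stepQ y) q a0 w i].
  move=> il; apply: contrapT => no; have := ev1 (ed (stepQ y) q a0 w i).
  have := @epath_take _ _ (stepQ y) hh _ hh0 (leqnn _) q a0 w rw 0 (size w); rewrite drop0 take_size /pos take0 /= => -> //.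
  rewrite count_map (@eq_in_count _ _ (pred1 i)).
    by rewrite count_uniq_mem ?iota_uniq // mem_iota il.
  move=> j; rewrite mem_iota add0n => jl /=; have [->|ji] := eqVneq j i; first by rewrite eqxx.
  by apply/eqP => e; apply: no; exists j.
have [vs [fl ne sz] [c gc cP]] := @segmentation X Q (stepQ y) (stepQK y) hh _ hh0 (leqnn _) walk_uniqP q a0 w rw nb lw twice.
rewrite -E -fl; exists (Ordinal (sz : (size vs < nsegs.+1)%N)); exists c.
exists [ffun i : 'I_(size vs) => nth [::] vs i != nth [::] vs (c i)]; split=> //.
exists vs; split=> // i; rewrite ffunE; case: eqP => //= ne'.
by have [|] := cP i.
Qed.

Lemma moment_le k : (k * D <= nb * hh)%N ->
  (forall g, (len x g <= k * D)%N <-> g \in W) ->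
  normc (\sum_(s : signs) \tr (lin (ph s) ys ^+ k)) <=
  #|{: signs}|%:R * (#|Q|%:R * \sum_(h <- W | `[< few_segments nsegs (nf x h) >]) normc (u k h)).
Proof.
move=> kD WD.
have -> : \sum_(s : signs) \tr (lin (ph s) ys ^+ k) = \sum_(h <- W) u k h * \sum_(s : signs) \tr (ph s h).
  under eq_bigr => s _.
    rewrite lin_pow; [|exact: phi1|exact: phiM|by move=> g /WD].
    rewrite raddf_sum /=; under eq_bigr do rewrite mxtraceZ tr_phiV.
  over.
  by rewrite exchange_big /=; apply: eq_bigr => h _; rewrite mulr_sumr.
apply: (le_trans (normc_sum_le _ _ _)).
rewrite mulrA mulr_sumr [leRHS]big_mkcond /= big_seq [leRHS]big_seq; apply: ler_sum => h hW.
have [->|nz] := eqVneq (\sum_(s : signs) \tr (ph s h)) 0.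
  by rewrite mulr0 normc0; case: ifP => // _; rewrite !mulr_ge0 ?normc_ge0.
rewrite asboolT; last by apply: sum_tr_few => //; rewrite (leq_trans _ kD) //; exact/WD.
rewrite normcM mulrC ler_wpM2r ?normc_ge0 //.
apply: (le_trans (normc_sum_le _ _ _)); rewrite mulr_natl -sumr_const; apply: ler_sum => s _.
rewrite tr_phi; apply: (le_trans (normc_sum_le _ _ _)).
rewrite -sumr_const; apply: ler_sum => q _.
by case: eqP => _; rewrite ?mul0r ?normc0 ?ler01 // mul1r; case: sgn; rewrite ?expr1 ?normcN normc1.
Qed.
End Moment.

(** * Norms of matrices *)

Section MatrixNorm.
Local Open Scope complex_scope.
Variables (R : realType) (n : nat).
Notation C := R[i].
Implicit Types (M A B H : 'M[C]_n) (v w : 'I_n -> C).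

Definition sqnorm v : R := \sum_(i < n) normc (v i) ^+ 2.
Definition hs_sqnorm M : R := \sum_(i < n) \sum_(j < n) normc (M i j) ^+ 2.
Definition adjm M : 'M[C]_n := \matrix_(i, j) conjc (M j i).

Lemma sqnorm_ge0 v : 0 <= sqnorm v. Proof. by apply: sumr_ge0 => i _; exact: sqr_ge0. Qed.
Lemma hs_sqnorm_ge0 M : 0 <= hs_sqnorm M.
Proof. by apply: sumr_ge0 => i _; apply: sumr_ge0 => j _; exact: sqr_ge0. Qed.

(** The factor [n] is wasteful but harmless: with the factor [#|Q|] from the trace it makes up the
    |Q|^2 that disappears under the root. *)
Lemma sqnorm_mxop M v : sqnorm (mxop M v) <= n%:R * hs_sqnorm M * sqnorm v.
Proof.
rewrite /hs_sqnorm [n%:R * _]mulr_sumr mulr_suml {1}/sqnorm; apply: ler_sum => i _.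
apply: (@le_trans _ _ ((\sum_(j < n) normc (M i j) * normc (v j)) ^+ 2)).
  rewrite lerXn2r ?nnegrE ?normc_ge0 ?sumr_ge0 // => [j _|]; first by rewrite mulr_ge0 ?normc_ge0.
  by apply: (le_trans (normc_sum_le _ _ _)); apply: ler_sum => j _; rewrite normcM.
apply: (le_trans (sqr_sum_le _ _)); rewrite [size _](_ : _ = n); last first.
  by rewrite [index_enum _]unlock -enumT size_enum_ord.
rewrite -mulrA ler_wpM2l // mulr_suml; apply: ler_sum => j _.
rewrite exprMn ler_wpM2l ?sqr_ge0 // /sqnorm (bigD1 j) //= lerDl.
by apply: sumr_ge0 => *; exact: sqr_ge0.
Qed.

Lemma mxopM A B v : mxop (A *m B) v = mxop A (mxop B v).
Proof.
apply: funext => i; rewrite /mxop; under eq_bigr do rewrite mxE mulr_suml.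
rewrite exchange_big /=; apply: eq_bigr => j _; rewrite mulr_sumr.
by apply: eq_bigr => k _; rewrite mulrA.
Qed.

Lemma normc_conj (c : C) : conjc c * c = ((normc c) ^+ 2)%:C.
Proof. by rewrite mulrC -sqr_normc rmorphXn. Qed.

Lemma conj_sum (I : Type) (r : seq I) (P : pred I) (f : I -> C) :
  conjc (\sum_(i <- r | P i) f i) = \sum_(i <- r | P i) conjc (f i).
Proof. exact: (rmorph_sum (@conjc R)). Qed.

Lemma conjM (a b : C) : conjc (a * b) = conjc a * conjc b. Proof. exact: (rmorphM (@conjc R)). Qed.

Definition dotp v w : C := \sum_(i < n) conjc (v i) * w i.

Lemma dotp_sqnorm v : dotp v v = (sqnorm v)%:C.
Proof. by rewrite /sqnorm rmorph_sum /=; apply: eq_bigr => i _; exact: normc_conj. Qed.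

Lemma dotp_adj A v w : dotp (mxop A v) w = dotp v (mxop (adjm A) w).
Proof.
rewrite /dotp; under eq_bigr => i _ do rewrite {1}/mxop conj_sum mulr_suml.
rewrite exchange_big /=; apply: eq_bigr => j _; rewrite /mxop mulr_sumr.
by apply: eq_bigr => i _; rewrite mxE conjM mulrA [conjc (A i j) * _]mulrC.
Qed.

Lemma normcR (r : R) : 0 <= r -> normc r%:C = r.
Proof. by move=> r0; rewrite /normc /= expr0n /= addr0 sqrtr_sqr ger0_norm. Qed.

Lemma normc_conjc (c : C) : normc (conjc c) = normc c.
Proof. by case: c => a b; rewrite /normc /= sqrrN. Qed.

Lemma dotp_le (t : R) v w : 0 < t -> normc (dotp v w) <= 2^-1 * (t * sqnorm v + t^-1 * sqnorm w).
Proof.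
move=> t0; apply: (le_trans (normc_sum_le _ _ _)).
rewrite /sqnorm !mulr_sumr -big_split /= mulr_sumr; apply: ler_sum => i _.
rewrite normcM normc_conjc; set a := normc (v i); set b := normc (w i).
have e : 2^-1 * (t * a ^+ 2 + t^-1 * b ^+ 2) - a * b = 2^-1 * t^-1 * (t * a - b) ^+ 2.
  by field; rewrite gt_eqF.
rewrite -subr_ge0 e; apply: mulr_ge0; last exact: sqr_ge0.
by apply: mulr_ge0; rewrite invr_ge0 ?ler0n ?ltW.
Qed.

Lemma sqnorm_adj A v : (sqnorm (mxop A v))%:C = dotp v (mxop (adjm A *m A) v).
Proof. by rewrite -dotp_sqnorm dotp_adj mxopM. Qed.

Lemma adjmK A : adjm (adjm A) = A.
Proof. by apply/matrixP => i j; rewrite !mxE conjcK. Qed.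

Lemma adjmM A B : adjm (A *m B) = adjm B *m adjm A.
Proof.
apply/matrixP => i j; rewrite !mxE conj_sum; apply: eq_bigr => k _.
by rewrite !mxE conjM mulrC.
Qed.

Lemma adjmX H k : adjm H = H -> adjm (H ^+ k) = H ^+ k.
Proof.
move=> hH; elim: k => [|k IH].
  rewrite expr0; apply/matrixP => i j; rewrite !mxE eq_sym.
  by case: (i == j); rewrite ?conjc1 ?conjc0.
by rewrite exprS adjmM IH hH -[RHS]exprS exprSr.
Qed.

(* |A v|^2 = <v, A^* A v> <= (t |v|^2 + t^-1 |A^* A v|^2) / 2 *)
Lemma sqnorm_le_step (t : R) A : 0 < t ->
  (forall v, sqnorm (mxop (adjm A *m A) v) <= t ^+ 2 * sqnorm v) ->
  forall v, sqnorm (mxop A v) <= t * sqnorm v.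
Proof.
move=> t0 h v; have := dotp_le v (mxop (adjm A *m A) v) t0.
rewrite -sqnorm_adj normcR ?sqnorm_ge0 // => /le_trans; apply.
have := h v; rewrite -(@ler_pM2l _ t^-1) ?invr_gt0 // mulrA expr2 mulKf ?gt_eqF //; lra.
Qed.

Lemma tr_hs H k : adjm H = H -> \tr (H ^+ (2 * k)) = (hs_sqnorm (H ^+ k))%:C.
Proof.
move=> hH; rewrite mul2n -addnn exprD -[X in \tr (X * _)](adjmX k hH).
rewrite /mxtrace /hs_sqnorm exchange_big rmorph_sum; apply: eq_bigr => i _.
by rewrite mxE rmorph_sum; apply: eq_bigr => j _; rewrite mxE normc_conj.
Qed.

(** The crude bound is applied to the power [2 ^ j] of the self-adjoint [H]; each use of
    [sqnorm_le_step] then halves the exponent, and a last one passes from [H] to [A]. *)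
Lemma sqnorm_le_power (t : R) A j : 0 < t -> n%:R * hs_sqnorm ((adjm A *m A) ^+ (2 ^ j)) <= t ^+ (2 ^ j.+1) ->
  forall v, sqnorm (mxop A v) <= t * sqnorm v.
Proof.
set H := adjm A *m A => t0 h; have hH : adjm H = H by rewrite adjmM adjmK.
suff: forall v, sqnorm (mxop H v) <= t ^+ 2 * sqnorm v by exact: sqnorm_le_step.
suff: forall i, (i <= j)%N -> forall v, sqnorm (mxop (H ^+ (2 ^ (j - i))) v) <= t ^+ (2 ^ (j - i).+1) * sqnorm v.
  by move=> /(_ j (leqnn _)); rewrite subnn expr1.
elim=> [_ v|i IH ij].
  rewrite subn0; apply: (le_trans (sqnorm_mxop _ _)); by apply: ler_wpM2r => //; exact: sqnorm_ge0.
apply: sqnorm_le_step => [|v]; first exact: exprn_gt0.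
rewrite (adjmX _ hH) -[_ *m _]/(_ * _) -exprD addnn -mul2n -expnS.
by rewrite -exprM mulnC -expnS -subSn // subSS; apply: IH; exact: ltnW.
Qed.
End MatrixNorm.

(** * Formal sums: products, adjoints and contractions *)

Section FormalSums.
Variables (R : realType) (F : groupType).
Notation C := R[i].
Implicit Types (z a b : seq (C * F)).

Definition adjz z : seq (C * F) := [seq (conjc p.1, p.2^-1%g) | p <- z].
Definition mulz a b : seq (C * F) := [seq (p.1 * q.1, (p.2 * q.2)%g) | p <- a, q <- b].

Lemma Rop_mulz a b f h : Rop (mulz a b) f h = Rop a (Rop b f) h.
Proof.
rewrite /Rop big_allpairs_dep /=; apply: eq_bigr => p _; rewrite mulr_sumr.
by apply: eq_bigr => q _ /=; rewrite mulrA mulgA.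
Qed.

Lemma contr_mulz a b : contr a -> contr b -> contr (mulz a b).
Proof.
move=> ha hb f c fc s us; rewrite (eq_bigr (fun h => normc (Rop a (Rop b f) h) ^+ 2)).
  exact: ha (hb _ _ fc) _ us.
by move=> h _; rewrite Rop_mulz.
Qed.

(* Pairing with the truncation [v] of [Rop (adjz z) f] to [s] gives [V <= (V + c) / 2]. *)
Lemma contr_adjz z : contr z -> contr (adjz z).
Proof.
move=> cz f c fc s us.
pose v h := if h \in s then Rop (adjz z) f h else 0.
set V := \sum_(h <- s) _.
have V0 : 0 <= V by apply: sumr_ge0 => *; exact: sqr_ge0.
have vV : l2b (fun h => normc (v h)) V.
  move=> r ur; rewrite (bigID (fun h => h \in s)) /= [X in _ + X]big1 ?addr0; last first.
    by move=> h hs; rewrite /v (negbTE hs) normc0 expr0n.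
  rewrite -big_filter; apply: (@le_trans _ _ (\sum_(h <- [seq h <- s | h \in r]) normc (v h) ^+ 2)).
    rewrite le_eqVlt; apply/orP; left; apply/eqP; apply: perm_big; apply: uniq_perm; rewrite ?filter_uniq //.
    by move=> h; rewrite !mem_filter andbC.
  rewrite big_filter; apply: (@le_trans _ _ (\sum_(h <- s) normc (v h) ^+ 2)).
    by apply: ler_sum_cond => h; exact: sqr_ge0.
  by rewrite /V big_seq [leRHS]big_seq; apply: ler_sum => h hs; rewrite /v hs.
pose s' := undup [seq (h * p.2^-1)%g | h <- s, p <- z].
have us' : uniq s' by exact: undup_uniq.
have E : (V%:C)%C = \sum_(h' <- s') conjc (Rop z v h') * f h'.
  transitivity (\sum_(h <- s) \sum_(p <- z) conjc (v h) * conjc p.1 * f (h * p.2^-1)%g).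
    rewrite /V rmorph_sum /= big_seq [RHS]big_seq; apply: eq_bigr => h hs.
    rewrite -normc_conj {2}/Rop big_map mulr_sumr; apply: eq_bigr => p _ /=.
    by rewrite /v hs mulrA.
  transitivity (\sum_(p <- z) \sum_(h' <- s') conjc (v (h' * p.2)%g) * conjc p.1 * f h').
    rewrite exchange_big /=; apply: eq_big_seq => p pz.
    transitivity (\sum_(h' <- [seq (h * p.2^-1)%g | h <- s]) conjc (v (h' * p.2)%g) * conjc p.1 * f h').
      by rewrite big_map; apply: eq_bigr => h _; rewrite mulgKV.
    apply: sum_supp; [by rewrite map_inj_uniq //; exact: mulIg | exact: us' |].
    move=> h' nz; have hs : (h' * p.2)%g \in s.
      by apply: contraR nz => hs; rewrite /v (negbTE hs) conjc0 !mul0r.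
    apply/andP; split; first by apply/mapP; exists (h' * p.2)%g; rewrite ?mulgK.
    by rewrite mem_undup; apply/allpairsP; exists ((h' * p.2)%g, p); split; rewrite /= ?mulgK.
  rewrite exchange_big /=; apply: eq_bigr => h' _.
  rewrite /Rop conj_sum mulr_suml; apply: eq_bigr => p _.
  by rewrite conjM [conjc p.1 * _]mulrC.
have VE : V <= 2^-1 * (V + c).
  rewrite -{1}(normcR V0) E; apply: (le_trans (normc_sum_le _ _ _)).
  apply: (@le_trans _ _ (\sum_(h' <- s') 2^-1 * (normc (Rop z v h') ^+ 2 + normc (f h') ^+ 2))).
    apply: ler_sum => h' _; rewrite normcM normc_conjc.
    set p := normc _; set q := normc _; have := sqr_ge0 (p - q); nra.
  rewrite -mulr_sumr ler_wpM2l ?invr_ge0 ?ler0n // big_split /= lerD //; last exact: fc.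
  exact: cz vV _ us'.
lra.
Qed.

Lemma lin_mulz n (psi : F -> 'M[C]_n) a b :
  (forall g h, psi (g * h)%g = psi g *m psi h) ->
  lin psi (mulz a b) = lin psi a *m lin psi b.
Proof.
move=> pM; rewrite /lin big_allpairs_dep mulmx_suml; apply: eq_bigr => p _.
rewrite mulmx_sumr; apply: eq_bigr => q _ /=.
by rewrite pM -scalemxAl -scalemxAr scalerA.
Qed.

Lemma lin_adjz n (psi : F -> 'M[C]_n) z :
  (forall g, psi g^-1%g = adjm (psi g)) -> lin psi (adjz z) = adjm (lin psi z).
Proof.
move=> pV; rewrite /lin big_map; apply/matrixP => i j; rewrite !mxE !summxE conj_sum.
by apply: eq_bigr => p _; rewrite pV !mxE conjM.
Qed.
End FormalSums.

Section Ball.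
Variables (X : finType) (F : groupType) (x : X -> F).
Hypothesis gen : forall g, exists w, g = ev x w.

Lemma ball_exists r : exists2 B : seq F, uniq B & forall g, (g \in B) = (len x g <= r)%N.
Proof.
pose ws := flatten [seq [seq ev x (val t) | t <- enum {: i.-tuple (letter X)}] | i <- iota 0 r.+1].
exists [seq g <- undup ws | (len x g <= r)%N]; first by rewrite filter_uniq ?undup_uniq.
move=> g; rewrite mem_filter mem_undup; case: (leqP (len x g) r) => //= lr.
apply/flattenP; exists [seq ev x (val t) | t <- enum {: (len x g).-tuple (letter X)}].
  by apply/mapP; exists (len x g) => //; rewrite mem_iota.
apply/mapP; exists (in_tuple (nf x g)); first by rewrite mem_enum.
by rewrite /= nfK.
Qed.
End Ball.

(** * Polynomial against exponential growth *)

Section Growth.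
Variable R : realType.

Lemma exp_unbounded (r A : R) : 1 < r -> exists m0, forall m, (m0 <= m)%N -> A <= r ^+ m.
Proof.
move=> r1; have d0 : 0 < r - 1 by rewrite subr_gt0.
pose m0 := Num.bound (`|A| / (r - 1)); exists m0 => m mm.
have h : A <= (r - 1) * m%:R.
  apply: (le_trans (ler_norm A)); rewrite -ler_pdivrMl // mulrC ltW //.
  apply: (lt_le_trans (archi_boundP _)); first by rewrite divr_ge0 // ltW.
  by rewrite ler_nat.
apply: (le_trans h); elim: (m) => [|i IH]; first by rewrite mulr0 ler01.
have p : 1 <= r ^+ i by rewrite exprn_ege1 // ltW.
rewrite exprS -natr1; nra.
Qed.

(** With [s] the square root of [r], one factor [s ^+ m] absorbs the power [e] by induction and the
    other the additional factor [m.+1]. *)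
Lemma poly_le_exp (r A : R) e : 1 < r -> exists m0, forall m, (m0 <= m)%N -> A * m.+1%:R ^+ e <= r ^+ m.
Proof.
elim: e r A => [|e IH] r A r1; first by have [m0 h] := exp_unbounded A r1; exists m0 => m /h; rewrite expr0 mulr1.
pose s := Num.sqrt r; have r0 : 0 <= r by rewrite (le_trans ler01) // ltW.
have s1 : 1 < s by rewrite -sqrtr1 ltr_sqrt // (lt_trans ltr01).
have sE : s ^+ 2 = r by rewrite sqr_sqrtr.
have [m1 h1] := IH s `|A| s1.
have [m2 h2] : exists m2, forall m, (m2 <= m)%N -> m.+1%:R <= s ^+ m.
  pose u := Num.sqrt s; have s0 : 0 <= s by rewrite sqrtr_ge0.
  have u1 : 1 < u by rewrite -sqrtr1 ltr_sqrt // (lt_trans ltr01).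
  have uE : u ^+ 2 = s by rewrite sqr_sqrtr.
  pose dl := Num.min (u - 1) 1; have dl0 : 0 < dl by rewrite lt_min subr_gt0 u1 ltr01.
  have [m2 h] := exp_unbounded dl^-1 u1; exists m2 => m /h hm.
  have bern : dl * m.+1%:R <= u ^+ m.
    have dlu : dl <= u - 1 by rewrite ge_min lexx.
    have dl1 : dl <= 1 by rewrite ge_min lexx orbT.
    elim: (m) => [|i IHi]; first by rewrite expr0 mulr1.
    have p : 1 <= u ^+ i by rewrite exprn_ege1 // ltW.
    rewrite exprS -natr1; nra.
  rewrite -uE -exprM mulnC exprM expr2 -[leLHS](mulVKf (x := dl)) ?gt_eqF // mulrCA.
  rewrite [leLHS](_ : _ = dl^-1 * (dl * m.+1%:R)); last by rewrite mulrCA.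
  by apply: ler_pM => //; rewrite ?invr_ge0 ?mulr_ge0 // ltW.
exists (maxn m1 m2) => m; rewrite geq_max => /andP[/h1 a1 /h2 a2].
rewrite -sE -exprM mulnC exprM expr2 exprS mulrCA.
apply: (@le_trans _ _ (m.+1%:R * (`|A| * m.+1%:R ^+ e))).
  by rewrite ler_wpM2l // ler_wpM2r ?exprn_ge0 // ler_norm.
by apply: ler_pM => //; rewrite mulr_ge0 ?exprn_ge0.
Qed.
End Growth.

Section FewBound.
Variables (R : realType) (X : finType) (F : groupType) (y : seq (R[i] * F)) (B : seq F) (M : nat).

Definition few_bound (k : nat) : R :=
  M.+1%:R * ((M ^ M)%:R * ((2 ^ M)%:R *
    ((1 + cutK X y B k) ^+ M * (4 * cntG R X B k ^+ 2) ^+ M * cntH R X B k))).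

Let o : R := #|{: option (letter X)}|%:R.
Let b : R := (size B)%:R.

Definition few_const : R :=
  M.+1%:R * ((M ^ M)%:R * ((2 ^ M)%:R *
    ((1 + o * b * (1 + coef_sum y)) ^+ M * (4 * (b * (o * b)) ^+ 2) ^+ M * (o * b)))).

Lemma few_bound_ge0 k : 0 <= few_bound k.
Proof.
have K0 := cutK_ge0 X y B k; have H0 := cntH_ge0 R X B k; have G0 := cntG_ge0 R X B k.
by rewrite !mulr_ge0 ?exprn_ge0 ?mulr_ge0 ?sqr_ge0 ?addr_ge0.
Qed.

Lemma few_const_ge0 : 0 <= few_const.
Proof.
rewrite /few_const; do 3 (apply: mulr_ge0; first exact: ler0n).
apply: mulr_ge0; last by rewrite mulr_ge0 ?ler0n.
apply: mulr_ge0; apply: exprn_ge0; last by rewrite mulr_ge0 ?ler0n ?sqr_ge0.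
by rewrite addr_ge0 ?ler01 // mulr_ge0 ?addr_ge0 ?ler01 ?coef_sum_ge0 // mulr_ge0 ?ler0n.
Qed.

(** The bases [1 + cutK] and [cntG ^+ 2] are quadratic in [k] and occur to the power [M]; the factor
    [cntH] is linear. *)
Lemma few_bound_poly k : few_bound k <= few_const * k.+1%:R ^+ (4 * M + 1).
Proof.
have o0 : 0 <= o by exact: ler0n.
have b0 : 0 <= b by exact: ler0n.
have c0 := coef_sum_ge0 y; have k1 : 1 <= k.+1%:R :> R by rewrite ler1n.
have K0 := cutK_ge0 X y B k; have H0 := cntH_ge0 R X B k; have G0 := cntG_ge0 R X B k.
have kc : 1 + k%:R * coef_sum y <= k.+1%:R * (1 + coef_sum y).
  by rewrite -natr1 mulrDr mulr1 mulrDl mul1r; have : 0 <= k%:R :> R := ler0n _ _; lra.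
have h1 : 1 + cutK X y B k <= (1 + o * b * (1 + coef_sum y)) * k.+1%:R ^+ 2.
  rewrite mulrDl mul1r lerD //; first by rewrite exprn_ege1.
  rewrite /cutK -/o -/b -[leRHS]mulrA -[leRHS]mulrA; do 2 apply: ler_wpM2l => //.
  by rewrite expr2 [leRHS]mulrC -mulrA ler_wpM2l.
have h2 : 4 * cntG R X B k ^+ 2 = 4 * (b * (o * b)) ^+ 2 * k.+1%:R ^+ 2.
  by rewrite /cntG /cntH -/o -/b -mulrA -exprMn !mulrA.
have h3 : cntH R X B k = o * b * k.+1%:R by rewrite /cntH mulrA.
rewrite /few_bound /few_const; do 3 (rewrite -[leRHS]mulrA; apply: ler_wpM2l => //).
rewrite h2 h3 exprMn; set a2 := (_ * _ ^+ 2) ^+ M; set a1 := 1 + o * b * (1 + coef_sum y).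
have -> : (4 * M + 1 = 2 * M + 2 * M + 1)%N by lia.
rewrite (exprD _ (2 * M + 2 * M) 1) (exprD _ (2 * M) (2 * M)) expr1 exprM; set u := (_ ^+ 2) ^+ M.
have -> : a1 ^+ M * a2 * (o * b) * (u * u * k.+1%:R) = (a1 ^+ M * u) * (a2 * u) * (o * b * k.+1%:R) by ring.
have u0 : 0 <= u by rewrite !exprn_ge0.
have a20 : 0 <= a2 by rewrite exprn_ge0 // mulr_ge0 ?sqr_ge0.
apply: ler_wpM2r; first by rewrite !mulr_ge0.
apply: ler_wpM2r; first exact: mulr_ge0.
by rewrite -exprMn lerXn2r ?nnegrE ?(le_trans _ h1) ?addr_ge0.
Qed.
End FewBound.

Lemma average_le (R : realType) (S : finType) (f : S -> R) (c : R) : (0 < #|S|)%N ->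
  \sum_s f s <= #|S|%:R * c -> exists s, f s <= c.
Proof.
move=> S0 h; apply: contrapT => /forallNP no; have : #|S|%:R * c < \sum_s f s.
  have lt s : c < f s by rewrite ltNge; apply/negP.
  have /card_gt0P[s0 _] := S0.
  rewrite mulr_natl -sumr_const (bigD1 s0) //= [ltRHS](bigD1 s0) //= ltr_leD //.
  by apply: ler_sum => s _; exact: ltW.
by rewrite ltNge h.
Qed.

Lemma phi_adj (X : finType) (F : groupType) (x : X -> F) (fb : free_basis x)
  (Q : finGroupType) (y : X -> Q) s (R : realType) g :
  phi fb y s R g^-1%g = adjm (phi fb y s R g).
Proof.
apply/matrixP => i j; rewrite !mxE conjM (rmorph_nat (@conjc R)) (rmorphXn (@conjc R)) rmorphN1 vprojV.
have e : (enum_val i * (vproj fb y s g)^-1 == enum_val j)%g = (enum_val j * vproj fb y s g == enum_val i)%g.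
  by apply/eqP/eqP => <-; rewrite ?mulgK ?mulgKV.
rewrite e; case: eqP => [ej|]; last by rewrite !mul0r.
have := sgnM fb y s g g^-1%g (enum_val j); rewrite mulgV sgn1 ej.
by case: (sgn fb y s g _); case: sgn.
Qed.

(** * Upper bound for a finite family of contractions *)

Section Upper.
Variables (R : realType) (n : nat) (F : groupType) (x : 'I_n -> F) (fb : free_basis x).
Notation C := R[i].
Let gen := free_basis_gen fb.
Let faith := free_basis_faithful fb.

Definition sanov_group (g : nat) : finGroupType := {'GL_2['Z_(modulus n g)]}.
Definition sanov_rep (g : nat) (s : {ffun sanov_group g * 'I_n -> bool}) : F -> 'M[C]_#|sanov_group g| :=
  phi fb (@lgl n (modulus n g)) s R.

(** The average over signs is applied to the sum over [zs]. Its terms are nonnegative, so signs good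
    for the sum are good for every [z] at once. *)
Lemma rep_moment (zs : seq (seq (C * F))) (d hh j nb : nat) (B : seq F) :
  (forall z, z \in zs -> contr z) ->
  (forall z p, z \in zs -> p \in z -> (len x p.2 <= d)%N) ->
  (0 < hh)%N -> (2 ^ j.+1 * (d + d) <= nb * hh)%N ->
  uniq B -> (forall g, (g \in B) = (len x g <= d + d)%N) ->
  exists s, forall z, z \in zs ->
    hs_sqnorm ((adjm (lin (@sanov_rep (2 * hh) s) z) *m lin (@sanov_rep (2 * hh) s) z) ^+ (2 ^ j)) <=
    #|sanov_group (2 * hh)|%:R * \sum_(z <- zs) few_bound 'I_n (mulz (adjz z) z) B (nsegs nb) (2 ^ j.+1).
Proof.
move=> cz dz hh0 kD uB BE; set Q := sanov_group (2 * hh).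
pose ys (z : seq (C * F)) := mulz (adjz z) z.
pose HS (s : {ffun Q * 'I_n -> bool}) z := hs_sqnorm ((adjm (lin (sanov_rep s) z) *m lin (sanov_rep s) z) ^+ (2 ^ j)).
have HS0 s z : 0 <= HS s z by exact: hs_sqnorm_ge0.
have linE s z : adjm (lin (sanov_rep s) z) *m lin (sanov_rep s) z = lin (@sanov_rep (2 * hh) s) (ys z).
  rewrite lin_mulz; last exact: phiM.
  by rewrite lin_adjz // => g; exact: phi_adj.
have trE s z : \tr (lin (@sanov_rep (2 * hh) s) (ys z) ^+ (2 ^ j.+1)) = ((HS s z)%:C)%C.
  by rewrite -linE expnS tr_hs // adjmM adjmK.
have [W uW WE] := ball_exists gen (2 ^ j.+1 * (d + d)).
have yD z p : z \in zs -> p \in ys z -> (len x p.2 <= d + d)%N.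
  move=> zz /allpairsP[[p1 p2] [/= /mapP[p0 p0z ->] p2z ->]] /=.
  apply: leq_trans (lenM gen faith _ _) _; rewrite lenV //.
  by apply: leq_add; [exact: dz zz p0z | exact: dz zz p2z].
have bnd z : z \in zs -> \sum_(s : {ffun Q * 'I_n -> bool}) HS s z <=
    #|{: {ffun Q * 'I_n -> bool}}|%:R * (#|Q|%:R * few_bound 'I_n (ys z) B (nsegs nb) (2 ^ j.+1)).
  move=> zz; have S0 : 0 <= \sum_(s : {ffun Q * 'I_n -> bool}) HS s z by apply: sumr_ge0.
  rewrite -(normcR S0) rmorph_sum /=; under eq_bigr do rewrite -trE.
  have girth w : reduced w -> w != [::] -> (size w <= 2 * hh)%N ->
     ev (@lgl n (modulus n (2 * hh))) w <> (1%g : Q) by exact: sanov_girth.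
  have := @moment_le R _ F x fb faith (ys z) (d + d) (fun p => yD z p zz) Q _ W uW hh nb hh0 girth (2 ^ j.+1) kD _.
  move=> /(_ _)/le_trans; apply; first by move=> g; rewrite WE.
  do 2 (apply: ler_wpM2l; rewrite ?ler0n //).
  apply: (@few_segments_sum R _ F x gen faith (ys z) (d + d) B (2 ^ j.+1) (fun p => yD z p zz) uB _ _ _ W (2 ^ j.+1 * (d + d)) uW).
  - by move=> g; rewrite BE.
  - by move=> g; rewrite BE.
  - by apply: contr_mulz; [apply: contr_adjz; exact: cz | exact: cz].
  - by move=> g; rewrite WE.
  - by move=> g; rewrite WE.
have [||s hs'] := @average_le R {ffun Q * 'I_n -> bool} (fun s => \sum_(z <- zs) HS s z)
   (#|Q|%:R * \sum_(z <- zs) few_bound 'I_n (ys z) B (nsegs nb) (2 ^ j.+1)).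
- by apply/card_gt0P; exists [ffun=> false].
- rewrite exchange_big /= !mulr_sumr big_seq [leRHS]big_seq; apply: ler_sum => z; exact: bnd.
by exists s => z zz; apply: le_trans hs'; exact: (ler_sum_mem (HS0 s) zz).
Qed.

Definition card_rate := (((7 * growth n ^ 2) ^ 4) ^ 2)%N.

Lemma card_sanov_group hh : (0 < hh)%N -> (#|sanov_group (2 * hh)| ^ 2 <= card_rate ^ hh)%N.
Proof.
move=> hh0; have := card_sanov n (2 * hh); rewrite -/(sanov_group _) => h.
apply: (@leq_trans (((7 * growth n ^ (2 * hh)) ^ 4) ^ 2)%N); first by rewrite leq_exp2r.
have -> : (card_rate ^ hh = (((7 * growth n ^ 2) ^ hh) ^ 4) ^ 2)%N.
  by rewrite /card_rate -!(expnM (7 * _)); congr (_ ^ _)%N; lia.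
rewrite !leq_exp2r // expnMn -expnM leq_mul2r; apply/orP; right.
by rewrite -{1}(expn1 7) leq_pexp2l.
Qed.

(* With [k = 2^kap.+1 * 2^a], the choice of [kap] makes |Q|^2 at most [(1 + e)^(k / 2)], and the
   polynomial factor is at most [(1 + e)^(k / 2)] for [a] large. *)
Lemma rep_upper (zs : seq (seq (C * F))) (e : R) :
  (forall z, z \in zs -> contr z) -> 0 < e ->
  exists a0, forall a, (a0 <= a)%N -> exists s, forall z, z \in zs ->
    forall v, sqnorm (mxop (lin (@sanov_rep (2 * 2 ^ a) s) z) v) <= (1 + e) * sqnorm v.
Proof.
move=> cz e0; have t1 : 1 < 1 + e by rewrite ltrDl.
have [d dz] : exists d, forall z p, z \in zs -> p \in z -> (len x p.2 <= d)%N.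
  exists (\max_(p <- flatten zs) len x p.2) => z p zz pz.
  by apply: (@leq_bigmax_seq _ (flatten zs) xpredT (fun p => len x p.2)) => //; apply/flattenP; exists z.
have [B uB BE] := ball_exists gen (d + d).
have [kap hkap] := exp_unbounded (card_rate%:R) t1.
(* [nb] depends on [kap] but not on [a]: the number of segments, hence the degree of the polynomial,
   stays fixed while the girth grows. *)
pose nb := (2 ^ kap.+1 * (d + d))%N; pose M := nsegs nb.
pose Atot := \sum_(z <- zs) few_const 'I_n (mulz (adjz z) z) B M.
(* The moment has order [2 * m]; the power of 2 pays for [(2 * m).+1 <= 2 * m.+1]. *)
have [m0 hm0] := poly_le_exp (Atot * 2 ^+ (4 * M + 1)) (4 * M + 1) t1.
exists m0 => a ma; pose hh := (2 ^ a)%N; pose m := (2 ^ kap * hh)%N.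
have hh0 : (0 < hh)%N by rewrite expn_gt0.
have kE : (2 ^ (kap + a).+1 = 2 * m)%N by rewrite expnS expnD.
have kD : (2 ^ (kap + a).+1 * (d + d) <= nb * hh)%N.
  by rewrite kE /nb /m expnS -!mulnA leq_mul2l /= leq_mul2l mulnC leqnn orbT.
have [s hs'] := rep_moment cz dz hh0 kD uB BE.
exists s => z zz; apply: (@sqnorm_le_power _ _ _ _ (kap + a)); first by rewrite (lt_trans ltr01).
apply: (@le_trans _ _ (#|sanov_group (2 * hh)|%:R * (#|sanov_group (2 * hh)|%:R *
   \sum_(z <- zs) few_bound 'I_n (mulz (adjz z) z) B M (2 ^ (kap + a).+1)))).
  by rewrite ler_wpM2l // hs'.
rewrite mulrA -natrM mulnn kE (mulnC 2 m) exprM expr2.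
have m0m : (m0 <= m)%N.
  apply: (leq_trans ma); apply: (leq_trans (ltnW (ltn_expl a (isT : 1 < 2)%N))).
  by rewrite leq_pmull // expn_gt0.
apply: ler_pM; rewrite ?ler0n //.
- by apply: sumr_ge0 => *; exact: few_bound_ge0.
- apply: (@le_trans _ _ (card_rate ^ hh)%:R); first by rewrite ler_nat card_sanov_group.
  have kk : card_rate%:R <= (1 + e) ^+ (2 ^ kap) by apply: hkap; rewrite ltnW // ltn_expl.
  by rewrite /m exprM natrX lerXn2r ?nnegrE ?ler0n // (le_trans _ kk) ?ler0n.
apply: le_trans (hm0 m m0m).
apply: (@le_trans _ _ (\sum_(z <- zs) few_const 'I_n (mulz (adjz z) z) B M * ((m * 2).+1)%:R ^+ (4 * M + 1))).
  by apply: ler_sum => *; exact: few_bound_poly.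
rewrite -mulr_suml -/Atot -mulrA ler_wpM2l //.
  by apply: sumr_ge0 => *; exact: few_const_ge0.
rewrite -exprMn lerXn2r ?nnegrE ?mulr_ge0 // -natrM ler_nat; lia.
Qed.
End Upper.

(** * Operator norms *)

Section OpNorm.
Variables (R : realType) (S : choiceType).
Notation C := R[i].
Notation op := ((S -> C) -> (S -> C)).
Implicit Types (T : op) (f : S -> C) (c : R).

Lemma l2norm_le f c : 0 <= c -> (l2norm f <= c%:E)%E <-> l2b (fun h => normc (f h)) (c ^+ 2).
Proof.
move=> c0; have -> : c%:E = sqrte ((c ^+ 2)%:E) by rewrite /= sqrtr_sqr ger0_norm.
rewrite /l2norm lee_sqrt ?lee_fin ?sqr_ge0 //; split.
  move=> h s us; rewrite -lee_fin -sumEFin; apply: le_trans h; apply: esum_ge.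
  exists [set` s]%classic; first by split=> //; exact: finite_seq.
  by rewrite -fsbig_seq.
move=> h; apply: ge_ereal_sup => _ [A [fA _] <-].
by rewrite fsbig_finite //= sumEFin lee_fin; apply: h; exact: fset_uniq.
Qed.

Lemma l2norm_ge0 f : (0 <= l2norm f)%E. Proof. exact: sqrte_ge0. Qed.

Definition opb T c := forall f K,
  l2b (fun h => normc (f h)) K -> l2b (fun h => normc (T f h)) (c ^+ 2 * K).
Definition homog T := forall (a : C) f h, T (fun k => a * f k) h = a * T f h.

Lemma opnorm_le T c : 0 <= c -> opb T c -> (opnorm T <= c%:E)%E.
Proof.
move=> c0 h; apply: ge_ereal_sup => _ [f /= f1 <-].
apply/l2norm_le => //; have := h f 1; rewrite mulr1; apply.
by have /l2norm_le := f1; rewrite expr1n; apply; exact: ler01.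
Qed.

Lemma opnorm_ge0 T : (0 <= opnorm T)%E.
Proof.
apply: (le_trans (l2norm_ge0 (T (fun=> 0)))); apply: ereal_sup_ubound.
exists (fun=> 0) => //=; apply/l2norm_le; first exact: ler01.
by move=> s us; rewrite big1 ?expr1n ?ler01 // => h _; rewrite normc0 expr0n.
Qed.

(** [opnorm] tests only the unit ball, so [f] is divided by the square root of [K]. If [K = 0] then
    [f] vanishes, and homogeneity with factor 0 gives [T f = 0]. *)
Lemma opb_opnorm T c : homog T -> 0 <= c -> (opnorm T <= c%:E)%E -> opb T c.
Proof.
move=> hT c0 hn f K fK; have K0 := l2b_ge0 fK.
have [Kz|Kn] := eqVneq K 0.
  have f0 h : f h = 0.
    apply: eq0_normc; have := l2b_le h fK; rewrite Kz => h0.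
    by apply/eqP; rewrite -sqrf_eq0 eq_le h0 sqr_ge0.
  move=> s us; rewrite big1 ?mulr_ge0 ?sqr_ge0 // => h _.
  have -> : f = (fun k => 0 * f k) by apply: funext => k; rewrite f0 mul0r.
  by rewrite hT mul0r normc0 expr0n.
have Kp : 0 < K by rewrite lt0r Kn.
pose r := Num.sqrt K; have r0 : 0 < r by rewrite sqrtr_gt0.
have rE : r ^+ 2 = K by rewrite sqr_sqrtr.
pose a : C := (r^-1)%:C%C.
have aE : normc a = r^-1 by rewrite normcR // invr_ge0 ltW.
pose af k := a * f k; have : (l2norm (T af) <= c%:E)%E.
  apply: le_trans hn; apply: ereal_sup_ubound; exists af => //=.
  apply/l2norm_le; first exact: ler01.
  move=> s us; under eq_bigr do rewrite /af normcM exprMn.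
  rewrite -mulr_sumr aE exprVn rE expr1n ler_pdivrMl // mulr1; exact: fK.
move=> /(l2norm_le _ c0) h s us; have := h s us.
under eq_bigr do rewrite /af hT normcM exprMn.
by rewrite -mulr_sumr aE exprVn rE ler_pdivrMl // mulrC.
Qed.

Definition opnormR T : R := fine (opnorm T).

Lemma opnorm_fin T c : 0 <= c -> opb T c -> opnorm T = (opnormR T)%:E.
Proof.
move=> c0 h; rewrite /opnormR fineK // ge0_fin_numE ?opnorm_ge0 //.
by apply: le_lt_trans (opnorm_le c0 h) _; exact: ltry.
Qed.

Lemma opnormR_ge0 T : 0 <= opnormR T. Proof. by apply: fine_ge0; exact: opnorm_ge0. Qed.

Lemma opnormR_le T c : 0 <= c -> opb T c -> opnormR T <= c.
Proof. by move=> c0 h; rewrite -lee_fin -(opnorm_fin c0 h) opnorm_le. Qed.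

Lemma opb_rn T c : homog T -> 0 <= c -> opb T c -> opb T (opnormR T).
Proof.
by move=> hT c0 h; apply: opb_opnorm => //; rewrite ?opnormR_ge0 // (opnorm_fin c0 h).
Qed.

Lemma opb_weak T c c' : 0 <= c -> c <= c' -> opb T c -> opb T c'.
Proof.
move=> c0 cc h f K fK; apply: l2b_weak (h f K fK).
by rewrite ler_wpM2r ?(l2b_ge0 fK) // lerXn2r ?nnegrE // (le_trans c0).
Qed.

Lemma opb_ext T T' c : (forall f h, T f h = T' f h) -> opb T c -> opb T' c.
Proof.
move=> e h f K fK s us; under eq_bigr do rewrite -e; exact: h f K fK s us.
Qed.

(** The weights [c' / c] and [c / c'] in Young's inequality make the constants add up to exactly
    [c + c']; [opb_approx] later removes the positivity that the divisions impose. *)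
Lemma opb_add_pos T T' c c' : 0 < c -> 0 < c' -> opb T c -> opb T' c' ->
  opb (fun f h => T f h + T' f h) (c + c').
Proof.
move=> c0 c0' h h' f K fK s us.
apply: (@le_trans _ _ (\sum_(k <- s) ((1 + c' / c) * normc (T f k) ^+ 2 + (1 + c / c') * normc (T' f k) ^+ 2))).
  apply: ler_sum => k _; set a := T f k; set b := T' f k.
  apply: (@le_trans _ _ ((normc a + normc b) ^+ 2)).
    by rewrite lerXn2r ?nnegrE ?addr_ge0 ?normc_ge0 // le_normcD.
  have : 0 <= (c' * normc a - c * normc b) ^+ 2 / (c * c').
    by rewrite divr_ge0 ?sqr_ge0 // ltW // mulr_gt0.
  have -> : (c' * normc a - c * normc b) ^+ 2 / (c * c') =
    ((1 + c' / c) * normc a ^+ 2 + (1 + c / c') * normc b ^+ 2) - (normc a + normc b) ^+ 2.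
    by field; rewrite !gt_eqF.
  by rewrite subr_ge0.
rewrite big_split /= -!mulr_sumr.
have e : (c + c') ^+ 2 * K = (1 + c' / c) * (c ^+ 2 * K) + (1 + c / c') * (c' ^+ 2 * K).
  by field; rewrite !gt_eqF.
rewrite e; apply: lerD; apply: ler_wpM2l.
- by rewrite addr_ge0 ?ler01 ?divr_ge0 ?ltW.
- exact: h f K fK s us.
- by rewrite addr_ge0 ?ler01 ?divr_ge0 ?ltW.
exact: h' f K fK s us.
Qed.

Lemma opb_approx T c : 0 <= c -> (forall e, 0 < e -> opb T (c + e)) -> opb T c.
Proof.
move=> c0 h f K fK s us; have K0 := l2b_ge0 fK; apply/ler_addgt0Pr => d d0.
pose e := Num.min 1 (d / ((2 * c + 1) * K + 1)).
have p : 0 < (2 * c + 1) * K + 1 by rewrite ltr_wpDl // mulr_ge0 // addr_ge0 // mulr_ge0.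
have e0 : 0 < e by rewrite lt_min ltr01 divr_gt0.
apply: (le_trans (h e e0 f K fK s us)).
have e1 : e <= 1 by rewrite ge_min lexx.
have e2 : e * ((2 * c + 1) * K + 1) <= d by rewrite -ler_pdivlMr // ge_min lexx orbT.
have : e * e * K <= e * K by rewrite ler_wpM2r // ler_piMl // ltW.
nra.
Qed.

Lemma opb_add T T' c c' : 0 <= c -> 0 <= c' -> opb T c -> opb T' c' ->
  opb (fun f h => T f h + T' f h) (c + c').
Proof.
move=> c0 c0' h h'; apply: opb_approx => [|e e0]; first exact: addr_ge0.
have e2 : 0 < e / 2 by rewrite divr_gt0.
have -> : c + c' + e = (c + e / 2) + (c' + e / 2) by lra.
apply: opb_add_pos; try (by rewrite ltr_wpDl).
  by apply: (opb_weak c0 _ h); rewrite lerDl ltW.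
by apply: (opb_weak c0' _ h'); rewrite lerDl ltW.
Qed.

Lemma opb_scale T (a : C) c : opb T c -> opb (fun f h => a * T f h) (normc a * c).
Proof.
move=> h f K fK s us; under eq_bigr do rewrite normcM exprMn.
rewrite -mulr_sumr [(normc a * c) ^+ 2]exprMn -[leRHS]mulrA; apply: ler_wpM2l; first exact: sqr_ge0.
exact: h f K fK s us.
Qed.

Section Formal.
Variables (F : groupType) (rho : F -> op).
Hypothesis rho_hom : forall g, homog (rho g).
Hypothesis rho1 : forall g, opb (rho g) 1.

Definition opz (z : seq (C * F)) : op := fun f h => \sum_(p <- z) p.1 * rho p.2 f h.

Lemma opz_homog z : homog (opz z).
Proof.
move=> a f h; rewrite /opz mulr_sumr; apply: eq_bigr => p _.
by rewrite rho_hom mulrCA.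
Qed.

Lemma opz_opb z : opb (opz z) (coef_sum z).
Proof.
elim: z => [|p z IH].
  move=> f K fK s us; rewrite /coef_sum big_nil expr0n mul0r big1 // => h _.
  by rewrite /opz big_nil normc0 expr0n.
rewrite /coef_sum big_cons; apply: (@opb_ext (fun f h => p.1 * rho p.2 f h + opz z f h)).
  by move=> f h; rewrite /opz big_cons.
apply: opb_add => //; [exact: normc_ge0 | exact: coef_sum_ge0 |].
by rewrite -[normc p.1]mulr1; exact: opb_scale.
Qed.

Lemma opnorm_opz z : opnorm (opz z) = (opnormR (opz z))%:E.
Proof. exact: opnorm_fin (coef_sum_ge0 z) (opz_opb z). Qed.

Lemma opb_opz z : opb (opz z) (opnormR (opz z)).
Proof. exact: opb_rn (opz_homog z) (coef_sum_ge0 z) (opz_opb z). Qed.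

(** The norm is 1-Lipschitz in the l^1 norm of the coefficients. The triples align two formal sums
    with the same group elements. *)
Lemma opnormR_diff (ts : seq (C * C * F)) :
  opnormR (opz [seq (t.1.1, t.2) | t <- ts]) <=
  opnormR (opz [seq (t.1.2, t.2) | t <- ts]) + \sum_(t <- ts) normc (t.1.1 - t.1.2).
Proof.
set z := map _ ts; set z' := map _ ts; pose dz := [seq (t.1.1 - t.1.2, t.2) | t <- ts].
have -> : \sum_(t <- ts) normc (t.1.1 - t.1.2) = coef_sum dz by rewrite /coef_sum big_map.
apply: opnormR_le; first by rewrite addr_ge0 ?opnormR_ge0 ?coef_sum_ge0.
apply: (@opb_ext (fun f h => opz z' f h + opz dz f h)).
  move=> f h; rewrite /opz /z /z' /dz !big_map -big_split /=; apply: eq_bigr => t _.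
  by rewrite -mulrDl addrCA subrr addr0.
by apply: opb_add; [exact: opnormR_ge0 | exact: coef_sum_ge0 | exact: opb_opz | exact: opz_opb].
Qed.
End Formal.
End OpNorm.

(** * Lower bound *)

Section Regular.
Variables (R : realType) (F : groupType).
Notation C := R[i].

Lemma regular_homog (g : F) : homog (@regular_rep R F g).
Proof. by []. Qed.

Lemma regular_opb (g : F) : opb (@regular_rep R F g) 1.
Proof.
move=> f K fK; rewrite expr1n mul1r.
by apply: (@l2b_inj _ _ _ (fun h => (g^-1 * h)%g) (fun h => normc (f h))) => //; exact: mulgI.
Qed.

Definition scalez (a : C) (z : seq (C * F)) : seq (C * F) := [seq (a * p.1, p.2) | p <- z].

(** Inversion of the group exchanges the left translations of lambda with the right translations of
    [Rop] and preserves l^2 norms. *)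
Lemma contr_scalez (z : seq (C * F)) (c : R) : 0 < c ->
  opb (opz (@regular_rep R F) z) c -> contr (scalez (c^-1)%:C%C z).
Proof.
move=> c0 h f K fK.
have fK' : l2b (fun k => normc (f k^-1%g)) K.
  by apply: (@l2b_inj _ _ _ (fun k => k^-1%g) (fun k => normc (f k))) => //; exact: invg_inj.
have := h (fun k => f k^-1%g) K fK' => h'.
have h2 := l2b_inj (@invg_inj F) h'.
move=> s us; have := h2 s us => /= h3.
rewrite -[leRHS](mulKf (x := c ^+ 2)) ?expf_neq0 ?gt_eqF // -exprVn.
apply: le_trans (ler_wpM2l _ h3); last by rewrite sqr_ge0.
rewrite mulr_sumr; apply: ler_sum => k _; rewrite le_eqVlt; apply/orP; left; apply/eqP.
have -> : Rop (scalez (c^-1)%:C%C z) f k = (c^-1)%:C%C * opz (@regular_rep R F) z (fun k => f k^-1%g) k^-1%g.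
  rewrite /Rop /scalez /opz big_map mulr_sumr; apply: eq_bigr => p _ /=.
  by rewrite /regular_rep -mulrA invgM !invgK.
by rewrite normcM exprMn normcR // invr_ge0 ltW.
Qed.
End Regular.

Section Finite.
Variables (R : realType) (X : finType) (F : groupType) (x : X -> F) (fb : free_basis x).
Variables (Q : finGroupType) (y : X -> Q) (s : {ffun Q * X -> bool}).
Notation C := R[i].
Notation ph := (phi fb y s R).

Lemma mxop_phi g (v : 'I_#|Q| -> C) i :
  mxop (ph g) v i = (-1) ^+ sgn fb y s g (enum_val i) * v (enum_rank (enum_val i * vproj fb y s g)%g).
Proof.
rewrite /mxop (bigD1 (enum_rank (enum_val i * vproj fb y s g)%g)) //= big1 ?addr0.
  by rewrite mxE enum_rankK eqxx mul1r.
move=> j jn; rewrite mxE; case: eqP => [e|]; last by rewrite !mul0r.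
by rewrite e enum_valK eqxx in jn.
Qed.

Lemma mxop_homog n (A : 'M[C]_n) : homog (mxop A).
Proof. by move=> a f h; rewrite /mxop mulr_sumr; apply: eq_bigr => i _; rewrite mulrCA. Qed.

Lemma mxop_phi_opb g : opb (mxop (ph g)) 1.
Proof.
move=> f K fK; rewrite expr1n mul1r.
have inj : injective (fun i : 'I_#|Q| => enum_rank (enum_val i * vproj fb y s g)%g).
  by move=> i j /enum_rank_inj /mulIg /enum_val_inj.
apply: l2b_mon (l2b_inj inj fK) => i; first exact: normc_ge0.
rewrite mxop_phi normcM /=; case: sgn; rewrite ?expr1 ?expr0 ?normcN normc1 mul1r //.
Qed.

Lemma mxop_lin n (psi : F -> 'M[C]_n) z v i : mxop (lin psi z) v i = opz (fun g => mxop (psi g)) z v i.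
Proof.
rewrite /mxop /lin /opz; under eq_bigr do rewrite summxE mulr_suml.
rewrite exchange_big /=; apply: eq_bigr => p _; rewrite mulr_sumr; apply: eq_bigr => j _.
by rewrite mxE mulrA.
Qed.

(** The vectors [ph h] applied to one basis vector are orthonormal for [h] in [S], because [vproj]
    separates the points of [S]. *)
Lemma sqnorm_orbit (S : seq F) (w : F -> C) i0 : uniq S ->
  (forall h h', h \in S -> h' \in S -> h != h' -> vproj fb y s (h^-1 * h')%g != 1%g) ->
  sqnorm (fun i => \sum_(h <- S) w h * ph h i i0) = \sum_(h <- S) normc (w h) ^+ 2.
Proof.
move=> uS hS; have inner h h' : h \in S -> h' \in S -> \sum_i conjc (ph h i i0) * ph h' i i0 = (h == h')%:R.
  move=> hh hh'; have -> : \sum_i conjc (ph h i i0) * ph h' i i0 = ph (h^-1 * h')%g i0 i0.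
    rewrite phiM phi_adj [RHS]mxE; apply: eq_bigr => i _; congr (_ * _).
    by rewrite [RHS]mxE.
  have [->|ne] := eqVneq h h'; first by rewrite mulVg phi1 mxE eqxx.
  rewrite mxE -[X in _ == X]mulg1 (inj_eq (mulgI _)).
  by rewrite (negbTE (hS _ _ hh hh' ne)) mul0r.
suff: ((sqnorm (fun i => \sum_(h <- S) w h * ph h i i0))%:C = (\sum_(h <- S) normc (w h) ^+ 2)%:C)%C by case.
rewrite -dotp_sqnorm /dotp.
under eq_bigr do rewrite conj_sum mulr_suml.
rewrite exchange_big /= rmorph_sum /= big_seq [RHS]big_seq; apply: eq_bigr => h hh.
under eq_bigr do rewrite mulr_sumr.
rewrite exchange_big /= -normc_conj (bigD1_seq h) //= [X in _ + X]big_seq_cond [X in _ + X]big1 ?addr0.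
  under eq_bigr do rewrite conjM mulrACA.
  by rewrite -mulr_sumr inner // eqxx mulr1.
move=> h' /andP[hh' ne]; under eq_bigr do rewrite conjM mulrACA.
by rewrite -mulr_sumr inner // eq_sym (negbTE ne) mulr0.
Qed.

Lemma lin_orbit z (S S' : seq F) (w : F -> C) i0 i : uniq S -> uniq S' ->
  (forall h, w h != 0 -> h \in S) -> (forall p h, p \in z -> h \in S -> (p.2 * h)%g \in S') ->
  mxop (lin ph z) (fun i => \sum_(h <- S) w h * ph h i i0) i =
  \sum_(h <- S') opz (@regular_rep R F) z w h * ph h i i0.
Proof.
move=> uS uS' wS zS; rewrite mxop_lin /opz; under [RHS]eq_bigr do rewrite mulr_suml.
rewrite [RHS]exchange_big /=; apply: eq_big_seq => p pz.
under [RHS]eq_bigr do rewrite -mulrA; rewrite -mulr_sumr; congr (_ * _).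
transitivity (\sum_(h <- S) w h * ph (p.2 * h)%g i i0).
  rewrite /mxop; under eq_bigr do rewrite mulr_sumr.
  rewrite exchange_big /=; apply: eq_bigr => h _; rewrite phiM mxE mulr_sumr.
  by apply: eq_bigr => j _; rewrite mulrCA.
transitivity (\sum_(h <- [seq (p.2 * h)%g | h <- S]) w (p.2^-1 * h)%g * ph h i i0).
  by rewrite big_map; apply: eq_bigr => h _; rewrite mulKg.
apply: sum_supp => //; first by rewrite map_inj_uniq //; exact: mulgI.
move=> h nz; have hS : (p.2^-1 * h)%g \in S.
  by apply: wS; apply: contraNneq nz => ->; rewrite mul0r.
apply/andP; split; first by apply/mapP; exists (p.2^-1 * h)%g; rewrite ?mulKVg.
by rewrite -[h](mulKVg p.2); exact: zS.
Qed.
End Finite.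

Lemma eventually_all (I : eqType) (s : seq I) (P : I -> nat -> Prop) :
  (forall i, i \in s -> exists a0, forall a, (a0 <= a)%N -> P i a) ->
  exists a0, forall a, (a0 <= a)%N -> forall i, i \in s -> P i a.
Proof.
elim: s => [|i s IH] h; first by exists 0%N.
have [a1 h1] := h i (mem_head _ _).
have [|a2 h2] := IH; first by move=> j js; apply: h; rewrite inE js orbT.
exists (maxn a1 a2) => a; rewrite geq_max => /andP[l1 l2] j; rewrite inE => /orP[/eqP ->|js].
  exact: h1.
exact: h2.
Qed.

(** * Two-sided approximation of finitely many norms *)

Section Approximation.
Variables (R : realType) (n : nat) (F : groupType) (x : 'I_n -> F) (fb : free_basis x).
Notation C := R[i].
Let gen := free_basis_gen fb.
Let faith := free_basis_faithful fb.
Notation lam := (opz (@regular_rep R F)).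
Notation opphi g s := (opz (fun h => mxop (@sanov_rep R n F x fb g s h))).

Lemma vproj_neq1 g s h : (len x h <= g)%N -> h != 1%g ->
  vproj fb (@lgl n (modulus n g)) s h != (1%g : sanov_group n g).
Proof.
move=> lh h1; apply/eqP; rewrite -(nfK gen h) vproj_ev; apply: sanov_girth => //.
  exact: nf_reduced.
by apply: contraNneq h1 => e; rewrite -(nfK gen h) e.
Qed.

Lemma opnormR_lam_lt z r : 0 <= r -> r < opnormR (lam z) ->
  exists f K, [/\ 0 <= K, l2b (fun h => normc (f h)) K &
    exists2 A : seq F, uniq A & r ^+ 2 * K < \sum_(h <- A) normc (lam z f h) ^+ 2].
Proof.
move=> r0 rl; apply: contrapT => no; move: rl; rewrite ltNge => /negP; apply.
apply: opnormR_le => // f K fK A uA; rewrite leNgt; apply/negP => lt; apply: no.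
by exists f, K; split; [exact: l2b_ge0 fK | exact: fK | exists A].
Qed.

Lemma rep_lower (z : seq (C * F)) (e : R) : 0 < e ->
  exists a0, forall a, (a0 <= a)%N -> forall s,
    opnormR (lam z) - e <= opnormR (opphi (2 * 2 ^ a) s z).
Proof.
move=> e0; have [neg|pos] := ltP (opnormR (lam z) - e) 0.
  by exists 0%N => a _ s; rewrite (le_trans (ltW neg)) // opnormR_ge0.
have lt : opnormR (lam z) - e < opnormR (lam z) by rewrite gtrBl.
have [f [K [K0 fK [A uA hA]]]] := opnormR_lam_lt pos lt.
(* [S] contains every point at which [lam z f] reads [f] on [A], so truncation to [S] changes
   nothing on [A]; [S'] contains [A] and the support of [lam z w]. *)
pose S := undup [seq (p.2^-1 * h)%g | h <- A, p <- z].
pose w h := if h \in S then f h else 0.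
pose S' := undup (A ++ [seq (p.2 * h)%g | h <- S, p <- z]).
have uS : uniq S by exact: undup_uniq.
have uS' : uniq S' by exact: undup_uniq.
pose rho := \max_(h <- S ++ S') len x h.
have rhoP h : h \in S ++ S' -> (len x h <= rho)%N.
  by move=> hs; apply: (@leq_bigmax_seq _ (S ++ S') xpredT (fun h => len x h)).
exists rho => a ra s; set g := (2 * 2 ^ a)%N; set phi' := @sanov_rep R n F x fb g s.
(* Since [2 ^ a > a >= rho], quotients of two points of [S], or of two points of [S'], have length
   at most [g] and survive in the finite group. *)
have rg : (rho + rho <= g)%N.
  have := ltn_expl a (isT : (1 < 2)%N); rewrite /g; lia.
have sep (S0 : seq F) : {subset S0 <= S ++ S'} -> forall h h', h \in S0 -> h' \in S0 -> h != h' ->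
    vproj fb (@lgl n (modulus n g)) s (h^-1 * h')%g != (1%g : sanov_group n g).
  move=> sub h h' hS hS' ne; apply: vproj_neq1.
    apply: leq_trans (lenM gen faith _ _) _; rewrite lenV //.
    by apply: leq_trans rg; apply: leq_add; apply/rhoP/sub.
  by apply: contra ne => /eqP e1; rewrite -[h']mulg1 -[h](mulg1 h) -e1 mulVKg e1 mulg1.
pose i0 : 'I_#|sanov_group n g| := enum_rank (1%g : sanov_group n g).
pose v i := \sum_(h <- S) w h * phi' h i i0.
have nvv : sqnorm v <= K.
  rewrite /v (@sqnorm_orbit R _ F x fb _ _ s S w i0 uS); last first.
    by apply: sep => h hs; rewrite mem_cat hs.
  apply: le_trans (fK S uS); rewrite big_seq [leRHS]big_seq; apply: ler_sum => h hS.
  by rewrite /w hS.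
have vE : opphi g s z v = (fun i => \sum_(h <- S') lam z w h * phi' h i i0).
  apply: funext => i; rewrite -mxop_lin; apply: lin_orbit => //.
    by move=> h; rewrite /w; case: ifP => //; rewrite eqxx.
  move=> p h pz hS; rewrite mem_undup mem_cat; apply/orP; right.
  by apply/allpairsP; exists (h, p).
have lower : (opnormR (lam z) - e) ^+ 2 * K < sqnorm (opphi g s z v).
  rewrite vE (@sqnorm_orbit R _ F x fb _ _ s S' (lam z w) i0 uS'); last first.
    by apply: sep => h hs; rewrite mem_cat hs orbT.
  apply: (lt_le_trans hA).
  apply: (@le_trans _ _ (\sum_(h <- A) normc (lam z w h) ^+ 2)).
    rewrite big_seq [leRHS]big_seq le_eqVlt; apply/orP; left; apply/eqP.
    apply: eq_bigr => h hA'; congr (normc _ ^+ 2); rewrite /opz; apply: eq_big_seq => p pz.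
    rewrite /regular_rep /w mem_undup; congr (_ * _); case: ifP => // /negP[].
    by apply/allpairsP; exists (h, p).
  have -> : \sum_(h <- A) normc (lam z w h) ^+ 2 =
      \sum_(h <- S') (if h \in A then normc (lam z w h) ^+ 2 else 0).
    rewrite -big_mkcond -big_filter; apply: perm_big; apply: uniq_perm; rewrite ?filter_uniq //.
    move=> h; rewrite mem_filter mem_undup mem_cat; case: (h \in A) => //.
  by apply: ler_sum => h _; case: ifP => // _; exact: sqr_ge0.
have upper : sqnorm (opphi g s z v) <= opnormR (opphi g s z) ^+ 2 * K.
  have hop : opb (opphi g s z) (opnormR (opphi g s z)).
    by apply: opb_opz => h; [exact: mxop_homog | exact: mxop_phi_opb].
  have := hop v K; apply; last exact: index_enum_uniq.
  move=> r ur; apply: le_trans nvv; rewrite /sqnorm.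
  rewrite (@big_uniq _ _ _ _ r) //= big_mkcond; apply: ler_sum => i _; case: ifP => // _.
  exact: sqr_ge0.
have lt2 := lt_le_trans lower upper.
have Kp : 0 < K by rewrite lt0r K0 andbT; apply: contraTneq lt2 => ->; rewrite !mulr0 ltxx.
by move: lt2; rewrite ltr_pM2r // ltr_pXn2r ?nnegrE ?opnormR_ge0 // => /ltW.
Qed.

Lemma strong_approximation (zs : seq (seq (C * F))) (e : R) : 0 < e ->
  exists (N : nat) (phi : F -> 'M[C]_N), [/\ (0 < N)%N, hyperoctahedral_rep phi, forall g, opb (mxop (phi g)) 1 &
    forall z, z \in zs -> `|opnormR (opz (fun g => mxop (phi g)) z) - opnormR (lam z)| <= e].
Proof.
move=> e0; have e20 : 0 < e / 2 by rewrite divr_gt0.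
have [a1 h1] := eventually_all (fun z (_ : z \in zs) => rep_lower z e0).
pose Nmax := \sum_(z <- zs) opnormR (lam z) + e / 2.
have N0 : 0 < Nmax by rewrite ltr_wpDl // sumr_ge0 // => *; exact: opnormR_ge0.
(* The shift by [e / 2] makes the normalizing constant positive even when the norm vanishes. *)
pose c z := opnormR (lam z) + e / 2.
have c0 z : 0 < c z by rewrite ltr_wpDl // opnormR_ge0.
have cN z : z \in zs -> c z <= Nmax.
  by move=> zz; rewrite lerD2r; apply: (ler_sum_mem (a := fun z => opnormR (lam z))) zz => j; exact: opnormR_ge0.
(* Chosen so that [c z * e1 <= e / 2] for every [z] of the family, whatever its norm. *)
pose e1 := e / 2 / Nmax; have e10 : 0 < e1 by rewrite divr_gt0.
have lopb z : opb (lam z) (opnormR (lam z)).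
  by apply: opb_opz => g; [exact: regular_homog | exact: regular_opb].
have [|a2 h2] := @rep_upper R n F x fb [seq scalez ((c z)^-1)%:C%C z | z <- zs] e1 _ e10.
  move=> _ /mapP[z zz ->]; apply: contr_scalez => //.
  by apply: (opb_weak _ _ (lopb z)); rewrite ?opnormR_ge0 // lerDl ltW.
pose a := maxn a1 a2; have [s hs] := h2 a (leq_maxr _ _).
exists #|sanov_group n (2 * 2 ^ a)|, (@sanov_rep R n F x fb _ s); split.
- by apply/card_gt0P; exists 1%g.
- exact: hyperoctahedral_phi.
- exact: mxop_phi_opb.
move=> z zz; rewrite ler_norml; apply/andP; split.
  by have := h1 a (leq_maxl _ _) z zz s; lra.
suff : opnormR (opphi (2 * 2 ^ a) s z) <= c z * (1 + e1).
  have : c z * e1 <= e / 2.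
    by rewrite /e1 mulrCA ger_pMr // ler_pdivrMr // mul1r cN.
  rewrite mulrDr mulr1 /c; lra.
have e10' : 0 <= 1 + e1 := addr_ge0 ler01 (ltW e10).
apply: opnormR_le; first exact: mulr_ge0 (ltW (c0 z)) e10'.
move=> f K fK r ur; have K0 := l2b_ge0 fK.
pose T := opphi (2 * 2 ^ a) s z.
have nvf : sqnorm f <= K by exact: fK (index_enum_uniq _).
apply: (@le_trans _ _ (sqnorm (T f))).
  rewrite (@big_uniq _ _ _ _ r) //= /sqnorm big_mkcond; apply: ler_sum => i _; case: ifP => // _.
  exact: sqr_ge0.
have := hs _ (map_f _ zz) f.
have -> : mxop (lin (@sanov_rep R n F x fb (2 * 2 ^ a) s) (scalez ((c z)^-1)%:C%C z)) f = (fun i => ((c z)^-1)%:C%C * T f i).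
  apply: funext => i; rewrite mxop_lin /T /opz /scalez big_map mulr_sumr; apply: eq_bigr => p _ /=.
  by rewrite mulrA.
rewrite /sqnorm; under eq_bigr do rewrite normcM exprMn normcR ?invr_ge0 ?(ltW (c0 z)) //.
rewrite -mulr_sumr -/(sqnorm _) exprVn ler_pdivrMl ?exprn_gt0 // => /le_trans; apply.
(* The bound [1 + e1] concerns squared norms; it is weakened to its square, the form that [opb]
   requires. *)
rewrite [leRHS]mulrC exprMn [leRHS]mulrCA; apply: ler_wpM2l; first exact: sqr_ge0.
rewrite [leRHS]mulrC; apply: ler_pM => //.
- exact: sqnorm_ge0.
- by rewrite expr2 ler_peMl // lerDl ltW.
Qed.
End Approximation.

(** * Density of rational coefficients *)

Section Density.
Variables (R : realType) (n : nat) (F : groupType) (x : 'I_n -> F) (fb : free_basis x).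
Notation C := R[i].

Definition rational_sum (l : seq (rat * rat * seq (letter 'I_n))) : seq (C * F) :=
  [seq ((ratr t.1.1 +i* ratr t.1.2)%C, ev x t.2) | t <- l].

Definition rational_enum (m : nat) : seq (C * F) := rational_sum (odflt [::] (choice.unpickle m)).

Lemma rat_close (a e : R) : 0 < e -> exists q : rat, `|a - ratr q| <= e.
Proof.
move=> e0; have [|q] := @rat_in_itvoo R (a - e) (a + e); first by lra.
by rewrite in_itv /= => /andP[h1 h2]; exists q; rewrite ler_norml; apply/andP; split; lra.
Qed.

Lemma normc_le_sum (a b : R) : normc (a +i* b)%C <= `|a| + `|b|.
Proof.
have -> : (a +i* b)%C = (a +i* 0)%C + (0 +i* b)%C by rewrite /GRing.add /= addr0 add0r.
apply: (le_trans (le_normcD _ _)); rewrite /normc /= expr0n /= addr0 add0r.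
by rewrite !sqrtr_sqr.
Qed.

Lemma rational_dense (z : seq (C * F)) (e : R) : 0 < e ->
  exists m, exists ts : seq (C * C * F), [/\ [seq (t.1.1, t.2) | t <- ts] = z,
    [seq (t.1.2, t.2) | t <- ts] = rational_enum m & \sum_(t <- ts) normc (t.1.1 - t.1.2) <= e].
Proof.
suff: 0 < e -> exists l, exists ts : seq (C * C * F), [/\ [seq (t.1.1, t.2) | t <- ts] = z,
    [seq (t.1.2, t.2) | t <- ts] = rational_sum l & \sum_(t <- ts) normc (t.1.1 - t.1.2) <= e].
  move=> h /h[l [ts ht]]; exists (choice.pickle l), ts.
  by rewrite /rational_enum choice.pickleK.
elim: z e => [|[c g] z IH] e e0.
  by exists [::], [::]; split=> //; rewrite big_nil ltW.
have e4 : 0 < e / 4 by rewrite divr_gt0.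
have e2 : 0 < e / 2 by rewrite divr_gt0.
have [l [ts [h1 h2 h3]]] := IH _ e2; case: c => a b.
have [p hp] := rat_close a e4; have [q hq] := rat_close b e4.
have [w gw] := free_basis_gen fb g.
exists ((p, q, w) :: l), (((a +i* b)%C, (ratr p +i* ratr q)%C, g) :: ts); split.
- by rewrite /= h1.
- by rewrite /= h2 -gw.
rewrite big_cons /=; have := normc_le_sum (a - ratr p) (b - ratr q).
have -> : ((a - ratr p) +i* (b - ratr q))%C = (a +i* b)%C - (ratr p +i* ratr q)%C by [].
by move=> hn; apply: (le_trans (lerD hn h3)); move: hp hq; lra.
Qed.
End Density.

Lemma dist_transfer (R : realType) (N N' r r' s s' t e : R) :
  N <= N' + s -> N' <= N + s' -> r <= r' + s -> r' <= r + s' ->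
  s <= e / 4 -> s' <= e / 4 -> t <= e / 4 -> 0 < e -> `|r' - N'| <= t -> `|N - r| <= e.
Proof.
rewrite !ler_norml => *; apply/andP; split; lra.
Qed.

(** * From rational sums to all of C[F] *)

Section Convergence.
Variables (R : realType) (F : groupType).
Notation C := R[i].
Notation lam := (opz (@regular_rep R F)).

Definition terms (z : group_algebra R F) : seq (C * F) := [seq (z g, g) | g <- finsupp z].

Lemma linear_extension_terms n (phi : F -> 'M[C]_n) (z : group_algebra R F) :
  mxop (linear_extension phi z) = opz (fun g => mxop (phi g)) (terms z).
Proof.
apply: funext => v; apply: funext => i; rewrite -mxop_lin.
by rewrite /linear_extension /lin /terms big_map.
Qed.

Lemma regular_extension_terms (z : group_algebra R F) :
  linear_extension (@regular_rep R F) z = lam (terms z).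
Proof.
apply: funext => f; apply: funext => h.
by rewrite /linear_extension /opz /terms big_map !fct_sumE.
Qed.

Lemma converges_of_rational n (x : 'I_n -> F) (fb : free_basis x) (N : nat -> nat)
    (phi : forall i, F -> 'M[C]_(N i)) :
  (forall i g, opb (mxop (phi i g)) 1) ->
  (forall i m, (m <= i)%N ->
     `|opnormR (opz (fun g => mxop (phi i g)) (rational_enum R x m)) - opnormR (lam (rational_enum R x m))| <= i.+1%:R^-1) ->
  strongly_converges_to_regular phi.
Proof.
move=> phi1 happ z; rewrite regular_extension_terms.
have lam1 (g : F) : opb (@regular_rep R F g) 1 by exact: regular_opb.
have lamh (g : F) : homog (@regular_rep R F g) by exact: regular_homog.
have phih i g : homog (mxop (phi i g)) by exact: mxop_homog.
rewrite opnorm_opz //.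
under eq_fun do rewrite linear_extension_terms opnorm_opz //.
apply: cvg_EFin; first by near=> i.
apply/cvgrPdist_le => e e0.
have e4 : 0 < e / 4 by rewrite divr_gt0.
have [m [ts [h1 h2 h3]]] := rational_dense fb (terms z) e4.
(* [opnormR_diff] is one-sided, so the list with exchanged coefficients supplies the reverse
   inequalities. *)
have h3' : \sum_(t <- [seq (t.1.2, t.1.1, t.2) | t <- ts]) normc (t.1.1 - t.1.2) <= e / 4.
  by apply: le_trans h3; rewrite big_map; apply: ler_sum => t _; rewrite -opprB normcN.
have m1 : [seq (t.1.1, t.2) | t <- [seq (t.1.2, t.1.1, t.2) | t <- ts]] = rational_enum R x m.
  by rewrite -map_comp -h2.
have m2 : [seq (t.1.2, t.2) | t <- [seq (t.1.2, t.1.1, t.2) | t <- ts]] = terms z.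
  by rewrite -map_comp -h1.
near=> i.
have mi : (m <= i)%N by near: i; exact: nbhs_infty_ge.
have ie : i.+1%:R^-1 <= e / 4.
  by near: i; apply: filterS (near_infty_natSinv_lt (PosNum e4)) => j /ltW.
rewrite /=.
have a1 := opnormR_diff lamh lam1 ts; have a2 := opnormR_diff lamh lam1 [seq (t.1.2, t.1.1, t.2) | t <- ts].
have b1 := opnormR_diff (phih i) (phi1 i) ts; have b2 := opnormR_diff (phih i) (phi1 i) [seq (t.1.2, t.1.1, t.2) | t <- ts].
rewrite h1 h2 in a1 b1; rewrite m1 m2 in a2 b2.
exact: dist_transfer a1 a2 b1 b2 h3 h3' ie e0 (happ i m mi).
Unshelve. all: by end_near. Qed.
End Convergence.

Theorem theorem1p5 (R : realType) (F : groupType)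
    (freeF : free_group F) (fgF : finitely_generated F) :
  exists (n : nat -> nat) (phi : forall i : nat, F -> 'M[R[i]]_(n i)),
    (forall i : nat, (0 < n i)%N) /\
    (forall i : nat, hyperoctahedral_rep (phi i)) /\
    strongly_converges_to_regular phi.
Proof.
have [n [x fb]] := finite_free_basis freeF fgF.
(* Index [i] handles the rational sums numbered 0 to [i] with error [1 / (i + 1)], so each fixed
   rational sum is controlled from some index on. *)
have H i : exists p : {N : nat & F -> 'M[R[i]]_N}, [/\ (0 < projT1 p)%N, hyperoctahedral_rep (projT2 p),
    forall g, opb (mxop (projT2 p g)) 1 & forall m, (m <= i)%N ->
    `|opnormR (opz (fun g => mxop (projT2 p g)) (rational_enum R x m)) - opnormR (opz (@regular_rep R F) (rational_enum R x m))|
      <= i.+1%:R^-1].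
  have i0 : 0 < i.+1%:R^-1 :> R by rewrite invr_gt0 ltr0n.
  have [N [phi [p1 p2 p3 p4]]] := @strong_approximation R n F x fb [seq rational_enum R x m | m <- iota 0 i.+1] _ i0.
  exists (existT _ N phi); split=> // m mi; apply: p4; apply: map_f.
  by rewrite mem_iota.
have [p hp] := choice H.
exists (fun i => projT1 (p i)), (fun i => projT2 (p i)); split=> [i|]; first by have [] := hp i.
split=> [i|]; first by have [] := hp i.
apply: (converges_of_rational fb) => [i|i]; first by have [] := hp i.
by have [_ _ _] := hp i.
Qed.
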